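(* Let $T>0$, $d\ge1$, $p\in[1,\infty)$. Let $\nu_{[0,T]}\in\mathcal{P}_p(C([0,T],\mathbb{R}^d))$ satisfy $\mathbb{E}_{\nu_{[0,T]}}\big[e^{\alpha\sup_{0\le t\le T}|\mathsf{X}_t|^p}\big]<\infty$ for every $\alpha>0$, and let $\Psi:\mathcal{P}_p(\mathbb{R}^d)\to\mathbb{R}$ be lower semi-continuous. Let $\mu^{\mathrm{ini}},\mu^{\mathrm{fin}}\in\mathcal{P}_p(\mathbb{R}^d)$ be such that $\nu_{0,T}\sim\mu^{\mathrm{ini}}\otimes\mu^{\mathrm{fin}}$ (mutual absolute continuity), where $\nu_{0,T}$ is the law of $(\mathsf{X}_0,\mathsf{X}_T)$ under $\nu_{[0,T]}$. Consider the problem $$\inf\big\{H(\mu_{[0,T]}|\nu_{[0,T]})\ :\ \mu_{[0,T]}\in\mathcal{P}_p(C([0,T],\mathbb{R}^d)),\ \mu_0=\mu^{\mathrm{ini}},\ \mu_T=\mu^{\mathrm{fin}},\ \forall t\in[0,T],\ \Psi(\mu_t)\le0\big\}.\qquad(\ast)$$ 1. If the infimum in $(\ast)$ is finite, then it is reached at some $\overline\mu_{[0,T]}$ which satisfies $\overline\mu_0=\mu^{\mathrm{ini}}$, $\overline\mu_T=\mu^{\mathrm{fin}}$, and $\Psi(\overline\mu_t)\le0$ for any $t\in[0,T]$. Moreover, if $\Psi$ is convex, this minimiser is unique. 2. Let $\overline\mu_{[0,T]}$ be a minimiser of $(\ast)$ such that: (i) $\Psi$ is continuous on $\mathcal{P}_p(\mathbb{R}^d)$;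 (ii) for every $t\in[0,T]$, $\Psi$ is differentiable at $\overline\mu_t$ w.r.t. the set of directions $\mathcal{P}_p(\mathbb{R}^d)$, uniformly in $t$ in the sense that for any $\mu_{[0,T]}\in\mathcal{P}_p(C([0,T],\mathbb{R}^d))$, $$\lim_{\varepsilon\to0^+}\sup_{t\in[0,T]}\left|\frac{\Psi((1-\varepsilon)\overline\mu_t+\varepsilon\mu_t)-\Psi(\overline\mu_t)}{\varepsilon}-\Big\langle\mu_t-\overline\mu_t,\frac{\delta\Psi}{\delta\mu}(\overline\mu_t)\Big\rangle\right|=0;$$ (iii) $(t,x)\mapsto\frac{\delta\Psi}{\delta\mu}(\overline\mu_t,x)$ is continuous on $[0,T]\times\mathbb{R}^d$; (iv) there is $D^\Psi\in[0,\infty)$ such that $\sup_{t\in[0,T]}|\frac{\delta\Psi}{\delta\mu}(\overline\mu_t,x)|\le D^\Psi[1+|x|^p]$ for all $x\in\mathbb{R}^d$; (v) there exist $\tilde\mu_{[0,T]}\in\mathcal{P}_p(C([0,T],\mathbb{R}^d))$ with $H(\tilde\mu_{[0,T]}|\nu_{[0,T]})<\infty$, $\tilde\mu_0=\mu^{\mathrm{ini}}$, $\tilde\mu_T=\mu^{\mathrm{fin}}$, and $\tilde\varepsilon>0$ such that $\Psi(\overline\mu_t)+\tilde\varepsilon\langle\tilde\mu_t-\overline\mu_t,\frac{\delta\Psi}{\delta\mu}(\overline\mu_t)\rangle<0$ for all $t\in[0,T]$. Then there exist a positive Radon measure $\overline\lambda\in\mathcal{M}_+([0,T])$ and measurable $\overline\zeta_0,\overline\zeta_T:\mathbb{R}^d\to\mathbb{R}$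 such that $$\frac{d\overline\mu_{[0,T]}}{d\nu_{[0,T]}}(x_{[0,T]})=\overline Z^{-1}\exp\Big[-\overline\zeta_0(x_0)-\overline\zeta_T(x_T)-\int_{[0,T]}\frac{\delta\Psi}{\delta\mu}(\overline\mu_t,x_t)\,\overline\lambda(dt)\Big],$$ where $\overline Z\in(0,\infty)$ is a normalising constant, and $\Psi(\overline\mu_t)=0$ for $\overline\lambda$-a.e. $t\in[0,T]$.
   Context: $C([0,T],\mathbb{R}^d)$ is the space of continuous paths $x_{[0,T]}=(x_t)_{t\in[0,T]}$ with the sup norm; $\mathsf{X}_t:x_{[0,T]}\mapsto x_t$ are the coordinate maps. For a normed space, $\mathcal{P}_p$ denotes the set of Borel probability measures with finite $p$-th moment of the norm, with the topology of the Wasserstein distance $W_p$. For $\mu_{[0,T]}\in\mathcal{P}_p(C([0,T],\mathbb{R}^d))$, $\mu_t$ is the law of $\mathsf{X}_t$ under $\mu_{[0,T]}$. $\langle\mu,f\rangle:=\int f\,d\mu$. $H(\mu|\nu):=\int\log\frac{d\mu}{d\nu}d\mu$ if $\mu\ll\nu$, $+\infty$ otherwise. $\mathcal{M}_+([0,T])$ is the cone of (finite) positive Radon measures on $[0,T]$. Linear functional derivative: $\Psi:\mathcal{P}_p(\mathbb{R}^d)\to\mathbb{R}$ is differentiable at $\mu$ w.r.t. the set of directions $\mathcal{P}_p(\mathbb{R}^d)$ if there is a measurable $\frac{\delta\Psi}{\delta\mu}(\mu):\mathbb{R}^d\to\mathbb{R}$, $x\mapsto\frac{\delta\Psi}{\delta\mu}(\mu,x)$,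 such that for every $\mu'\in\mathcal{P}_p(\mathbb{R}^d)$ it is $\mu'$-integrable and $\varepsilon^{-1}[\Psi((1-\varepsilon)\mu+\varepsilon\mu')-\Psi(\mu)]\to\langle\mu'-\mu,\frac{\delta\Psi}{\delta\mu}(\mu)\rangle$ as $\varepsilon\to0^+$. It is normalised by $\langle\mu,\frac{\delta\Psi}{\delta\mu}(\mu)\rangle=0$.
   Formalization: In item 2 a minimiser of (∗) is required to have a finite infimum; if the infimum is +∞, every admissible path law attains it, and such a law may fail to be absolutely continuous with respect to ν, so the density formula can fail. *)

(* Defs.v *)
From HB Require Import structures.
From mathcomp Require Import all_boot all_order all_algebra.
From mathcomp Require Import all_classical all_reals all_analysis.
From mathcomp Require Import measurable_realfun giry.
Set Implicit Arguments.
Unset Strict Implicit.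
Unset Printing Implicit Defensive.
Import Order.TTheory GRing.Theory Num.Theory.
Import numFieldNormedType.Exports.
Local Open Scope classical_set_scope.
Local Open Scope ring_scope.
Local Open Scope charge_scope.

Notation borel X := (g_sigma_algebraType (@open X)).

Lemma continuous_borel_measurable (X Y : ptopologicalType) (f : X -> Y) :
  continuous f -> measurable_fun setT (f : borel X -> borel Y).
Proof.
move=> /continuousP cf.
apply: (@measurability _ _ (borel X) (borel Y) setT f (@open Y)) => //.
move=> _ [B oB <-]; rewrite setTI; apply: sub_sigma_algebra; exact: cf.
Qed.

Lemma continuous_borel_measurableR (R : realType) (X : ptopologicalType)
    (f : X -> R) :
  continuous f -> measurable_fun setT (f : borel X -> R).
Proof.
move=> /continuousP cf.
apply: (measurability _ (RGenOpens.measurableE R)).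
move=> _ [_ [a [b ->] <-]].
by rewrite setTI; apply: sub_sigma_algebra; apply: cf; exact: interval_open.
Qed.

(* The Euclidean norm |x|.  The library's norm on 'rV[R]_d is the max norm,
   which induces the same topology, hence the same Borel sets. *)
Definition enorm (R : realType) (d : nat) (x : 'rV[R]_d) : R :=
  Num.sqrt (\sum_(i < d) x ord0 i ^+ 2).

Lemma enorm_continuous (R : realType) (d : nat) : continuous (@enorm R d).
Proof.
have cs : continuous (fun x : 'rV[R]_d => \sum_(i < d) x ord0 i ^+ 2).
  apply: (@continuous_big R _ +%R 0 xpredT _ _ (index_enum _)
    (fun (i : 'I_d) (x : 'rV[R]_d) => x ord0 i ^+ 2)); first exact: add_continuous.
  move=> i _ y.
  apply: (@continuous_comp _ _ _ (fun x : 'rV[R]_d => x ord0 i)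
    (fun u : R => u ^+ 2)); last exact: exprn_continuous.
  exact: coord_continuous.
move=> x; apply: (@continuous_comp _ _ _ _ (@Num.sqrt R)); first exact: cs.
exact: sqrt_continuous.
Qed.

Lemma measurable_enorm_powR (R : realType) (d : nat) (p : R) :
  @measurable_fun _ _ (borel 'rV[R]_d) (\bar R) setT
    (fun x => (enorm x `^ p)%:E).
Proof.
apply/measurable_EFinP; apply: (measurableT_comp (measurable_powR p)).
apply: (@continuous_borel_measurableR R 'rV[R]_d); exact: enorm_continuous.
Qed.

Definition time (R : realType) (T : {posnum R}) : Type :=
  set_type `[0, T%:num]%classic.

HB.instance Definition _ (R : realType) (T : {posnum R}) :=
  PseudoMetric.on (time T).

Fact time_ini_subproof (R : realType) (T : {posnum R}) :
  (0 : R) \in `[0, T%:num]%classic.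
Proof. by rewrite inE /= in_itv /= lexx ge0. Qed.

Fact time_fin_subproof (R : realType) (T : {posnum R}) :
  T%:num \in `[0, T%:num]%classic.
Proof. by rewrite inE /= in_itv /= lexx ge0. Qed.

Definition time_ini (R : realType) (T : {posnum R}) : time T :=
  SigSub (time_ini_subproof T).

Definition time_fin (R : realType) (T : {posnum R}) : time T :=
  SigSub (time_fin_subproof T).

HB.instance Definition _ (R : realType) (T : {posnum R}) :=
  isPointed.Build (time T) (time_ini T).

(* C([0,T], R^d), with the topology of uniform convergence. *)
Definition path_space (R : realType) (T : {posnum R}) (d : nat) : Type :=
  continuousType (time T) 'rV[R]_d.

HB.instance Definition _ (R : realType) (T : {posnum R}) (d : nat) :=
  Uniform.copy (path_space T d)
    (initial_topology
      (id : continuousType (time T) 'rV[R]_d ->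
            arrow_uniform_type (time T) 'rV[R]_d)).

Fact zero_path_continuous (R : realType) (T : {posnum R}) (d : nat) :
  continuous (fun _ : time T => 0 : 'rV[R]_d).
Proof. exact: cst_continuous. Qed.

HB.instance Definition _ (R : realType) (T : {posnum R}) (d : nat) :=
  isPointed.Build (path_space T d)
    (mkcts (@zero_path_continuous R T d)).

(* The coordinate map X_t. *)
Definition coord_at (R : realType) (T : {posnum R}) (d : nat) (t : time T)
    (x : path_space T d) : 'rV[R]_d :=
  (x : continuousType (time T) 'rV[R]_d) t.

Definition supnorm (R : realType) (T : {posnum R}) (d : nat)
    (x : path_space T d) : R :=
  sup (range (fun t : time T => enorm (coord_at t x))).

Lemma coord_at_continuous (R : realType) (T : {posnum R}) (d : nat)
  (t : time T) : continuous (@coord_at R T d t).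
Proof.
move=> x.
apply: (@continuous_comp _ _ _
  ((fun x => x : continuousType _ _) : path_space T d ->
     arrow_uniform_type (time T) 'rV[R]_d)
  (fun f : arrow_uniform_type (time T) 'rV[R]_d => f t)).
  exact: initial_continuous.
move=> A /nbhsP [E entE EA].
have : nbhs (x : arrow_uniform_type (time T) 'rV[R]_d)
    [set g | forall s, E ((x : continuousType _ _) s, g s)].
  apply/nbhsP; exists [set fg | forall s, E (fg.1 s, fg.2 s)]; first by exists E.
  by move=> g /xsectionP.
by apply: filterS => g /(_ t) Eg; apply: EA; apply/xsectionP.
Qed.

Lemma supnorm_has_sup (R : realType) (T : {posnum R}) (d : nat)
  (x : path_space T d) :
  has_sup (range (fun t : time T => enorm (coord_at t x))).
Proof.
pose f (s : time T) := enorm (coord_at s x).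
have cf : continuous f.
  move=> s; apply: (@continuous_comp _ _ _
    (x : continuousType (time T) 'rV[R]_d) (@enorm R d)).
    exact: cts_fun.
  exact: enorm_continuous.
have /subspace_valL_continuousP'-/(_ 0) cf' := cf.
have [c _ cmax] := EVT_max (ltW [gt0 of T%:num]) cf'.
split; first by exists (f (time_ini T)); exists (time_ini T).
exists ('valL_0 f c) => _ [s _ <-].
have := cmax (\val s) (set_valP s).
by rewrite -[X in X <= _]/(sigL _ ('valL_0 f) s) valLK.
Qed.

Lemma enorm_le_supnorm (R : realType) (T : {posnum R}) (d : nat) (t : time T)
  (x : path_space T d) : enorm (coord_at t x) <= supnorm x.
Proof.
by apply: sup_upper_bound; [exact: supnorm_has_sup|exists t].
Qed.

Lemma measurable_supnorm (R : realType) (T : {posnum R}) (d : nat) :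
  measurable_fun setT (@supnorm R T d : borel (path_space T d) -> R).
Proof.
apply: (measurability _ (RGenOInfty.measurableE R)) => _ [_ [a ->] <-].
rewrite setTI; apply: sub_sigma_algebra.
have -> : @supnorm R T d @^-1` `]a, +oo[ =
    \bigcup_(t in [set: time T]) [set x | a < enorm (coord_at t x)].
  apply/seteqP; split => x /=; rewrite in_itv /= andbT.
    move=> /(sup_gt (proj1 (supnorm_has_sup x)))[_ [t _ <-] at_].
    by exists t.
  by move=> [t _ /= /lt_le_trans]; apply; exact: enorm_le_supnorm.
apply: bigcup_open => t _.
have /continuousP/(_ `]a, +oo[%classic) : continuous (fun x : path_space T d =>
    enorm (coord_at t x)).
  move=> x; apply: (@continuous_comp _ _ _ (@coord_at R T d t) (@enorm R d)).
    exact: coord_at_continuous.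
  exact: enorm_continuous.
rewrite (_ : _ @^-1` _ = [set x | a < enorm (coord_at t x)]); last first.
  by apply/seteqP; split => x /=; rewrite in_itv /= andbT.
by apply; exact: interval_open.
Qed.

(* Probability measures with finite p-th moment of the norm N; a library
   measure is a function on all sets, so equality of laws has to be stated
   with ≡μ, i.e., on measurable sets only. *)
Record wprob (dX : measure_display) (X : measurableType dX) (R : realType)
    (N : X -> R) (p : R) := WProb {
  wprob_prob :> probability X R;
  wprob_moment : (\int[wprob_prob]_x (N x `^ p)%:E < +oo)%E }.

Definition P_Rd (R : realType) (d : nat) (p : R) : Type :=
  @wprob _ (borel 'rV[R]_d) R (@enorm R d) p.

Definition P_path (R : realType) (T : {posnum R}) (d : nat) (p : R) : Type :=
  @wprob _ (borel (path_space T d)) R (@supnorm R T d) p.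

Definition coupling (dX : measure_display) (X : measurableType dX)
    (R : realType) (mu nu : probability X R) (pi : probability (X * X)%type R) :
    Prop :=
  (forall A, measurable A -> pi (fst @^-1` A) = mu A) /\
  (forall A, measurable A -> pi (snd @^-1` A) = nu A).

Definition wasserstein (R : realType) (d : nat) (p : R)
    (mu nu : probability (borel 'rV[R]_d) R) : \bar R :=
  poweR (ereal_inf [set (\int[pi]_z (enorm (z.1 - z.2) `^ p)%:E)%E
                   | pi in coupling mu nu]) p^-1.

(* The metric topology of W_p: a set is open when it contains a W_p-ball
   around each of its points. *)
Definition wasserstein_open (R : realType) (d : nat) (p : R)
    (U : set (P_Rd d p)) : Prop :=
  forall mu, U mu -> exists2 e : R, 0 < e &
    forall nu : P_Rd d p, (wasserstein p mu nu < e%:E)%E -> U nu.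

Fact wasserstein_openT (R : realType) (d : nat) (p : R) :
  @wasserstein_open R d p setT.
Proof. by move=> mu _; exists 1. Qed.

Fact wasserstein_openI (R : realType) (d : nat) (p : R) :
  setI_closed (@wasserstein_open R d p).
Proof.
move=> U V oU oV mu [/oU[e e0 eU] /oV[f f0 fV]].
exists (Num.min e f) => [|nu]; first by rewrite lt_min e0 f0.
by rewrite EFin_min lt_min => /andP[/eU ? /fV ?].
Qed.

Fact wasserstein_open_bigU (R : realType) (d : nat) (p : R) (I : Type)
    (f : I -> set (P_Rd d p)) :
  (forall i, wasserstein_open (f i)) -> wasserstein_open (\bigcup_i f i).
Proof.
move=> of_ mu [i _ /of_[e e0 ef]]; exists e => // nu /ef fnu.
by exists i.
Qed.

HB.instance Definition _ (R : realType) (d : nat) (p : R) :=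
  gen_eqMixin (P_Rd d p).
HB.instance Definition _ (R : realType) (d : nat) (p : R) :=
  gen_choiceMixin (P_Rd d p).
HB.instance Definition _ (R : realType) (d : nat) (p : R) :=
  isOpenTopological.Build (P_Rd d p) (@wasserstein_openT R d p)
    (@wasserstein_openI R d p) (@wasserstein_open_bigU R d p).

Fact measurable_coord_at (R : realType) (T : {posnum R}) (d : nat)
    (t : time T) :
  @measurable_fun _ _ (borel (path_space T d)) (borel 'rV[R]_d) setT
    (coord_at t).
Proof.
exact: (@continuous_borel_measurable _ _ _ (@coord_at_continuous R T d t)).
Qed.

Definition coord_mfun (R : realType) (T : {posnum R}) (d : nat) (t : time T) :
    {mfun borel (path_space T d) >-> borel 'rV[R]_d} :=
  HB.pack_for {mfun borel (path_space T d) >-> borel 'rV[R]_d}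
    (@coord_at R T d t : borel (path_space T d) -> borel 'rV[R]_d)
    (isMeasurableFun.Build _ _ _ _ _ (@measurable_coord_at R T d t)).

Definition law_at (R : realType) (T : {posnum R}) (d : nat)
    (mu : probability (borel (path_space T d)) R) (t : time T) :
    probability (borel 'rV[R]_d) R :=
  distribution mu (coord_mfun d t).

Fact law_at_moment (R : realType) (T : {posnum R}) (d : nat) (p : R)
    (hp : 1 <= p) (mu : P_path T d p) (t : time T) :
  (\int[law_at mu t]_x (enorm x `^ p)%:E < +oo)%E.
Proof.
rewrite ge0_integral_distribution//; last first.
- by move=> x; rewrite lee_fin powR_ge0.
- exact: measurable_enorm_powR.
apply: le_lt_trans (wprob_moment mu).
apply: ge0_le_integral => //=.
- by move=> x _; rewrite lee_fin powR_ge0.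
- apply: measurableT_comp; [exact: measurable_enorm_powR|exact: measurable_coord_at].
- apply/measurable_EFinP; apply: (measurableT_comp (measurable_powR p)).
  exact: measurable_supnorm.
move=> x _; rewrite lee_fin ge0_ler_powR ?nnegrE//.
- exact: le_trans hp.
- exact: sqrtr_ge0.
- by apply: le_trans (enorm_le_supnorm t x); exact: sqrtr_ge0.
exact: enorm_le_supnorm.
Qed.

Definition marginal (R : realType) (T : {posnum R}) (d : nat) (p : R)
    (hp : 1 <= p) (mu : P_path T d p) (t : time T) : P_Rd d p :=
  WProb (law_at_moment hp mu t).

(* The law of (X_0, X_T), on the product sigma-algebra, which is the Borel
   sigma-algebra of R^d x R^d. *)
Definition endpoints (R : realType) (T : {posnum R}) (d : nat)
    (x : borel (path_space T d)) : borel 'rV[R]_d * borel 'rV[R]_d :=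
  (coord_at (time_ini T) x, coord_at (time_fin T) x).

Definition endpoints_law (R : realType) (T : {posnum R}) (d : nat)
    (mu : probability (borel (path_space T d)) R) :
    set (borel 'rV[R]_d * borel 'rV[R]_d) -> \bar R :=
  pushforward mu (@endpoints R T d).

Definition clamp01 (R : realType) (e : R) : R := Num.max 0 (Num.min 1 e).

Fact clamp01_ge0 (R : realType) (e : R) : 0 <= clamp01 e.
Proof. by rewrite le_max lexx. Qed.

Fact onem_clamp01_ge0 (R : realType) (e : R) : 0 <= 1 - clamp01 e.
Proof. by rewrite subr_ge0 ge_max ler01 ge_min lexx. Qed.

(* (1 - e) mu + e nu; only used for 0 <= e <= 1, where clamp01 e = e. *)
Definition mixm (dX : measure_display) (X : measurableType dX) (R : realType)
    (e : R) (mu nu : probability X R) : set X -> \bar R :=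
  measure_add (mscale (NngNum (onem_clamp01_ge0 e)) mu)
              (mscale (NngNum (clamp01_ge0 e)) nu).

HB.instance Definition _ (dX : measure_display) (X : measurableType dX)
    (R : realType) (e : R) (mu nu : probability X R) :=
  Measure.on (mixm e mu nu).

Fact mixm_setT (dX : measure_display) (X : measurableType dX) (R : realType)
  (e : R) (mu nu : probability X R) : mixm e mu nu setT = 1%E.
Proof.
have -> : mixm e mu nu setT =
    ((1 - clamp01 e)%:E * mu setT + (clamp01 e)%:E * nu setT)%E.
  exact: measure_addE.
by rewrite !probability_setT !mule1 -EFinD subrK.
Qed.

HB.instance Definition _ (dX : measure_display) (X : measurableType dX)
    (R : realType) (e : R) (mu nu : probability X R) :=
  Measure_isProbability.Build _ _ _ (mixm e mu nu) (mixm_setT e mu nu).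

Fact mixm_moment (R : realType) (d : nat) (p e : R) (mu nu : P_Rd d p) :
  (\int[mixm e mu nu]_x (enorm x `^ p)%:E < +oo)%E.
Proof.
rewrite ge0_integral_measure_add//; last first.
- exact: measurable_enorm_powR.
- by move=> x _; rewrite lee_fin powR_ge0.
rewrite !ge0_integral_mscale//=; try exact: measurable_enorm_powR; last 2 first.
- by move=> x _; rewrite lee_fin powR_ge0.
- by move=> x _; rewrite lee_fin powR_ge0.
have fin (m : P_Rd d p) : (\int[m]_x (enorm x `^ p)%:E)%E \is a fin_num.
  rewrite ge0_fin_numE; first exact: wprob_moment.
  by apply: integral_ge0 => x _; rewrite lee_fin powR_ge0.
by rewrite -(fineK (fin mu)) -(fineK (fin nu)) -!EFinM -EFinD ltry.
Qed.

Definition mix (R : realType) (d : nat) (p e : R) (mu nu : P_Rd d p) :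
    P_Rd d p := WProb (mixm_moment e mu nu).

Definition convex_on_P (R : realType) (d : nat) (p : R) (Psi : P_Rd d p -> R) :
    Prop :=
  forall (e : R) (mu nu : P_Rd d p), 0 <= e <= 1 ->
    Psi (mix e mu nu) <= (1 - e) * Psi mu + e * Psi nu.

(* g is the normalised linear functional derivative of Psi at mu w.r.t. the
   set of directions P_p; the normalisation makes g unique. *)
Definition is_linear_derivative (R : realType) (d : nat) (p : R)
    (Psi : P_Rd d p -> R) (mu : P_Rd d p) (g : 'rV[R]_d -> R) : Prop :=
  [/\ measurable_fun setT (g : borel 'rV[R]_d -> R),
      forall nu : P_Rd d p,
        nu.-integrable setT (EFin \o (g : borel 'rV[R]_d -> R)) /\
        e^-1 * (Psi (mix e mu nu) - Psi mu) @[e --> 0^'+] -->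
          \int[nu]_x g x - \int[mu]_x g x
    & \int[mu]_x g x = 0].

Definition density (dX : measure_display) (X : measurableType dX)
    (R : realType) (mu nu : probability X R) : X -> \bar R :=
  'd (charge_of_finite_measure mu) '/d nu.

Definition entropy (dX : measure_display) (X : measurableType dX)
    (R : realType) (mu nu : probability X R) : \bar R :=
  if `[< mu `<< nu >] then
    (\int[mu]_x lne (density mu nu x))%E
  else +oo%E.

Definition admissible (R : realType) (T : {posnum R}) (d : nat) (p : R)
    (hp : 1 <= p) (Psi : P_Rd d p -> R) (mu_ini mu_fin : P_Rd d p)
    (mu : P_path T d p) : Prop :=
  [/\ marginal hp mu (time_ini T) ≡μ mu_ini,
      marginal hp mu (time_fin T) ≡μ mu_fin
    & forall t : time T, Psi (marginal hp mu t) <= 0].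

Definition problem_value (R : realType) (T : {posnum R}) (d : nat) (p : R)
    (hp : 1 <= p) (nu : P_path T d p) (Psi : P_Rd d p -> R)
    (mu_ini mu_fin : P_Rd d p) : \bar R :=
  ereal_inf [set entropy mu nu | mu in admissible hp Psi mu_ini mu_fin].

(* As usual in convex analysis, only a finite infimum is said to be reached:
   when no admissible mu has finite entropy there is no minimiser. *)
Definition minimiser (R : realType) (T : {posnum R}) (d : nat) (p : R)
    (hp : 1 <= p) (nu : P_path T d p) (Psi : P_Rd d p -> R)
    (mu_ini mu_fin : P_Rd d p) (mu : P_path T d p) : Prop :=
  [/\ admissible hp Psi mu_ini mu_fin mu,
      entropy mu nu = problem_value hp nu Psi mu_ini mu_fin
    & problem_value hp nu Psi mu_ini mu_fin \is a fin_num].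

(* exp[- zeta_0(x_0) - zeta_T(x_T) - int_[0,T] g_t(x_t) lambda(dt)].  A finite
   Borel measure on the compact interval [0,T] is automatically Radon. *)
Definition gibbs_weight (R : realType) (T : {posnum R}) (d : nat)
    (g : time T -> 'rV[R]_d -> R)
    (lambda : {finite_measure set (borel (time T)) -> \bar R})
    (zeta0 zetaT : 'rV[R]_d -> R) (x : path_space T d) : R :=
  expR (- zeta0 (coord_at (time_ini T) x) - zetaT (coord_at (time_fin T) x)
        - \int[lambda]_t g t (coord_at t x)).

(* Main.v *)
(* Write H(mu|nu) as the integral of theta(dmu/dnu) against nu, where theta x = x ln x - x + 1 >= 0.

   Part 1.  By Young's inequality the exponential moments of nu make |X_t|^p uniformly
   integrable on sets of bounded entropy.  Hence an ultrafilter limit of a minimising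
   sequence, taken setwise, is again a probability measure, its marginals are limits in W_p
   (couple two laws through the masses they share on small cells), and semicontinuity of Psi
   and of H applies.  Strict convexity of theta gives uniqueness.

   Part 2.  Let h(t) = Psi(mubar_t), G_mu(t) = <mu_t, dPsi(mubar_t)>, fbar = dmubar/dnu.  If mu
   has finite entropy, the right endpoints and h + e G_mu < 0 for some e > 0, then mubar may be
   moved towards mu, so the integral of ln fbar against mu - mubar is nonnegative.  The Slater
   point mutilde turns this into an exact penalisation, and a minimal sublinear functional
   (Zorn) below the penalty yields a positive linear functional of time, i.e. the multiplier
   lambda.  Then Phi = ln fbar + int dPsi(mubar_t, x_t) lambda(dt) is orthogonal to all
   bounded relative perturbations of mubar with vanishing endpoint marginals.  Moving mass
   around rectangles of endpoints (x, y), (x, y'), (x', y'), (x', y) gives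
   Phi(w) = phi(x, y') + phi(x', y) - phi(x', y') for almost every w with endpoints (x, y), with phi
   the conditional mean of Phi given the endpoints; freezing (x', y') splits Phi into
   -zeta_0(x) - zeta_T(y).  The same rectangles, applied to mutilde, show fbar > 0. *)
Require Import Defs.
From HB Require Import structures.
From mathcomp Require Import all_boot all_order all_algebra.
From mathcomp Require Import all_classical all_reals all_analysis.
From mathcomp Require Import measurable_realfun giry.
From mathcomp Require Import ring lra.
Set Implicit Arguments.
Unset Strict Implicit.
Unset Printing Implicit Defensive.
Import Order.TTheory GRing.Theory Num.Theory.
Import numFieldNormedType.Exports.
Local Open Scope classical_set_scope.
Local Open Scope ring_scope.

(** * Densities and entropy *)

(** Setwise limits take the place of weak ones because a bound on the entropy makes measures
    uniformly absolutely continuous with respect to [nu], and this is what saves countable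
    additivity in the limit. The integrand [theta] keeps most integrals nonnegative, hence always
    defined.

    In Part 2 the obstacle is the additive form of the potential. Orthogonality to the perturbations
    with null endpoint marginals suggests that Phi is a limit of sums a(x) + b(y), but such sums
    need not form a closed set. The equivalence of the endpoint law with a product gives more:
    almost every rectangle of endpoints has its corners where the endpoint density is positive, so
    the splitting can be read off pointwise. Rectangles are first restricted to corners of density
    at least 1/(n+1); there the transported masses have bounded densities, and a small step along
    the perturbation keeps the density nonnegative and the entropy finite. Positivity of fbar uses
    the infinite slope of the entropy at density 0: a strictly feasible perturbation of mutilde
    cannot charge the zero set of fbar. *)

Section as_probability.
Context d (T : measurableType d) (R : realType) (m : {measure set T -> \bar R}).

(** The proof argument lets the alias remember why [m] is finite, so that the instances below can be
    inferred; likewise for [as_probability]. *)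
Definition as_finite_measure (_ : fin_num_fun m) : set T -> \bar R := m.

Definition as_probability (_ : m setT = 1%E) : set T -> \bar R := m.

Variables (mfin : fin_num_fun m) (m1 : m setT = 1%E).

HB.instance Definition _ := Measure.on (as_finite_measure mfin).
HB.instance Definition _ := Measure_isFinite.Build _ _ _
  (as_finite_measure mfin) mfin.

HB.instance Definition _ := Measure.on (as_probability m1).
HB.instance Definition _ := Measure_isProbability.Build _ _ _
  (as_probability m1) m1.

End as_probability.

Section density.
Context d (T : measurableType d) (R : realType).
Implicit Types (mu nu : {measure set T -> \bar R}) (f : T -> R).
Local Open Scope ereal_scope.

Definition mdens nu f (mf : measurable_fun setT f) (f0 : forall x, (0 <= f x)%R)
  (A : set T) : \bar R := \int[nu]_(x in A) (f x)%:E.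

Variables (nu : {measure set T -> \bar R}) (f : T -> R).
Hypotheses (mf : measurable_fun setT f) (f0 : forall x, (0 <= f x)%R).

Let mdens0 : mdens nu mf f0 set0 = 0.
Proof. by rewrite /mdens integral_set0. Qed.

Let mdens_ge0 A : 0 <= mdens nu mf f0 A.
Proof. by apply: integral_ge0 => x _; rewrite lee_fin. Qed.

Let mdens_semi_sigma_additive : semi_sigma_additive (mdens nu mf f0).
Proof.
apply: semi_sigma_additive_nng_induced => [|x]; last by rewrite lee_fin.
exact/measurable_EFinP.
Qed.

HB.instance Definition _ := isMeasure.Build _ _ _ (mdens nu mf f0)
  mdens0 mdens_ge0 mdens_semi_sigma_additive.

End density.

(** A relation instead of the derivative [density]: the representative is real and nonnegative
    everywhere, so almost-everywhere side conditions do not follow it through the integrals. *)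
Definition has_density d (T : measurableType d) (R : realType)
    (mu nu : {measure set T -> \bar R}) (f : T -> R) : Prop :=
  [/\ measurable_fun setT f, forall x, 0 <= f x
    & forall A, measurable A -> mu A = (\int[nu]_(x in A) (f x)%:E)%E].

Section has_density.
Context d (T : measurableType d) (R : realType).
Implicit Types (mu nu : {measure set T -> \bar R}) (f : T -> R).
Local Open Scope ereal_scope.

Lemma has_density_dominates mu nu f : has_density mu nu f -> mu `<< nu.
Proof.
move=> [mf f0 muf]; apply/null_content_dominatesP => A mA nuA.
rewrite muf//; apply: null_set_integral => //.
by apply/measurable_EFinP; exact: measurable_funTS.
Qed.

Lemma has_density_exists (mu : {finite_measure set T -> \bar R})
    (nu : {sigma_finite_measure set T -> \bar R}) :
  mu `<< nu -> exists f, has_density mu nu f.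
Proof.
move=> munu.
pose g := Radon_Nikodym (charge_of_finite_measure mu) nu.
have ig : nu.-integrable setT g by exact: Radon_Nikodym_integrable.
have gfin x : g x \is a fin_num by exact: Radon_Nikodym_fin_num.
have mg : measurable_fun setT g by exact: measurable_int ig.
have gE A : measurable A -> mu A = \int[nu]_(x in A) g x.
  by move=> mA; rewrite -Radon_Nikodym_integral.
(* The derivative is that of a charge and may be negative on a set [N]; as [mu] is nonnegative, [N]
   is [nu]-null and the positive part is still a density. *)
pose f x := Num.max (fine (g x)) 0%R.
have mf : measurable_fun setT f.
  apply: measurable_funrpos; apply: measurableT_comp => //.
exists f; split => // [x|A mA]; first by rewrite /f le_max lexx orbT.
pose N := [set x | g x < 0].
have mN : measurable N.
  rewrite (_ : N = g @^-1` `]-oo, 0[); last first.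
    by apply/seteqP; split => x /=; rewrite in_itv.
  by rewrite -[X in measurable X]setTI; apply: mg => //; exact: emeasurable_itv.
have N0 : nu N = 0.
  apply/eqP; apply: contraT => nuN.
  have iN : nu.-integrable N g by apply: integrableS ig.
  have h : \int[nu]_(x in N) g x = 0.
    apply/eqP; rewrite eq_le; apply/andP; split; last by rewrite -gE.
    rewrite -oppe_ge0 -integralN; last exact: integrable_add_def.
    by apply: integral_ge0 => x Nx; rewrite oppe_ge0; exact: ltW.
  have : ae_eq nu N g (cst 0).
    apply/(ae_eq_integral_abs _ mN); first exact: measurable_funTS.
    rewrite (eq_integral (fun x => - g x)).
      by rewrite integralN ?h ?oppe0//; exact: integrable_add_def.
    by move=> x /[!inE] Nx; rewrite lte0_abs.
  move=> [M [mM M0 sub]]; exfalso.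
  have : nu N <= nu M.
    apply: le_measure; rewrite ?inE// => x Nx; apply: sub => /= h'.
    by have := Nx; rewrite /N /= h'// ltxx.
  by rewrite M0 measure_le0 => /eqP nN; rewrite nN eqxx in nuN.
transitivity (\int[nu]_(x in A) g x); first exact: gE.
apply: ae_eq_integral => //.
- exact: measurable_funTS.
- by apply/measurable_EFinP; exact: measurable_funTS.
exists N; split => // x /= h; apply: contrapT => /negP; rewrite -leNgt => g0.
apply: h => _; rewrite /f max_l ?fineK//.
by rewrite -lee_fin fineK.
Qed.

Import HBNNSimple.

Lemma ge0_integral_density mu nu f (g : T -> \bar R) D : has_density mu nu f ->
  measurable D ->
  measurable_fun setT g -> (forall x, 0 <= g x) ->
  \int[mu]_(x in D) g x = \int[nu]_(x in D) (g x * (f x)%:E).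
Proof.
move=> [mf f0 muf] mD mg g0.
have mEf : measurable_fun setT (EFin \o f) by exact/measurable_EFinP.
have mgD : measurable_fun D g by exact: measurable_funTS.
pose g_ := nnsfun_approx mD mgD.
have ndg x : {homo (fun n => (g_ n x)%:E) : n m / (n <= m)%N >-> n <= m}.
  by move=> m n mn; rewrite lee_fin; exact/lefP/nd_nnsfun_approx.
transitivity (limn (fun n => \int[mu]_(x in D) (g_ n x)%:E)).
  rewrite -monotone_convergence//.
  - apply: eq_integral => y /[!inE] yD; apply/esym/cvg_lim => //.
    exact: cvg_nnsfun_approx.
  - by move=> n; exact/measurable_EFinP/measurable_funP.
  - by move=> n y _; rewrite lee_fin.
rewrite [X in limn X](_ : _ =
    (fun n => \int[nu]_(x in D) ((g_ n x)%:E * (f x)%:E))).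
  rewrite -monotone_convergence//; last 3 first.
  - move=> n; apply: emeasurable_funM; last exact: measurable_funTS.
    exact/measurable_EFinP/measurable_funP.
  - by move=> n x _; rewrite mule_ge0// lee_fin.
  - move=> x _ m n mn; apply: lee_wpmul2r; rewrite ?lee_fin//.
    by rewrite -lee_fin; exact: ndg.
  apply: eq_integral => y /[!inE] yD; apply: cvg_lim => //.
  by apply: cvgeZr => //; exact: cvg_nnsfun_approx.
apply/funext => n.
transitivity (\int[mu]_(x in D) (\sum_(y \in range (g_ n)) y * \1_(g_ n @^-1` [set y]) x)%:E).
  by apply: eq_integral => x _; rewrite -fimfunE.
transitivity (\sum_(y \in range (g_ n)) \int[nu]_(x in D) ((y * \1_(g_ n @^-1` [set y]) x)%:E * (f x)%:E)).
  under eq_integral do rewrite -fsumEFin//.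
  rewrite ge0_integral_fsum//; last first.
  - by move=> y x _; rewrite nnfun_muleindic_ge0.
  - move=> y; apply/measurable_EFinP; apply: measurable_funM => //.
  apply: eq_fsbigr => y /[!inE] -[z _ zy].
  have y0 : (0 <= y)%R by rewrite -zy.
  have mgy : measurable (g_ n @^-1` [set y]) by exact: measurable_sfunP.
  under eq_integral do rewrite EFinM.
  under [RHS]eq_integral do rewrite EFinM -muleA.
  rewrite !ge0_integralZl//; last 3 first.
  - apply: emeasurable_funM; last exact: measurable_funTS.
    by apply/measurable_EFinP; exact: measurable_indic.
  - by move=> x _; rewrite mule_ge0// lee_fin.
  - by apply/measurable_EFinP; exact: measurable_indic.
  rewrite integral_indic// muf; last exact: measurableI.
  congr *%E; rewrite setIC integral_mkcondr; apply: eq_integral => x _.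
  by rewrite patchE indicE; case: (x \in _); rewrite ?mul1e ?mul0e.
rewrite -ge0_integral_fsum//.
- apply: eq_integral => x _; rewrite -ge0_mule_fsuml; last first.
    by move=> y; rewrite nnfun_muleindic_ge0.
  by rewrite fsumEFin// -fimfunE.
- move=> y; apply: emeasurable_funM; last exact: measurable_funTS.
  apply/measurable_EFinP; apply: measurable_funM => //.
- move=> y x _; apply: mule_ge0; last by rewrite lee_fin.
  by rewrite EFinM nnfun_muleindic_ge0.
Qed.

Lemma integrable_density mu nu f (g : T -> R) : has_density mu nu f ->
  measurable_fun setT g ->
  mu.-integrable setT (EFin \o g) <-> nu.-integrable setT (fun x => (g x * f x)%:E).
Proof.
move=> mf mg.
have [mf' f0 _] := mf.
have h : \int[mu]_x `|(g x)%:E| = \int[nu]_x `|(g x * f x)%:E|.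
  rewrite (ge0_integral_density mf)//.
    by apply: eq_integral => x _; rewrite EFinM abseM (gee0_abs (x := (f x)%:E))// lee_fin.
  by apply: measurableT_comp => //; exact/measurable_EFinP.
split => /integrableP[_ i]; apply/integrableP; split.
- by apply/measurable_EFinP; exact: measurable_funM.
- by rewrite -h.
- by apply/measurable_EFinP.
- by rewrite h.
Qed.

Lemma integral_density mu nu f (g : T -> R) : has_density mu nu f ->
  measurable_fun setT g ->
  \int[mu]_x (g x)%:E = \int[nu]_x (g x * f x)%:E.
Proof.
move=> mf mg.
have [mf' f0 _] := mf.
have mEg : measurable_fun setT (EFin \o g) by exact/measurable_EFinP.
rewrite integralE [in RHS]integralE.
rewrite !(ge0_integral_density mf)//; [|exact: measurable_funeneg|exact: measurable_funepos].
congr (_ - _); apply: eq_integral => x _.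
- rewrite !funeposE -!EFin_max -EFinM maxr_pMl// mul0r//.
- rewrite !funenegE -!EFinN -!EFin_max -EFinM maxr_pMl// mul0r// mulNr//.
Qed.

Lemma Rintegral_density mu nu f (g : T -> R) : has_density mu nu f ->
  measurable_fun setT g ->
  (\int[mu]_x g x = \int[nu]_x (g x * f x))%R.
Proof. by move=> mf mg; rewrite /Rintegral (integral_density mf). Qed.

Lemma probability_density nu f : measurable_fun setT f ->
  (forall x, (0 <= f x)%R) -> \int[nu]_x (f x)%:E = 1 ->
  exists P : probability T R, has_density P nu f.
Proof.
move=> mf f0 f1.
by exists (as_probability (m := mdens nu mf f0) f1); split.
Qed.

Lemma finite_measure_density nu f : measurable_fun setT f ->
  (forall x, (0 <= f x)%R) -> \int[nu]_x (f x)%:E < +oo ->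
  exists P : {finite_measure set T -> \bar R}, has_density P nu f.
Proof.
move=> mf f0 f1.
have h : fin_num_fun (mdens nu mf f0).
  move=> A mA; rewrite ge0_fin_numE//; apply: le_lt_trans f1.
  apply: ge0_subset_integral => //; first exact/measurable_EFinP.
  by move=> x _; rewrite lee_fin.
by exists (as_finite_measure (m := mdens nu mf f0) h); split.
Qed.

End has_density.

(** * The entropy integrand and its convexity *)

Section theta.
Context {R : realType}.
Implicit Types a b t : R.

(** The convex conjugate of b |-> e^b - 1. The terms [- a + 1] integrate to zero against a
    probability density and bring the minimum, reached at 1, to zero. As [ln 0 = 0], the value at 0
    is the right one, 1. *)
Definition theta a : R := a * ln a - a + 1.

Lemma measurable_theta : measurable_fun setT theta.
Proof.
apply: measurable_funD => //; apply: measurable_funB => //.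
by apply: measurable_funM => //; exact: measurable_ln.
Qed.

(** Convexity of the exponential: e^b = a e^(b - ln a) >= a (1 + b - ln a). *)
Lemma theta_young a b : 0 <= a -> a * b <= theta a + expR b - 1.
Proof.
rewrite le_eqVlt => /predU1P[<-|a0].
  by rewrite /theta !mul0r subr0 add0r addrAC subrr add0r expR_ge0.
have -> : expR b = a * expR (b - ln a).
  by rewrite expRD expRN lnK// mulrCA divff ?mulr1// gt_eqF.
have := ler_wpM2l (ltW a0) (expR_ge1Dx (b - ln a)).
rewrite /theta mulrDr mulrBr mulr1; set u := a * expR _; lra.
Qed.

(** Equality in e^u >= 1 + u occurs at u = 0 only; uniqueness of the minimiser rests on this. *)
Lemma theta_young_eq a b : 0 <= a -> a * b = theta a + expR b - 1 -> a = expR b.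
Proof.
rewrite le_eqVlt => /predU1P[<-|a0].
  rewrite /theta !mul0r subr0 add0r [1 + _]addrC addrK => /eqP.
  by rewrite eq_sym expR_eq0.
have {1}-> : expR b = a * expR (b - ln a).
  by rewrite expRD expRN lnK// mulrCA divff ?mulr1// gt_eqF.
have [->|ne] := eqVneq b (ln a); first by rewrite lnK.
have ne0 : b - ln a != 0 by rewrite subr_eq0.
have := expR_gt1Dx ne0; rewrite -(ltr_pM2l a0).
rewrite /theta mulrDr mulrBr mulr1; set u := a * expR _.
by move=> + h; have -> : u = a * b - a * ln a + a by [move: h; lra|]; rewrite addrC ltxx.
Qed.

Lemma theta_ge0 a : 0 <= a -> 0 <= theta a.
Proof. by move=> /(theta_young 0); rewrite mulr0 expR0 addrK. Qed.

Lemma theta0 : theta 0 = 1.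
Proof. by rewrite /theta mul0r subr0 add0r. Qed.

Lemma theta_tangent a m : 0 <= a -> 0 < m -> a * ln m - m + 1 <= theta a.
Proof. by move=> /(theta_young (ln m)) + m0; rewrite lnK//; lra. Qed.

(** [theta] decreases on [0, 1], where it is at most 1, and increases afterwards; hence the additive
    constant. *)
Lemma theta_le a b : 0 <= a -> a <= b -> theta a <= 1 + theta b.
Proof.
move=> a0 ab; have b0 := le_trans a0 ab.
have [a1|a1] := leP a 1.
  have : a * ln a <= 0 by rewrite mulr_ge0_le0// ln_le0.
  by have := theta_ge0 b0; rewrite /theta; lra.
have agt0 : 0 < a by apply: lt_trans a1.
have := theta_tangent b0 agt0.
have : a * ln a <= b * ln a by rewrite ler_wpM2r// ln_ge0// ltW.
by rewrite {2}/theta; lra.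
Qed.

Lemma theta_double b : 0 <= b -> theta (2 * b) <= 2 * theta b + 2 * b.
Proof.
rewrite le_eqVlt => /predU1P[<-|b0]; first by rewrite !mulr0 theta0; lra.
rewrite /theta lnM ?posrE//.
have : ln (2 : R) <= 1 by rewrite -[X in _ <= X]expRK ler_ln ?posrE ?expR_gt0//; have := expR_ge1Dx (1 : R); lra.
by move=> /(ler_wpM2l (ltW b0)); nra.
Qed.

(** Since a <= 2 max(b, c), monotonicity up to 1 applies to the larger term. Together with
    [theta_double] this bounds the entropy of a perturbed density. *)
Lemma theta_le_add a b c : 0 <= a -> 0 <= b -> 0 <= c -> a <= b + c ->
  theta a <= 1 + theta (2 * b) + theta (2 * c).
Proof.
move=> a0 b0 c0 abc.
have tb : 0 <= theta (2 * b) by apply: theta_ge0; rewrite mulr_ge0.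
have tc : 0 <= theta (2 * c) by apply: theta_ge0; rewrite mulr_ge0.
have [bc|cb] := leP b c.
  have /(theta_le a0) : a <= 2 * c by lra.
  by lra.
have /(theta_le a0) : a <= 2 * b by lra.
by lra.
Qed.

Lemma theta_convex a b t : 0 <= a -> 0 <= b -> 0 <= t <= 1 ->
  theta ((1 - t) * a + t * b) <= (1 - t) * theta a + t * theta b.
Proof.
move=> a0 b0 /andP[t0 t1]; set m := _ + _.
have s0 : 0 <= 1 - t by lra.
have : 0 <= m by rewrite addr_ge0// mulr_ge0.
rewrite le_eqVlt => /predU1P[m0|m0].
  have ha : (1 - t) * a = 0 by apply/eqP; rewrite eq_le mulr_ge0// andbT; have := mulr_ge0 t0 b0; move: m0; rewrite /m; lra.
  have hb : t * b = 0 by apply/eqP; rewrite eq_le mulr_ge0// andbT; have := mulr_ge0 s0 a0; move: m0; rewrite /m; lra.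
  rewrite -m0 theta0 /theta (_ : (1 - t) * (a * ln a - a + 1) = (1 - t) * a * ln a - (1 - t) * a + (1 - t)); last by ring.
  rewrite (_ : t * (b * ln b - b + 1) = t * b * ln b - t * b + t); last by ring.
  by rewrite ha hb; lra.
have := ler_wpM2l s0 (theta_tangent a0 m0).
have := ler_wpM2l t0 (theta_tangent b0 m0).
have -> : theta m = (1 - t) * (a * ln m - m + 1) + t * (b * ln m - m + 1).
  have : m = (1 - t) * a + t * b by [].
  by move: m {m0} => m mE; rewrite /theta {1}mE; ring.
by lra.
Qed.

(** Both tangent inequalities at the midpoint [m] are tight, and equality in Young's inequality
    forces a = e^(ln m) = b. *)
Lemma theta_midpoint_eq a b : 0 <= a -> 0 <= b ->
  theta a + theta b <= 2 * theta ((a + b) / 2) -> a = b.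
Proof.
move=> a0 b0; set m := _ / _ => h.
have mE : a + b = 2 * m by rewrite /m; lra.
have : 0 <= m by rewrite /m; lra.
rewrite le_eqVlt => /predU1P[m0|m0]; first by lra.
have ha := theta_tangent a0 m0; have hb := theta_tangent b0 m0.
have hs : theta a + theta b <= a * ln m - m + 1 + (b * ln m - m + 1).
  apply: (le_trans h); rewrite /theta; set L := ln m.
  have -> : b = 2 * m - a by lra.
  nra.
have : a = expR (ln m) by apply: theta_young_eq => //; rewrite lnK//; lra.
have : b = expR (ln m) by apply: theta_young_eq => //; rewrite lnK//; lra.
by move=> -> ->.
Qed.

End theta.

(** * Entropy as an integral of [theta], and Young's inequality *)

Section entropy.
Context d (T : measurableType d) (R : realType).
Implicit Types (mu nu : probability T R) (f : T -> R).
Local Open Scope ereal_scope.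

Lemma measurable_theta_comp f : measurable_fun setT f ->
  measurable_fun setT (fun x => (theta (f x))%:E).
Proof.
by move=> mf; apply/measurable_EFinP; exact: measurableT_comp measurable_theta mf.
Qed.

Lemma integral_probability_cst (P : probability T R) r : \int[P]__ r%:E = r%:E.
Proof.
by rewrite integral_cst// -[RHS]mule1; congr *%E; exact: probability_setT.
Qed.

Lemma has_density_int mu nu f : has_density mu nu f -> \int[nu]_x (f x)%:E = 1.
Proof. by move=> [_ _ h]; rewrite -(probability_setT mu); exact/esym/h. Qed.

Lemma has_density_integrable mu nu f : has_density mu nu f ->
  nu.-integrable setT (EFin \o f).
Proof.
move=> h; have [mf f0 _] := h; apply/integrableP; split; first exact/measurable_EFinP.
under eq_integral do rewrite gee0_abs ?lee_fin//.
by rewrite (has_density_int h) ltry.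
Qed.

Lemma density_ae_eq mu nu f : has_density mu nu f ->
  ae_eq nu setT (density mu nu) (EFin \o f).
Proof.
move=> h; have munu := has_density_dominates h; have [mf f0 muf] := h.
apply: integral_ae_eq => //.
- exact: Radon_Nikodym_integrable.
- exact/measurable_EFinP.
- by move=> E _ mE; rewrite -Radon_Nikodym_integral//; exact: muf.
Qed.

Lemma entropyE mu nu f : has_density mu nu f ->
  entropy mu nu = \int[nu]_x (theta (f x))%:E.
Proof.
move=> h; have munu := has_density_dominates h; have [mf f0 muf] := h.
rewrite /entropy asboolT//.
have mlnf : measurable_fun setT (fun x => ln (f x)) by exact: measurableT_comp (@measurable_ln R) mf.
transitivity (\int[mu]_x (ln (f x))%:E).
  apply: ae_eq_integral => //.
  - have mg : measurable_fun setT (density mu nu).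
      by apply: (measurable_int nu); exact: Radon_Nikodym_integrable.
    have mfg : measurable_fun setT (fun x => fine (density mu nu x)).
      by apply: measurableT_comp mg.
    have gfin x : density mu nu x \is a fin_num by exact: Radon_Nikodym_fin_num.
    have -> : (fun x => lne (density mu nu x)) = (fun x =>
        if (0 < fine (density mu nu x))%R
        then (ln (fine (density mu nu x)))%:E else -oo).
      apply/funext => x; rewrite -[in LHS](fineK (gfin x)).
      case: ltP => [r0|r0]; first by rewrite lne_EFin.
      by rewrite le0_lneNy// lee_fin.
    apply: measurable_fun_ifT => //.
    - by apply: measurable_fun_ltr.
    - by apply/measurable_EFinP; exact: measurableT_comp (@measurable_ln R) mfg.
  - exact/measurable_EFinP.
  have h1 := null_dominates_ae_eq measurableT munu (density_ae_eq h).
  have : ae_eq mu setT (fun x => lne (f x)%:E) (fun x => (ln (f x))%:E).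
    pose N := [set x | (f x <= 0)%R].
    have mN : measurable N.
      rewrite (_ : N = f @^-1` `]-oo, 0%R]); last first.
        by apply/seteqP; split => x /=; rewrite in_itv.
      by rewrite -[X in measurable X]setTI; apply: mf => //; exact: measurable_itv.
    exists N; split => //.
      rewrite muf//; apply: integral0_eq => x Nx.
      by congr EFin; apply/eqP; rewrite eq_le f0 andbT.
    move=> x /= hx; apply: contrapT => /negP; rewrite -ltNge => fx0.
    by apply: hx => _; rewrite leNgt fx0.
  apply: ae_eq_trans.
  apply: filterS h1 => x hx _; congr lne; exact: hx.
have mxl : measurable_fun setT (fun x => f x * ln (f x))%R.
  exact: measurable_funM.
have -> : \int[mu]_x (ln (f x))%:E = \int[nu]_x (f x * ln (f x))%:E.
  by rewrite (integral_density h)//; apply: eq_integral => x _; rewrite mulrC.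
(* Positive and negative parts of f ln f. As f ln f >= f - 1 >= -1, the negative part is at most 1,
   so the integral of ln f never meets oo - oo; the identity [NP] moves every term to a side where
   it is nonnegative. *)
pose P x := Num.max (f x * ln (f x))%R 0%R.
pose N x := Num.max (- (f x * ln (f x)))%R 0%R.
have mP : measurable_fun setT P by exact: measurable_funrpos.
have mN : measurable_fun setT N by exact: measurable_funrneg.
have P0 x : (0 <= P x)%R by rewrite /P le_max lexx orbT.
have N0 x : (0 <= N x)%R by rewrite /N le_max lexx orbT.
have NP x : (theta (f x) + (f x + N x) = P x + 1)%R.
  rewrite /theta /P /N; set y := (f x * ln (f x))%R.
  by case/orP: (le_total 0%R y) => y0;
    [rewrite (max_l y0) max_r ?oppr_le0//|rewrite (max_r y0) max_l ?oppr_ge0//]; lra.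
have N1 x : (N x <= 1)%R.
  rewrite /N ge_max ler01 andbT; have := theta_ge0 (f0 x).
  by have := f0 x; rewrite /theta; lra.
rewrite integralE (eq_integral (fun x => (P x)%:E)); last first.
  by move=> x _; rewrite funeposE EFin_max.
rewrite [X in _ - X](eq_integral (fun x => (N x)%:E)); last first.
  by move=> x _; rewrite funenegE EFin_max EFinN.
have intN : \int[nu]_x (N x)%:E \is a fin_num.
  rewrite ge0_fin_numE; last by apply: integral_ge0 => x _; rewrite lee_fin.
  apply: (@le_lt_trans _ _ (\int[nu]_x 1)); last first.
    by rewrite integral_probability_cst ltry.
  apply: ge0_le_integral => //.
  - by move=> x _; rewrite lee_fin.
  - exact/measurable_EFinP.
  - by move=> x _; rewrite lee_fin.
have : \int[nu]_x ((theta (f x))%:E + ((f x)%:E + (N x)%:E)) =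
    \int[nu]_x ((P x)%:E + 1%:E).
  by apply: eq_integral => x _; rewrite -!EFinD NP.
rewrite !ge0_integralD//; try exact/measurable_EFinP;
  try by move=> x _; rewrite ?lee_fin ?adde_ge0 ?lee_fin// theta_ge0.
- rewrite (has_density_int h) integral_probability_cst.
  move: intN; case: (\int[nu]_x (N x)%:E) => // r _.
  have : 0 <= \int[nu]_x (P x)%:E by apply: integral_ge0 => x _; rewrite lee_fin.
  have : 0 <= \int[nu]_x (theta (f x))%:E by apply: integral_ge0 => x _; rewrite lee_fin theta_ge0.
  case: (\int[nu]_x (P x)%:E) => // [q|]; case: (\int[nu]_x (theta (f x))%:E) => // s _ _ [].
  by move=> hh; congr EFin; move: hh; lra.
- exact: measurable_theta_comp.
- by move=> x _; rewrite -EFinD lee_fin addr_ge0.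
- by apply: emeasurable_funD; exact/measurable_EFinP.
Qed.

Lemma entropy_density mu nu : entropy mu nu < +oo ->
  exists2 f, has_density mu nu f & entropy mu nu = \int[nu]_x (theta (f x))%:E.
Proof.
rewrite {1}/entropy; case: asboolP => // munu _.
by have [f h] := has_density_exists munu; exists f => //; exact: entropyE.
Qed.

Lemma entropy_ge0 mu nu : 0 <= entropy mu nu.
Proof.
rewrite leNgt; apply/negP => h.
have [|f [mf f0 hf] hE] := @entropy_density mu nu; first exact: lt_trans h (ltry 0).
move: h; rewrite hE ltNge => /negP; apply.
by apply: integral_ge0 => x _; rewrite lee_fin theta_ge0.
Qed.

(** [theta_young] integrated at b = g, in the spirit of Donsker and Varadhan. Uniform absolute
    continuity and uniform tails under an entropy bound both come from a choice of [g]. *)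
Lemma entropy_young mu nu (g : T -> R) : measurable_fun setT g ->
  (forall x, (0 <= g x)%R) ->
  \int[mu]_x (g x)%:E <= entropy mu nu + \int[nu]_x (expR (g x) - 1)%:E.
Proof.
move=> mg g0.
have e0 x : (0 <= expR (g x) - 1)%R by rewrite subr_ge0 -expR0 ler_expR.
have I0 : 0 <= \int[nu]_x (expR (g x) - 1)%:E.
  by apply: integral_ge0 => x _; rewrite lee_fin.
have [h|] := ltP (entropy mu nu) +oo; last first.
  by rewrite leye_eq => /eqP ->; rewrite addye ?leey// gt_eqF// (lt_le_trans _ I0).
have [f hf ->] := entropy_density h; have [mf f0 _] := hf.
rewrite (integral_density hf)// -ge0_integralD//; last first.
- by apply/measurable_EFinP; apply: measurable_funB => //; exact: measurableT_comp.
- by move=> x _; rewrite lee_fin.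
- exact: measurable_theta_comp.
- by move=> x _; rewrite lee_fin theta_ge0.
apply: ge0_le_integral => //.
- by move=> x _; rewrite lee_fin mulr_ge0.
- by apply/measurable_EFinP; exact: measurable_funM.
- apply: emeasurable_funD; first exact: measurable_theta_comp.
  by apply/measurable_EFinP; apply: measurable_funB => //; exact: measurableT_comp.
by move=> x _; rewrite -EFinD lee_fin mulrC addrA theta_young.
Qed.

End entropy.

(** * Setwise limits of measures of bounded entropy *)

Section ultrafilter_limit.
Context {R : realType}.

Lemma ultra_cvg_bounded (U : set_system nat) (u : nat -> R) (a b : R) :
  UltraFilter U -> (forall n, a <= u n <= b) -> cvg (u n @[n --> U]).
Proof.
move=> UU uab.
have [p [_ clp]] : `[a, b]%classic `&` cluster (u n @[n --> U]) !=set0.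
  apply: segment_compact.
  have : U [set n | u n \in `[a, b]] by apply: filterE => n; rewrite /= in_itv /=; exact: uab.
  by [].
apply/cvg_ex; exists p => V pV.
have [//|nV] := in_ultra_setVsetC (u @^-1` V) UU.
by have [y [? ?]] := clp (~` V) V nV pV.
Qed.

(** The sum counts the integers 1, ..., N strictly below [z]: a discrete layer-cake formula, exact
    up to 1. *)
Lemma count_lt_bounds (N : nat) (z : R) : 0 <= z <= N%:R ->
  z - 1 <= \sum_(i < N) (i.+1%:R < z)%R%:R <= z.
Proof.
elim: N z => [|N IH] z /andP[z0 zN].
  by rewrite big_ord0; apply/andP; split; lra.
rewrite big_ord_recr/= ltNge zN addr0.
have [zN'|Nz] := leP z N%:R; first by rewrite IH// z0.
rewrite (eq_bigr (fun=> 1)); last first.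
  by move=> i _; rewrite (le_lt_trans _ Nz)// ler_nat.
rewrite sumr_const card_ord.
by move: zN; rewrite -natr1; lra.
Qed.

End ultrafilter_limit.

Section setwise_limit.
Context d (T : measurableType d) (R : realType).
Implicit Types (P : probability T R).

Lemma Rintegral_cst_probability P (r : R) : \int[P]_x r = r.
Proof. by rewrite /Rintegral integral_probability_cst. Qed.

Lemma integrable_bounded P (g : T -> R) (M : R) : measurable_fun setT g ->
  (forall x, `|g x| <= M) -> P.-integrable setT (EFin \o g).
Proof.
move=> mg gM; apply: (@le_integrable _ _ _ _ _ measurableT _ (cst M%:E)).
- exact/measurable_EFinP.
- by move=> x _; rewrite /= lee_fin (le_trans (gM x))// ler_norm.
- exact: finite_measure_integrable_cst.
Qed.

(** Layer-cake formula with an error of 1 whatever [P] and [N]. Only masses of measurable sets occur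
    in the sum, so setwise convergence applies to it. *)
Lemma Rintegral_layer P (g : T -> R) (N : nat) : measurable_fun setT g ->
  (forall x, 0 <= g x <= N%:R) ->
  `|\int[P]_x g x - \sum_(i < N) fine (P [set x | i.+1%:R < g x])| <= 1.
Proof.
move=> mg gN.
have mS (i : nat) : measurable [set x | i%:R < g x].
  rewrite (_ : [set x | _] = g @^-1` `]i%:R, +oo[); last first.
    by apply/seteqP; split => x /=; rewrite in_itv /= andbT.
  by rewrite -[X in measurable X]setTI; apply: mg => //; exact: measurable_itv.
have ig : P.-integrable setT (EFin \o g).
  apply: (@integrable_bounded P _ N%:R) => // x.
  by have /andP[? ?] := gN x; rewrite ger0_norm.
pose s x := \sum_(i < N) \1_[set x | i.+1%:R < g x] x : R.
have sE x : s x = \sum_(i < N) (i.+1%:R < g x)%R%:R.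
  by apply: eq_bigr => i _; rewrite indicE; congr (_%:R); congr nat_of_bool; apply/idP/idP; rewrite inE.
have ms : measurable_fun setT s.
  by apply: measurable_sum => i; exact: measurable_indic.
have s0 x : 0 <= s x by rewrite sE sumr_ge0.
have sN x : s x <= N%:R.
  by rewrite sE; have /andP[_ h] := count_lt_bounds (gN x); have /andP[_ h'] := gN x; apply: le_trans h h'.
have is_ : P.-integrable setT (EFin \o s).
  by apply: (@integrable_bounded P _ N%:R) => // x; rewrite ger0_norm.
have -> : \sum_(i < N) fine (P [set x | i.+1%:R < g x]) = \int[P]_x s x.
  rewrite /Rintegral.
  under eq_integral do rewrite /s -sumEFin.
  rewrite ge0_integral_sum//; last first.
    by move=> i; apply/measurable_EFinP; exact: measurable_indic.
  rewrite (eq_bigr (fun i : 'I_N => (fine (P [set x | i.+1%:R < g x]))%:E)).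
    by rewrite sumEFin.
  by move=> i _; rewrite integral_indic// setIT fineK// fin_num_measure.
rewrite -RintegralB//; apply: le_trans (le_normr_Rintegral _ _) _ => //.
  exact: (integrableB measurableT ig is_).
rewrite -[X in _ <= X](Rintegral_cst_probability P).
apply: le_Rintegral => //.
- apply: (@integrable_bounded P _ (N%:R + N%:R)); first exact/measurableT_comp/measurable_funB.
  move=> x; rewrite normr_id (le_trans (ler_normB _ _))// lerD// ger0_norm//.
  by have /andP[] := gN x.
  by have /andP[] := gN x.
- exact: finite_measure_integrable_cst.
- move=> x _; rewrite ler_norml sE; have := count_lt_bounds (gN x).
  by move=> /andP[h1 h2]; apply/andP; split; lra.
Qed.

Definition setwise_cvg (U : set_system nat) (mu_ : nat -> probability T R)
    (mu : probability T R) :=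
  forall A, measurable A -> fine (mu_ n A) @[n --> U] --> fine (mu A).

Lemma cvg_sum_filter (I : Type) (U : set_system nat) (FU : ProperFilter U) (r : seq I)
    (u : I -> nat -> R) (l : I -> R) :
  (forall i, u i n @[n --> U] --> l i) ->
  \sum_(i <- r) u i n @[n --> U] --> \sum_(i <- r) l i.
Proof.
move=> h; elim: r => [|i r IH].
  rewrite big_nil; under eq_fun do rewrite big_nil; exact: cvg_cst.
rewrite big_cons; under eq_fun do rewrite big_cons; exact: cvgD.
Qed.

Lemma setwise_cvg_Rintegral U mu_ mu (g : T -> R) (M : R) : ProperFilter U ->
  setwise_cvg U mu_ mu -> measurable_fun setT g ->
  (forall x, 0 <= g x <= M) ->
  \int[mu_ n]_x g x @[n --> U] --> \int[mu]_x g x.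
Proof.
move=> FU hmu mg gM.
apply/cvgrPdist_lt => e e0.
have M0 : 0 <= M by have /andP[a b] := gM point; apply: le_trans a b.
have [N Nh] : exists N : nat, 3 * (M + 1) / e < N.+1%:R.
  exists (Num.bound (3 * (M + 1) / e)).
  apply: lt_trans (archi_boundP _) _; last by rewrite ltr_nat.
  by apply: divr_ge0; [apply: mulr_ge0 => //; exact: addr_ge0|exact: ltW].
(* After scaling, [k * g] lies in [0, N + 1]. The two layer-cake errors and the distance between the
   finite sums are each at most 1, a total of at most 3 < k e. *)
pose k := N.+1%:R / (M + 1).
have M1 : 0 < M + 1 by rewrite ltr_wpDl.
have k0 : 0 < k by rewrite divr_gt0.
have ke : 3 < k * e by rewrite /k mulrAC ltr_pdivlMr// -ltr_pdivrMr.
pose g' x := k * g x.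
have mg' : measurable_fun setT g' by exact: measurable_funM.
have g'N x : 0 <= g' x <= N.+1%:R.
  have /andP[a b] := gM x; rewrite /g' mulr_ge0 ?(ltW k0)//=.
  by rewrite /k mulrAC ler_pdivrMr// ler_wpM2l//; lra.
have gi P : P.-integrable setT (EFin \o g).
  apply: (@integrable_bounded P _ M) => // x.
  by have /andP[? ?] := gM x; rewrite ger0_norm.
have Ig' P : \int[P]_x g' x = k * \int[P]_x g x by exact: (RintegralZl k measurableT (gi P)).
have mS (i : nat) : measurable [set x | i%:R < g' x].
  rewrite (_ : [set x | _] = g' @^-1` `]i%:R, +oo[); last first.
    by apply/seteqP; split => x /=; rewrite in_itv /= andbT.
  by rewrite -[X in measurable X]setTI; apply: mg' => //; exact: measurable_itv.
have /cvgrPdist_lt/(_ 1 ltr01) : \sum_(i < N.+1) fine (mu_ n [set x | i.+1%:R < g' x]) @[n --> U] -->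
   \sum_(i < N.+1) fine (mu [set x | i.+1%:R < g' x]).
  by apply: cvg_sum_filter => i; exact: hmu.
apply: filterS => n hn.
have h1 := Rintegral_layer (mu_ n) mg' g'N.
have h2 := Rintegral_layer mu mg' g'N.
rewrite -(ltr_pM2l k0) -[k in k * `|_|]gtr0_norm// -normrM mulrBr -!Ig'.
apply: lt_trans ke.
move: hn h1 h2; rewrite !ler_norml !ltr_norml; lra.
Qed.

End setwise_limit.

Section entropy_bounded_limit.
Context d (T : measurableType d) (R : realType).
Variables (nu : probability T R) (mu_ : nat -> probability T R).
Variables (U : set_system nat) (C : R).
Hypothesis UU : UltraFilter U.
Hypothesis muC : forall n, (entropy (mu_ n) nu <= C%:E)%E.

Let C0 : 0 <= C.
Proof. by rewrite -lee_fin; apply: le_trans (muC 0%N); exact: entropy_ge0. Qed.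

Let lm A : R := lim (fine (mu_ n A) @[n --> U]).

Let lm_cvg A : measurable A -> fine (mu_ n A) @[n --> U] --> lm A.
Proof.
move=> mA; apply: (@ultra_cvg_bounded _ _ _ 0 1) => // n.
rewrite fine_ge0//= -lee_fin fineK ?fin_num_measure//; exact: probability_le1.
Qed.

Let lm_ge0 A : measurable A -> 0 <= lm A.
Proof.
by move=> mA; apply: limr_ge; [exact: lm_cvg|apply: nearW => n; exact: fine_ge0].
Qed.

Let lmU A B : measurable A -> measurable B -> A `&` B = set0 ->
  lm (A `|` B) = lm A + lm B.
Proof.
move=> mA mB AB.
have mAB : measurable (A `|` B) by exact: measurableU.
have h : fine (mu_ n (A `|` B)) @[n --> U] --> lm A + lm B.
  have -> : (fun n => fine (mu_ n (A `|` B))) = (fun n => fine (mu_ n A) + fine (mu_ n B)).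
    by apply/funext => n; rewrite measureU// fineD// fin_num_measure.
  by apply: cvgD; exact: lm_cvg.
by apply: cvg_lim h.
Qed.

(** [entropy_young] at g = b 1_A. A large [b], then a small [nu A], make [mu A] small uniformly over
    measures of entropy at most [C]. *)
Lemma entropy_small_set (mu : probability T R) (b : R) A :
  (entropy mu nu <= C%:E)%E -> 0 < b -> measurable A ->
  b * fine (mu A) <= C + (expR b - 1) * fine (nu A).
Proof.
move=> mC b0 mA.
have := @entropy_young _ _ _ mu nu (fun x => b * \1_A x).
have -> : (\int[mu]_x (b * \1_A x)%:E = (b * fine (mu A))%:E)%E.
  under eq_integral do rewrite EFinM.
  rewrite integralZl//; last exact: integrable_indic.
  by rewrite integral_indic// setIT EFinM fineK// fin_num_measure.
have -> : (\int[nu]_x (expR (b * \1_A x) - 1)%:E = ((expR b - 1) * fine (nu A))%:E)%E.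
  transitivity (\int[nu]_x ((expR b - 1)%:E * (\1_A x)%:E))%E.
    apply: eq_integral => x _; rewrite -EFinM indicE.
    by case: (x \in A); rewrite ?mulr1// !mulr0 expR0 subrr.
  rewrite integralZl//; last exact: integrable_indic.
  by rewrite integral_indic// setIT EFinM fineK// fin_num_measure.
move=> h; rewrite -lee_fin EFinD; apply: le_trans (h _ _) _.
- exact: measurable_funM.
- by move=> x; rewrite mulr_ge0// ltW.
- exact: leeD2r.
Qed.

Let lm_small b A : 0 < b -> measurable A -> b * lm A <= C + (expR b - 1) * fine (nu A).
Proof.
move=> b0 mA; rewrite mulrC -ler_pdivlMr//.
apply: limr_le; first exact: lm_cvg.
by apply: nearW => n; rewrite ler_pdivlMr// mulrC entropy_small_set.
Qed.

(** A measure is nonnegative on every set, whereas the limit [lm] is controlled on measurable sets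
    only; elsewhere 0 is taken. *)
Let m (A : set T) : \bar R := if `[< measurable A >] then (lm A)%:E else 0%E.

Let mE A : measurable A -> m A = (lm A)%:E.
Proof. by move=> mA; rewrite /m asboolT. Qed.

Let m0 : m set0 = 0%E.
Proof.
rewrite mE//; congr EFin.
rewrite /lm; under eq_fun do rewrite measure0; exact: lim_cst.
Qed.

Let m_ge0 A : (0 <= m A)%E.
Proof. by rewrite /m; case: asboolP => // mA; rewrite lee_fin lm_ge0. Qed.

Let m_sigma_additive : semi_sigma_additive m.
Proof.
move=> F mF tF mFU.
have mFn n : measurable (\big[setU/set0]_(0 <= i < n) F i).
  by apply: bigsetU_measurable.
have sumE n : (\sum_(0 <= i < n) m (F i))%E = (lm (\big[setU/set0]_(0 <= i < n) F i))%:E.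
  elim: n => [|n IH]; first by rewrite !big_nil -mE// m0.
  rewrite !big_nat_recr//= IH mE// -EFinD; congr EFin; rewrite lmU//.
  rewrite -subset0 => x [].
  rewrite big_mkord -bigcup_mkord => -[i /= iltn Fix] Fnx.
  have : i = n by apply: tF => //; exists x.
  by move=> iE; move: iltn; rewrite iE ltnn.
pose Rn n := (\bigcup_n F n) `\` (\big[setU/set0]_(0 <= i < n) F i).
have mR n : measurable (Rn n) by exact: measurableD.
have sub n : \big[setU/set0]_(0 <= i < n) F i `<=` \bigcup_n F n.
  by rewrite big_mkord -bigcup_mkord; apply: bigcup_sub => i _; exact: bigcup_sup.
have lmR n : lm (\bigcup_n F n) = lm (\big[setU/set0]_(0 <= i < n) F i) + lm (Rn n).
  rewrite -lmU//; first by rewrite setDUK//.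
  exact: setDIK.
have nuR : fine (nu (Rn n)) @[n --> \oo] --> (0 : R).
  have h := @measure_semi_sigma_additive _ _ _ nu F mF tF mFU.
  have : (nu (\bigcup_n F n) - \sum_(0 <= i < n) nu (F i))%E @[n --> \oo] --> (nu (\bigcup_n F n) - nu (\bigcup_n F n))%E.
    apply: cvgeB => //; [|exact: cvg_cst].
    by rewrite fin_num_adde_defr// fin_num_measure.
  rewrite subee ?fin_num_measure// => /fine_cvgP[_].
  apply: cvg_trans; apply: near_eq_cvg; apply: nearW => n /=.
  congr fine; rewrite measureD//; last by rewrite ltey_eq fin_num_measure.
  congr (_ - _)%E; rewrite setIidr//.
  by rewrite !big_mkord measure_semi_additive//; exact: bigsetU_measurable.
rewrite mE//; under eq_fun do rewrite sumE.
apply/fine_cvgP; split; first by apply: nearW.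
apply/cvgrPdist_lt => e e0 /=.
(* [Rn] is what remains of the union, and [nu (Rn n)] tends to 0. Once e^b nu(Rn) < 1, [lm_small]
   gives b lm(Rn) < C + 1 < b e. *)
pose b := 2 * (C + 1) / e.
have b0 : 0 < b by rewrite divr_gt0// mulr_gt0// ltr_wpDl.
have be : b * e = 2 * (C + 1) by rewrite /b mulrVK// unitfE gt_eqF.
have eb0 : 0 < expR b by exact: expR_gt0.
have /cvgrPdist_lt/(_ (1 / expR b)) := nuR.
move=> /(_ (divr_gt0 ltr01 eb0)).
apply: filterS => n; rewrite sub0r normrN ger0_norm ?fine_ge0// => hn.
rewrite (lmR n) addrC addKr ger0_norm ?lm_ge0//.
rewrite -(ltr_pM2l b0) be; apply: le_lt_trans (lm_small b0 (mR n)) _.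
have : expR b * fine (nu (Rn n)) < 1 by rewrite mulrC -ltr_pdivlMr.
have : 0 <= fine (nu (Rn n)) by exact: fine_ge0.
move: C0; rewrite mulrBl mul1r; set z := expR b * _; set y := fine _; lra.
Qed.

HB.instance Definition _ := isMeasure.Build _ _ _ m m0 m_ge0 m_sigma_additive.

Lemma entropy_bounded_setwise_limit : exists mu : probability T R,
  setwise_cvg U mu_ mu /\ mu `<< nu.
Proof.
have m1 : m setT = 1%E.
  rewrite mE//; congr EFin.
  by rewrite /lm; under eq_fun do rewrite probability_setT; exact: lim_cst.
exists (as_probability (m := m) m1); split.
  by move=> A mA; rewrite /as_probability /= mE//=; exact: lm_cvg.
apply/null_content_dominatesP => A mA nuA.
rewrite /as_probability /= mE//; congr EFin; apply/eqP; rewrite eq_le lm_ge0// andbT.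
rewrite leNgt; apply/negP => l0.
have b0 : 0 < (C + 1) / lm A by rewrite divr_gt0// ltr_wpDl.
have := lm_small b0 mA; rewrite mulrVK ?unitfE ?gt_eqF// nuA mulr0; lra.
Qed.

End entropy_bounded_limit.

(** * Lower semi-continuity of the entropy along setwise limits *)

Section entropy_lsc.
Context d (T : measurableType d) (R : realType).
Implicit Types (mu nu : probability T R) (f : T -> R).

(** Young's inequality for a signed bounded [g]; the shift by [M] on both sides keeps every
    integrand nonnegative, so that the inequality can be stated in the extended reals. *)
Lemma entropy_young_bounded mu nu (g : T -> R) (M : R) : measurable_fun setT g ->
  (forall x, `|g x| <= M) ->
  (\int[mu]_x (g x + M)%:E + 1 <=
   entropy mu nu + (\int[nu]_x (expR (g x))%:E + M%:E))%E.
Proof.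
move=> mg gM.
have M0 : 0 <= M by exact: le_trans (gM point).
have gM0 x : 0 <= g x + M by have := gM x; rewrite ler_norml; lra.
have mgM : measurable_fun setT (fun x => g x + M) by exact: measurable_funD.
have me : measurable_fun setT (fun x => expR (g x)) by exact: measurableT_comp.
have [h|] := ltP (entropy mu nu) +oo%E; last first.
  rewrite leye_eq => /eqP ->; rewrite addye ?leey// gt_eqF//.
  apply: (@lt_le_trans _ _ 0%E) => //; apply: adde_ge0; last by rewrite lee_fin.
  by apply: integral_ge0 => x _; rewrite lee_fin expR_ge0.
have [f hf ->] := entropy_density h; have [mf f0 _] := hf.
rewrite (integral_density hf)//.
have -> : (1 = \int[nu]_x (1%:E : \bar R))%E by rewrite integral_probability_cst.
have -> : (M%:E = \int[nu]_x ((M * f x)%:E : \bar R))%E.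
  under eq_integral do rewrite EFinM.
  rewrite integralZl//; last exact: has_density_integrable hf.
  by rewrite (has_density_int hf) mule1.
rewrite -!ge0_integralD//; try (by move=> x _; rewrite lee_fin ?mulr_ge0// ?expR_ge0// theta_ge0);
  try (by apply/measurable_EFinP; exact: measurable_funM); try exact/measurable_EFinP.
- apply: ge0_le_integral => //.
  + by move=> x _; rewrite adde_ge0// lee_fin mulr_ge0.
  + apply: emeasurable_funD => //; apply/measurable_EFinP; exact: measurable_funM.
  + apply: emeasurable_funD; first exact: measurable_theta_comp.
    by apply: emeasurable_funD; apply/measurable_EFinP => //; exact: measurable_funM.
  move=> x _; rewrite -!EFinD lee_fin.
  have := theta_young (g x) (f0 x); set z := theta _; set w := expR _; nra.
- exact: measurable_theta_comp.
- by move=> x _; rewrite -EFinD lee_fin addr_ge0 ?expR_ge0// mulr_ge0.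
- by apply: emeasurable_funD; apply/measurable_EFinP => //; exact: measurable_funM.
Qed.

Lemma limn_einf_le (u : (\bar R)^nat) c : (forall n, (u n <= c)%E) ->
  (limn_einf u <= c)%E.
Proof.
move=> uc; rewrite limn_einf_lim; apply: lime_le; first exact: is_cvg_einfs.
apply: nearW => n; apply: le_trans (uc n).
by apply: ereal_inf_lbound; exists n => /=.
Qed.

Let clamp (k y : R) := Num.max k^-1 (Num.min k y).

Let clamp_bounds k y : 1 <= k -> k^-1 <= clamp k y <= k.
Proof.
move=> k1; rewrite /clamp le_max lexx/= ge_max ge_min lexx /= andbT.
by rewrite (le_trans _ k1)// invf_le1// (lt_le_trans _ k1).
Qed.

Let clamp_gt0 k y : 1 <= k -> 0 < clamp k y.
Proof.
move=> k1; have /andP[h _] := clamp_bounds y k1; apply: lt_le_trans h.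
by rewrite invr_gt0 (lt_le_trans _ k1).
Qed.

(** Clamping moves [y] towards 1, hence c ln c <= y ln c for the clamped value c, and the quantity
    is at least [theta c]. *)
Let clamp_theta k y : 1 <= k -> 0 <= y -> 0 <= y * ln (clamp k y) - clamp k y + 1.
Proof.
move=> k1 y0; have k0 : 0 < k by rewrite (lt_le_trans _ k1).
have c0 := clamp_gt0 y k1.
have := theta_ge0 (ltW c0); rewrite /theta.
suff : clamp k y * ln (clamp k y) <= y * ln (clamp k y) by lra.
have ki1 : k^-1 <= 1 by rewrite invf_le1.
rewrite /clamp; have [ky|yk] := leP k y.
  by rewrite max_r ?(le_trans ki1)// ler_wpM2r// ln_ge0.
have [h|h] := leP k^-1 y => //.
by rewrite ler_wnM2r ?ln_le0// ltW.
Qed.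

(** Young's inequality is tight at b = ln f, which may be unbounded, while setwise limits pass
    through bounded test functions. Hence the clamp of [f] to [1/k, k]: each resulting integrand
    [w n] is nonnegative with integral at most [c], and Fatou's lemma recovers [theta f]. *)
Lemma entropy_lsc (U : set_system nat) (mu_ : nat -> probability T R) mu nu (c : R) :
  ProperFilter U -> setwise_cvg U mu_ mu -> mu `<< nu ->
  (\forall n \near U, entropy (mu_ n) nu <= c%:E)%E -> (entropy mu nu <= c%:E)%E.
Proof.
move=> FU hmu munu hc.
have [f hf] := has_density_exists munu; have [mf f0 _] := hf.
rewrite (entropyE hf).
pose k (n : nat) : R := n.+1%:R.
have k1 n : 1 <= k n by rewrite /k ler1n.
pose fk n x := clamp (k n) (f x).
have mfk n : measurable_fun setT (fk n).
  by apply: measurable_maxr => //; apply: measurable_minr.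
pose w n x := f x * ln (fk n x) - fk n x + 1.
have w0 n x : 0 <= w n x by exact: clamp_theta.
have mln n : measurable_fun setT (fun x => ln (fk n x)).
  exact: measurableT_comp (@measurable_ln R) (mfk n).
have mw n : measurable_fun setT (fun x => (w n x)%:E).
  apply/measurable_EFinP; apply: measurable_funD => //; apply: measurable_funB => //.
  exact: measurable_funM.
have Iw n : (\int[nu]_x (w n x)%:E <= c%:E)%E.
  pose M := ln (k n).
  have M0 : 0 <= M by exact: ln_ge0.
  have fkM x : `|ln (fk n x)| <= M.
    have /andP[a b] := clamp_bounds (f x) (k1 n).
    have k0 : 0 < k n by rewrite (lt_le_trans _ (k1 n)).
    rewrite ler_norml; apply/andP; split.
      by rewrite /M -lnV ?posrE// ler_ln ?posrE ?invr_gt0// clamp_gt0.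
    by rewrite ler_ln ?posrE// clamp_gt0.
  have gM0 x : 0 <= ln (fk n x) + M by have := fkM x; rewrite ler_norml; lra.
  have mgM : measurable_fun setT (fun x => ln (fk n x) + M) by exact: measurable_funD.
  have efk : (\int[nu]_x (expR (ln (fk n x)))%:E = \int[nu]_x (fk n x)%:E)%E.
    by apply: eq_integral => x _; rewrite lnK// posrE clamp_gt0.
  have Ifk : (\int[nu]_x (fk n x)%:E)%E \is a fin_num.
    apply: integrable_fin_num => //; apply: (@integrable_bounded _ _ _ nu _ (k n)) => // x.
    by have /andP[a b] := clamp_bounds (f x) (k1 n); rewrite ger0_norm// ltW// clamp_gt0.
  have gi (P : probability T R) : P.-integrable setT (EFin \o (fun x => ln (fk n x) + M)).
    apply: (@integrable_bounded _ _ _ P _ (M + M)) => // x.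
    by rewrite ger0_norm// lerD2r; have := fkM x; rewrite ler_norml => /andP[].
  have key : \int[mu]_x (ln (fk n x) + M) + 1 <= c + fine (\int[nu]_x (fk n x)%:E) + M.
    rewrite -lerBrDr.
    have gb x : 0 <= ln (fk n x) + M <= M + M.
      by rewrite gM0/= lerD2r; have := fkM x; rewrite ler_norml => /andP[].
    have gcv := setwise_cvg_Rintegral FU hmu mgM gb.
    rewrite -(cvg_lim _ gcv)//; apply: limr_le; first by apply/cvg_ex; eexists; exact: gcv.
    apply: filterS hc => i hi.
    have := entropy_young_bounded (mu_ i) nu (mln n) fkM.
    rewrite efk -(fineK Ifk) -(fineK (integrable_fin_num measurableT (gi (mu_ i)))).
    move=> /le_trans /(_ (leeD2r _ hi)); rewrite -!EFinD lee_fin /Rintegral; lra.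
  have E : (\int[nu]_x ((w n x)%:E + ((fk n x)%:E + (M * f x)%:E)) =
      \int[nu]_x (((ln (fk n x) + M) * f x)%:E + 1%:E))%E.
    by apply: eq_integral => x _; rewrite -!EFinD; congr EFin; rewrite /w; ring.
  move: E; rewrite !ge0_integralD//; try (by move=> x _; rewrite lee_fin ?mulr_ge0// ltW// clamp_gt0);
   try (by apply/measurable_EFinP; exact: measurable_funM); try exact/measurable_EFinP.
  - have -> : (\int[nu]_x (M * f x)%:E = M%:E)%E.
      under eq_integral do rewrite EFinM.
      rewrite integralZl//; last exact: has_density_integrable hf.
      by rewrite (has_density_int hf) mule1.
    have <- : (\int[mu]_x (ln (fk n x) + M)%:E = \int[nu]_x ((ln (fk n x) + M) * f x)%:E)%E.
      exact: integral_density.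
    rewrite integral_probability_cst.
    rewrite -(fineK Ifk) -(fineK (integrable_fin_num measurableT (gi mu))).
    move: key; rewrite /Rintegral; set a := fine _; set b := fine _.
    have : (0 <= \int[nu]_x (w n x)%:E)%E by apply: integral_ge0 => x _; rewrite lee_fin.
    case: (\int[nu]_x (w n x)%:E)%E => // r _ key [] h; rewrite lee_fin; move: h key; lra.
  - by move=> x _; rewrite -EFinD lee_fin addr_ge0// ?mulr_ge0// ltW// clamp_gt0.
  - by apply: emeasurable_funD; apply/measurable_EFinP => //; exact: measurable_funM.
have wcvg x : (w n x)%:E @[n --> \oo] --> (theta (f x))%:E.
  apply: cvg_EFin; first exact: nearW.
  have := f0 x; rewrite le_eqVlt => /predU1P[fx0|fx0].
    have -> : fine \o (fun n => (w n x)%:E) = (fun n => - harmonic n + 1).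
      apply/funext => n /=; rewrite /w /fk /clamp -fx0 mul0r sub0r min_r// max_l// invr_ge0//.
    rewrite -fx0 theta0 /=; rewrite -[X in _ --> X]add0r -[X in X + _]oppr0.
    by apply: cvgD; [apply: cvgN; exact: cvg_harmonic|exact: cvg_cst].
  apply: (@cvg_near_cst _ _ _ _ _ _).
  have [N hN] : exists N : nat, Num.max (f x) (f x)^-1 < N%:R.
    by exists (Num.bound (Num.max (f x) (f x)^-1)); apply: archi_boundP; rewrite le_max ltW.
  near=> n.
  have Nn : (N <= n)%N by near: n; exact: nbhs_infty_ge.
  have : Num.max (f x) (f x)^-1 < k n.
    by apply: lt_le_trans hN _; rewrite ler_nat (leq_trans Nn).
  rewrite gt_max => /andP[h1 h2].
  rewrite /= /w /fk /clamp (min_r (ltW h1)) max_r//.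
  by rewrite invf_ple ?posrE// ltW.
have -> : (\int[nu]_x (theta (f x))%:E = \int[nu]_x limn_einf (fun n => (w n x)%:E))%E.
  apply: eq_integral => x _; apply/esym.
  by have /cvg_limn_einf_sup[-> _] := wcvg x.
apply: le_trans (fatou _ _ _ _) _ => //.
  by move=> n x _; rewrite lee_fin.
exact: limn_einf_le.
Unshelve. all: end_near. Qed.

End entropy_lsc.

(** * Wasserstein convergence of setwise limits *)

Section cell_coupling.
Context dX (X : measurableType dX) (R : realType).
Implicit Types (mu nu : probability X R).
Local Open Scope ereal_scope.

Lemma integral_prod_mul mu nu (f g : X -> \bar R) :
  measurable_fun setT f -> measurable_fun setT g ->
  (forall x, 0 <= f x) -> (forall x, 0 <= g x) ->
  \int[mu \x nu]_z (f z.1 * g z.2) = \int[mu]_x f x * \int[nu]_y g y.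
Proof.
move=> mf mg f0 g0.
rewrite fubini_tonelli1//; last 2 first.
- by apply: emeasurable_funM; [exact: measurableT_comp mf _|exact: measurableT_comp mg _].
- by move=> z; rewrite mule_ge0.
rewrite /fubini_F/=.
have G0 : 0 <= \int[nu]_y g y by apply: integral_ge0.
rewrite muleC -ge0_integralZl//.
by apply: eq_integral => x _; rewrite ge0_integralZl// muleC.
Qed.

Variables (mu nu : probability X R) (A : (set X)^nat) (N : nat).
Hypotheses (mA : forall i, measurable (A i)) (tA : trivIset setT A).

Let a i : R := fine (mu (A i)).
Let b i : R := fine (nu (A i)).
Let m i : R := Num.min (a i) (b i).
Let rho : R := (1 - \sum_(i < N) m i)%R.
Let u (x : X) : R := (1 - \sum_(i < N) m i / a i * \1_(A i) x)%R.
Let v (x : X) : R := (1 - \sum_(i < N) m i / b i * \1_(A i) x)%R.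
Let w1 (z : X * X) : R :=
  (\sum_(i < N) (m i / (a i * b i) * \1_(A i) z.1) * \1_(A i) z.2)%R.
(* The diagonal part [w1] couples the masses common to each cell, the residual masses
   are coupled independently. *)
Let w (z : X * X) : R := (w1 z + u z.1 * (v z.2 / rho))%R.

Let a0 i : (0 <= a i)%R. Proof. exact: fine_ge0. Qed.
Let b0 i : (0 <= b i)%R. Proof. exact: fine_ge0. Qed.
Let m0 i : (0 <= m i)%R. Proof. by rewrite le_min a0 b0. Qed.

Let aE i : mu (A i) = (a i)%:E.
Proof. by rewrite fineK// fin_num_measure. Qed.

Let bE i : nu (A i) = (b i)%:E.
Proof. by rewrite fineK// fin_num_measure. Qed.

(** Covers cells of mass zero, where [r / 0 = 0]: the shared mass [m i] vanishes there as well. *)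
Let mulKm (r s : R) : (s = 0 -> r = 0)%R -> (r / s * s = r)%R.
Proof.
have [->|s0] := eqVneq s 0%R; first by move=> ->//; rewrite mulr0.
by move=> _; rewrite mulfVK.
Qed.

Let ma i : (a i = 0 -> m i = 0)%R.
Proof. by move=> h; apply/eqP; rewrite eq_le m0 andbT /m h ge_min lexx. Qed.

Let mb i : (b i = 0 -> m i = 0)%R.
Proof. by move=> h; apply/eqP; rewrite eq_le m0 andbT /m h ge_min lexx orbT. Qed.

Let sum_indic_le1 (q : nat -> R) x : (forall i, (0 <= q i <= 1)%R) ->
  (0 <= \sum_(i < N) q i * \1_(A i) x <= 1)%R.
Proof.
move=> q01; apply/andP; split.
  by apply: sumr_ge0 => i _; rewrite mulr_ge0//; have /andP[] := q01 i.
have [[i Aix]|h] := pselect (exists i : 'I_N, A i x).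
  rewrite (bigD1 i)//= indicE mem_set// mulr1 big1 ?addr0; first by have /andP[] := q01 i.
  move=> j ji; rewrite indicE memNset ?mulr0// => Ajx; move/eqP: ji; apply.
  by apply: ord_inj; apply: tA => //; exists x.
rewrite big1 ?ler01// => i _; rewrite indicE memNset ?mulr0// => Aix.
by apply: h; exists i.
Qed.

Let mdiv01 (s r : R) : (0 <= s)%R -> (0 <= r)%R -> (0 <= Num.min s r / s <= 1)%R.
Proof.
move=> s0 r0; have [->|sn0] := eqVneq s 0%R; first by rewrite invr0 mulr0 lexx ler01.
have sp : (0 < s)%R by rewrite lt_neqAle eq_sym sn0.
by rewrite divr_ge0 ?le_min ?s0 ?r0//= ler_pdivrMr// mul1r ge_min lexx.
Qed.

Let u01 x : (0 <= u x <= 1)%R.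
Proof.
have := @sum_indic_le1 (fun i => m i / a i)%R x (fun i => mdiv01 (a0 i) (b0 i)).
by rewrite /u; lra.
Qed.

Let v01 x : (0 <= v x <= 1)%R.
Proof.
have := @sum_indic_le1 (fun i => m i / b i)%R x; rewrite /v => h.
have : (0 <= \sum_(i < N) m i / b i * \1_(A i) x <= 1)%R.
  by apply: h => i; rewrite /m minC; exact: mdiv01.
by lra.
Qed.

Let msum (q : nat -> R) : measurable_fun setT (fun x => \sum_(i < N) q i * \1_(A i) x : R)%R.
Proof.
apply: measurable_sum => i; apply: measurable_funM => //; exact: measurable_indic.
Qed.

Let mu_ : measurable_fun setT u.
Proof. by apply: measurable_funB => //; exact: (msum (fun i => m i / a i)%R). Qed.

Let mv_ : measurable_fun setT v.
Proof. by apply: measurable_funB => //; exact: (msum (fun i => m i / b i)%R). Qed.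

Let int_sum (P : probability X R) (q : nat -> R) : (forall i, (0 <= q i)%R) ->
  \int[P]_x (\sum_(i < N) q i * \1_(A i) x)%:E = (\sum_(i < N) q i * fine (P (A i)))%:E.
Proof.
move=> q0; under eq_integral do rewrite -sumEFin.
rewrite ge0_integral_sum//.
- rewrite -sumEFin; apply: eq_bigr => i _; under eq_integral do rewrite EFinM.
  rewrite integralZl//; last exact: integrable_indic.
  by rewrite integral_indic// setIT EFinM fineK// fin_num_measure.
- by move=> i; apply/measurable_EFinP; apply: measurable_funM => //; exact: measurable_indic.
- by move=> i x _; rewrite lee_fin mulr_ge0.
Qed.

Let int_u : \int[mu]_x (u x)%:E = rho%:E.
Proof.
under eq_integral do rewrite EFinB.
rewrite integralB//; last 2 first.
- exact: finite_measure_integrable_cst.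
- apply: (@integrable_bounded _ _ _ mu _ 1%R); first exact: (msum (fun i => m i / a i)%R).
  by move=> x; have := u01 x; rewrite /u ler_norml; lra.
rewrite integral_probability_cst (@int_sum mu (fun i => m i / a i)%R); last by move=> i; rewrite divr_ge0.
rewrite -EFinB; congr EFin; congr (_ - _)%R; apply: eq_bigr => i _; apply: mulKm; exact: ma.
Qed.

Let int_v : \int[nu]_x (v x)%:E = rho%:E.
Proof.
under eq_integral do rewrite EFinB.
rewrite integralB//; last 2 first.
- exact: finite_measure_integrable_cst.
- apply: (@integrable_bounded _ _ _ nu _ 1%R); first exact: (msum (fun i => m i / b i)%R).
  by move=> x; have := v01 x; rewrite /v ler_norml; lra.
rewrite integral_probability_cst (@int_sum nu (fun i => m i / b i)%R); last by move=> i; rewrite divr_ge0.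
rewrite -EFinB; congr EFin; congr (_ - _)%R; apply: eq_bigr => i _; apply: mulKm; exact: mb.
Qed.

Let rho0 : (0 <= rho)%R.
Proof.
by rewrite -lee_fin -int_u; apply: integral_ge0 => x _; rewrite lee_fin; have /andP[] := u01 x.
Qed.

Let w10 z : (0 <= w1 z)%R.
Proof. by apply: sumr_ge0 => i _; rewrite !mulr_ge0// invr_ge0 mulr_ge0. Qed.

Let u0 x : (0 <= u x)%R. Proof. by have /andP[] := u01 x. Qed.
Let v0 x : (0 <= v x)%R. Proof. by have /andP[] := v01 x. Qed.

Let w20 z : (0 <= u z.1 * (v z.2 / rho))%R.
Proof. by rewrite mulr_ge0// divr_ge0. Qed.

Let w0 z : (0 <= w z)%R.
Proof. by rewrite addr_ge0. Qed.

Let mfst dY (Y : measurableType dY) (f : X -> Y) : measurable_fun setT f ->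
  measurable_fun setT (fun z : X * X => f z.1).
Proof. by move=> mf; apply: measurableT_comp mf _; exact: measurable_fst. Qed.

Let msnd dY (Y : measurableType dY) (f : X -> Y) : measurable_fun setT f ->
  measurable_fun setT (fun z : X * X => f z.2).
Proof. by move=> mf; apply: measurableT_comp mf _; exact: measurable_snd. Qed.

Let mw1 : measurable_fun setT w1.
Proof.
apply: measurable_sum => i; apply: measurable_funM; first apply: measurable_funM => //.
- by apply: mfst; exact: measurable_indic.
- by apply: msnd; exact: measurable_indic.
Qed.

Let mw2 : measurable_fun setT (fun z : X * X => u z.1 * (v z.2 / rho))%R.
Proof.
apply: measurable_funM; first exact: mfst mu_.
apply: measurable_funM => //; exact: msnd mv_.
Qed.

Let mw : measurable_fun setT w.
Proof. exact: measurable_funD. Qed.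

Let int_w (f g : X -> R) : measurable_fun setT f -> measurable_fun setT g ->
  (forall x, (0 <= f x)%R) -> (forall x, (0 <= g x)%R) ->
  \int[mu \x nu]_z (f z.1 * g z.2 * w z)%:E =
  \sum_(i < N) (\int[mu]_x (f x * (m i / (a i * b i) * \1_(A i) x))%:E
                * \int[nu]_x (g x * \1_(A i) x)%:E)
  + \int[mu]_x (f x * u x)%:E * \int[nu]_x (g x * (v x / rho))%:E.
Proof.
move=> mf mg f0 g0.
have mi i : measurable_fun setT (\1_(A i) : X -> R) by exact: measurable_indic.
transitivity (\int[mu \x nu]_z (\sum_(i < N) ((f z.1 * (m i / (a i * b i) * \1_(A i) z.1))%:E * (g z.2 * \1_(A i) z.2)%:E)
   + (f z.1 * u z.1)%:E * (g z.2 * (v z.2 / rho))%:E)).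
  apply: eq_integral => z _; rewrite /w /w1 mulrDr mulr_sumr EFinD -sumEFin.
  congr (_ + _); first by apply: eq_bigr => i _; rewrite -EFinM; congr EFin; ring.
  by rewrite -EFinM; congr EFin; ring.
have mm i : measurable_fun setT (fun x => (f x * (m i / (a i * b i) * \1_(A i) x))%:E).
  by apply/measurable_EFinP; apply: measurable_funM => //; apply: measurable_funM.
have mm' i : measurable_fun setT (fun x => (g x * \1_(A i) x)%:E).
  by apply/measurable_EFinP; apply: measurable_funM => //; apply: measurable_funM.
have mm2 : measurable_fun setT (fun x => (f x * u x)%:E).
  by apply/measurable_EFinP; apply: measurable_funM.
have mm3 : measurable_fun setT (fun x => (g x * (v x / rho))%:E).
  by apply/measurable_EFinP; apply: measurable_funM => //; apply: measurable_funM.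
have g1 i x : 0 <= (f x * (m i / (a i * b i) * \1_(A i) x))%:E.
  by rewrite lee_fin !mulr_ge0// invr_ge0 mulr_ge0.
have g2 i x : 0 <= (g x * \1_(A i) x)%:E by rewrite lee_fin mulr_ge0.
have g3 x : 0 <= (f x * u x)%:E by rewrite lee_fin mulr_ge0.
have g4 x : 0 <= (g x * (v x / rho))%:E by rewrite lee_fin mulr_ge0// divr_ge0.
have mp (p q : X -> \bar R) : measurable_fun setT p -> measurable_fun setT q ->
    measurable_fun setT (fun z : X * X => p z.1 * q z.2).
  by move=> ? ?; apply: emeasurable_funM; [exact: mfst|exact: msnd].
rewrite ge0_integralD//; last 4 first.
- by move=> z _; apply: sume_ge0 => i _; exact: mule_ge0.
- by apply: emeasurable_sum => i; exact: (mp _ _ (mm i) (mm' i)).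
- by move=> z _; exact: mule_ge0.
- exact: (mp _ _ mm2 mm3).
congr (_ + _); last exact: (@integral_prod_mul mu nu _ _ mm2 mm3).
rewrite ge0_integral_sum//.
- by apply: eq_bigr => i _; exact: (@integral_prod_mul mu nu _ _ (mm i) (mm' i)).
- by move=> i; exact: (mp _ _ (mm i) (mm' i)).
- by move=> i z _; exact: mule_ge0.
Qed.

Let int_vrho : \int[nu]_x (v x / rho)%:E = (rho / rho)%:E.
Proof.
under eq_integral do rewrite mulrC EFinM.
rewrite ge0_integralZl//; last 3 first.
- exact/measurable_EFinP.
- by move=> x _; rewrite lee_fin.
- by rewrite lee_fin invr_ge0.
by rewrite int_v -EFinM mulrC.
Qed.

(** When no residual mass is left, [v / rho] is 0 by convention; the residual part of each marginal
    is then null too, so the marginals remain correct. *)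
Let rho_mul (s : \bar R) : 0 <= s -> s <= rho%:E -> s * (rho / rho)%:E = s.
Proof.
have [->|r0] := eqVneq rho 0%R; last by rewrite divff// mule1.
move=> s0 s1; have -> : s = 0%E by apply/eqP; rewrite eq_le; apply/andP; split.
by rewrite mul0e.
Qed.

Let marginal1 B : measurable B ->
  \int[mu \x nu]_z (\1_B z.1 * w z)%:E = mu B.
Proof.
move=> mB.
have mi C : measurable C -> measurable_fun setT (\1_C : X -> R) by move=> ?; exact: measurable_indic.
transitivity (\int[mu \x nu]_z (\1_B z.1 * cst 1%R z.2 * w z)%:E).
  by apply: eq_integral => z _; rewrite /= mulr1.
rewrite int_w//.
transitivity (\sum_(i < N) \int[mu]_x (m i / a i * \1_(A i `&` B) x)%:E + \int[mu]_x (\1_B x * u x)%:E).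
  congr (_ + _).
    apply: eq_bigr => i _.
    rewrite [X in _ * X](_ : _ = (b i)%:E); last first.
      by under eq_integral do rewrite /= mul1r; rewrite integral_indic// setIT; exact: bE.
    rewrite muleC -ge0_integralZl//; last 3 first.
    - by apply/measurable_EFinP; apply: measurable_funM; [exact: mi|apply: measurable_funM => //; exact: mi].
    - by move=> x _; rewrite lee_fin !mulr_ge0// invr_ge0 mulr_ge0.
    - by rewrite lee_fin.
    apply: eq_integral => x _; rewrite -EFinM indicI; congr EFin.
    have -> : (b i * (\1_B x * (m i / (a i * b i) * \1_(A i) x)) =
       (m i / b i * b i) / a i * (\1_(A i) x * \1_B x))%R by rewrite invfM; ring.
    by rewrite mulKm//; exact: mb.
  rewrite [X in _ * X](_ : _ = (rho / rho)%:E); last first.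
    by rewrite -int_vrho; apply: eq_integral => x _; rewrite /= mul1r.
  apply: rho_mul; first by apply: integral_ge0 => x _; rewrite lee_fin mulr_ge0.
  rewrite -int_u; apply: ge0_le_integral => //.
  - by move=> x _; rewrite lee_fin mulr_ge0.
  - by apply/measurable_EFinP; apply: measurable_funM => //; exact: mi.
  - exact/measurable_EFinP.
  - move=> x _; rewrite lee_fin indicE; case: (_ \in _); rewrite ?mul1r// mul0r//.
rewrite -ge0_integral_sum//; last 2 first.
- move=> i; apply/measurable_EFinP; apply: measurable_funM => //; apply: mi; exact: measurableI.
- by move=> i x _; rewrite lee_fin mulr_ge0// divr_ge0.
rewrite -ge0_integralD//; last 4 first.
- by move=> x _; apply: sume_ge0 => i _; rewrite lee_fin mulr_ge0// divr_ge0.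
- apply: emeasurable_sum => i; apply/measurable_EFinP; apply: measurable_funM => //; apply: mi; exact: measurableI.
- by move=> x _; rewrite lee_fin mulr_ge0.
- by apply/measurable_EFinP; apply: measurable_funM => //; exact: mi.
transitivity (\int[mu]_x (\1_B x)%:E); last by rewrite integral_indic// setIT.
apply: eq_integral => x _; rewrite sumEFin -EFinD; congr EFin.
rewrite /u mulrBr mulr1 addrCA -[RHS]addr0; congr (_ + _)%R.
rewrite mulr_sumr -sumrB big1// => i _; rewrite indicI/=; ring.
Qed.

Let marginal2 B : measurable B ->
  \int[mu \x nu]_z (\1_B z.2 * w z)%:E = nu B.
Proof.
move=> mB.
have mi C : measurable C -> measurable_fun setT (\1_C : X -> R) by move=> ?; exact: measurable_indic.
transitivity (\int[mu \x nu]_z (cst 1%R z.1 * \1_B z.2 * w z)%:E).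
  by apply: eq_integral => z _; rewrite /= mul1r.
rewrite int_w//.
transitivity (\sum_(i < N) \int[nu]_x (m i / b i * \1_(A i `&` B) x)%:E + \int[nu]_x (\1_B x * v x)%:E).
  congr (_ + _).
    apply: eq_bigr => i _.
    rewrite [X in X * _](_ : _ = (m i / (a i * b i) * a i)%:E); last first.
      under eq_integral do rewrite /= mul1r EFinM.
      rewrite integralZl//; last exact: integrable_indic.
      by rewrite integral_indic// setIT [RHS]EFinM; congr (_ * _); exact: aE.
    rewrite -ge0_integralZl//; last 2 first.
    - by apply/measurable_EFinP; apply: measurable_funM; exact: mi.
    - by rewrite lee_fin !mulr_ge0// invr_ge0 mulr_ge0.
    apply: eq_integral => x _; rewrite -EFinM indicI; congr EFin.
    have -> : (m i / (a i * b i) * a i * (\1_B x * \1_(A i) x) =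
       (m i / a i * a i) / b i * (\1_(A i) x * \1_B x))%R by rewrite invfM; ring.
    by rewrite mulKm//; exact: ma.
  rewrite [X in X * _](_ : _ = rho%:E); last first.
    by rewrite -int_u; apply: eq_integral => x _; rewrite /= mul1r.
  rewrite -ge0_integralZl//; last 2 first.
  - apply/measurable_EFinP; apply: measurable_funM; first exact: mi.
    exact: measurable_funM.
  - by move=> x _; rewrite lee_fin mulr_ge0// divr_ge0.
  rewrite -[RHS]rho_mul; last 2 first.
  - by apply: integral_ge0 => x _; rewrite lee_fin mulr_ge0.
  - rewrite -int_v; apply: ge0_le_integral => //.
    + by move=> x _; rewrite lee_fin mulr_ge0.
    + by apply/measurable_EFinP; apply: measurable_funM => //; exact: mi.
    + exact/measurable_EFinP.
    + by move=> x _; rewrite lee_fin indicE; case: (_ \in _); rewrite ?mul1r// mul0r.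
  rewrite muleC -ge0_integralZl//; last 3 first.
  - by apply/measurable_EFinP; apply: measurable_funM => //; exact: mi.
  - by move=> x _; rewrite lee_fin mulr_ge0.
  - by rewrite lee_fin divr_ge0.
  by apply: eq_integral => x _; rewrite -!EFinM; congr EFin; ring.
rewrite -ge0_integral_sum//; last 2 first.
- move=> i; apply/measurable_EFinP; apply: measurable_funM => //; apply: mi; exact: measurableI.
- by move=> i x _; rewrite lee_fin mulr_ge0// divr_ge0.
rewrite -ge0_integralD//; last 4 first.
- by move=> x _; apply: sume_ge0 => i _; rewrite lee_fin mulr_ge0// divr_ge0.
- apply: emeasurable_sum => i; apply/measurable_EFinP; apply: measurable_funM => //; apply: mi; exact: measurableI.
- by move=> x _; rewrite lee_fin mulr_ge0.
- by apply/measurable_EFinP; apply: measurable_funM => //; exact: mi.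
transitivity (\int[nu]_x (\1_B x)%:E); last by rewrite integral_indic// setIT.
apply: eq_integral => x _; rewrite sumEFin -EFinD; congr EFin.
rewrite /v mulrBr mulr1 addrCA -[RHS]addr0; congr (_ + _)%R.
rewrite mulr_sumr -sumrB big1// => i _; rewrite indicI/=; ring.
Qed.

Let int_w_total : \int[mu \x nu]_z (w z)%:E = 1.
Proof.
rewrite -(probability_setT mu) -marginal1//.
by apply: eq_integral => z _; rewrite indicT mul1r.
Qed.

(** Pairs from the diagonal part share a cell and cost at most [e]. The residual part has mass 1
    minus the shared masses, and there K <= h x + h y with each [h] cut at level [S]: the excess
    goes into the tails, the rest is at most [S] times the residual mass. *)
Lemma cell_coupling : exists pi : probability (X * X)%type R, coupling mu nu pi /\
  forall (K : X * X -> R) (h : X -> R) (e S : R),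
    measurable_fun setT K -> measurable_fun setT h ->
    (forall z, (0 <= K z)%R) -> (forall x, (0 <= h x)%R) -> (0 <= e)%R -> (0 <= S)%R ->
    (forall i x y, (i < N)%N -> A i x -> A i y -> (K (x, y) <= e)%R) ->
    (forall x y, (K (x, y) <= h x + h y)%R) ->
    \int[pi]_z (K z)%:E <= (e + 2 * S * (1 - \sum_(i < N)
        Num.min (fine (mu (A i))) (fine (nu (A i)))))%:E
      + \int[mu]_x (h x * \1_[set x | S < h x]%R x)%:E
      + \int[nu]_x (h x * \1_[set x | S < h x]%R x)%:E.
Proof.
have [pi pid] := probability_density mw w0 int_w_total.
have [_ _ piE] := pid.
exists pi; split.
  split => B mB; rewrite piE.
  - rewrite -[RHS]marginal1// integral_mkcond; apply: eq_integral => z _.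
    rewrite patchE indicE (_ : (z \in fst @^-1` B) = (z.1 \in B))//.
    by case: (_ \in B); rewrite ?mul1r ?mul0r.
  - by rewrite -[X in measurable X]setTI; exact: measurable_fst.
  - rewrite -[RHS]marginal2// integral_mkcond; apply: eq_integral => z _.
    rewrite patchE indicE (_ : (z \in snd @^-1` B) = (z.2 \in B))//.
    by case: (_ \in B); rewrite ?mul1r ?mul0r.
  - by rewrite -[X in measurable X]setTI; exact: measurable_snd.
move=> K h e S mK mh K0 h0 e0 S0 Ke Kh.
have mS : measurable [set x | (S < h x)%R].
  rewrite (_ : [set x | _] = h @^-1` `]S, +oo[); last first.
    by apply/seteqP; split => x /=; rewrite in_itv /= andbT.
  by rewrite -[X in measurable X]setTI; apply: mh => //; exact: measurable_itv.
pose t := (fun x => h x * \1_[set x | S < h x]%R x)%R.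
have mt : measurable_fun setT t by apply: measurable_funM => //; exact: measurable_indic.
have t0 x : (0 <= t x)%R by rewrite mulr_ge0.
have tail (P : probability X R) (q : X -> R) : measurable_fun setT q ->
    (forall x, (0 <= q x <= 1)%R) -> \int[P]_x (q x)%:E = rho%:E ->
    \int[P]_x (h x * q x)%:E <= (S * rho)%:E + \int[P]_x (t x)%:E.
  move=> mq q01 qr.
  have q0 x : (0 <= q x)%R by have /andP[] := q01 x.
  rewrite EFinM -qr -ge0_integralZl//; last 2 first.
  - exact/measurable_EFinP.
  - by move=> x _; rewrite lee_fin.
  rewrite -ge0_integralD//; last 4 first.
  - by move=> x _; rewrite -EFinM lee_fin mulr_ge0.
  - by apply/measurable_EFinP; exact: measurable_funM.
  - by move=> x _; rewrite lee_fin.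
  - exact/measurable_EFinP.
  apply: ge0_le_integral => //.
  - by move=> x _; rewrite lee_fin mulr_ge0.
  - by apply/measurable_EFinP; exact: measurable_funM.
  - by apply/measurable_EFinP; apply: measurable_funD => //; exact: measurable_funM.
  move=> x _; rewrite -EFinM -EFinD lee_fin /t indicE.
  have /andP[_ q1] := q01 x.
  have [Sh|hS] := ltP S (h x).
    rewrite mem_set//= mulr1 -[X in (X <= _)%R]add0r lerD ?mulr_ge0//.
    by rewrite ler_piMr.
  by rewrite memNset /= ?mulr0 ?addr0 ?ler_wpM2r//; apply/negP; rewrite -leNgt.
rewrite (ge0_integral_density pid)//; last exact/measurable_EFinP.
have mvr : measurable_fun setT (fun x => v x / rho)%R by apply: measurable_funM.
have vr0 x : (0 <= v x / rho)%R by rewrite divr_ge0.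
apply: (@le_trans _ _ (\int[mu \x nu]_z ((e * w1 z)%:E +
   ((h z.1 * u z.1)%:E * (v z.2 / rho)%:E + (u z.1)%:E * (h z.2 * (v z.2 / rho))%:E)))).
  apply: ge0_le_integral => //.
  - by move=> z _; rewrite -EFinM lee_fin mulr_ge0.
  - by apply/measurable_EFinP; exact: measurable_funM.
  - apply/measurable_EFinP; apply: measurable_funD; first exact: measurable_funM.
    apply: measurable_funD; apply: measurable_funM.
    + by apply: (mfst (f := fun x => h x * u x)%R); exact: measurable_funM.
    + exact: (msnd mvr).
    + exact: (mfst mu_).
    + by apply: (msnd (f := fun x => h x * (v x / rho))%R); exact: measurable_funM.
  move=> z _; rewrite -!EFinM -!EFinD lee_fin /w mulrDr lerD//.
    rewrite /w1 !mulr_sumr; apply: ler_sum => i _.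
    rewrite !indicE; have [z1|] := boolP (z.1 \in A i); last by rewrite !(mulr0, mul0r).
    have [z2|] := boolP (z.2 \in A i); last by rewrite !mulr0.
    rewrite !mulr1 ler_wpM2r//; first by rewrite mulr_ge0// invr_ge0 mulr_ge0.
    by case: z z1 z2 => x y /=; rewrite !inE; exact: Ke.
  have -> : (h z.1 * u z.1 * (v z.2 / rho) + u z.1 * (h z.2 * (v z.2 / rho)) =
    (h z.1 + h z.2) * (u z.1 * (v z.2 / rho)))%R by ring.
  by rewrite ler_wpM2r//; case: z => x y /=.
rewrite ge0_integralD//; last 4 first.
- by move=> z _; rewrite lee_fin mulr_ge0.
- by apply/measurable_EFinP; exact: measurable_funM.
- by move=> z _; rewrite -!EFinM -EFinD lee_fin addr_ge0// !mulr_ge0// invr_ge0.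
- apply/measurable_EFinP; apply: measurable_funD; apply: measurable_funM.
  + by apply: (mfst (f := fun x => h x * u x)%R); exact: measurable_funM.
  + exact: (msnd mvr).
  + exact: (mfst mu_).
  + by apply: (msnd (f := fun x => h x * (v x / rho))%R); exact: measurable_funM.
rewrite ge0_integralD//; last 4 first.
- by move=> z _; rewrite -!EFinM lee_fin !mulr_ge0// invr_ge0.
- apply/measurable_EFinP; apply: measurable_funM.
  + by apply: (mfst (f := fun x => h x * u x)%R); exact: measurable_funM.
  + exact: (msnd mvr).
- by move=> z _; rewrite -!EFinM lee_fin !mulr_ge0// invr_ge0.
- apply/measurable_EFinP; apply: measurable_funM.
  + exact: (mfst mu_).
  + by apply: (msnd (f := fun x => h x * (v x / rho))%R); exact: measurable_funM.
have mhu : measurable_fun setT (fun x => (h x * u x)%:E).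
  by apply/measurable_EFinP; exact: measurable_funM.
have mhv : measurable_fun setT (fun x => (h x * (v x / rho))%:E).
  by apply/measurable_EFinP; exact: measurable_funM.
have mEu : measurable_fun setT (fun x => (u x)%:E) by exact/measurable_EFinP.
have mEvr : measurable_fun setT (fun x => (v x / rho)%:E) by exact/measurable_EFinP.
rewrite (@integral_prod_mul mu nu _ _ mhu mEvr); last 2 first.
- by move=> x; rewrite lee_fin mulr_ge0.
- by move=> x; rewrite lee_fin.
rewrite (@integral_prod_mul mu nu _ _ mEu mhv); last 2 first.
- by move=> x; rewrite lee_fin.
- by move=> x; rewrite lee_fin mulr_ge0.
rewrite int_u int_vrho.
have rr1 : (rho / rho <= 1)%R.
  by have [->|r0] := eqVneq rho 0%R; rewrite ?mul0r ?ler01// divff.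
have T1 := tail mu u mu_ u01 int_u.
have T2 := tail nu v mv_ v01 int_v.
have E1 : \int[mu \x nu]_z (e * w1 z)%:E <= e%:E.
  apply: (@le_trans _ _ (\int[mu \x nu]_z (e%:E * (w z)%:E))).
    apply: ge0_le_integral => //.
    - by move=> z _; rewrite lee_fin mulr_ge0.
    - by apply/measurable_EFinP; exact: measurable_funM.
    - by apply/measurable_EFinP; exact: measurable_funM.
    by move=> z _; rewrite -EFinM lee_fin ler_wpM2l// /w lerDl.
  rewrite ge0_integralZl//; last 2 first.
  - exact/measurable_EFinP.
  - by move=> z _; rewrite lee_fin.
  by rewrite int_w_total mule1.
have E2 : \int[mu]_x (h x * u x)%:E * (rho / rho)%:E <= \int[mu]_x (h x * u x)%:E.
  rewrite -[X in _ <= X]mule1; apply: lee_wpmul2l; last by rewrite lee_fin.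
  by apply: integral_ge0 => x _; rewrite lee_fin mulr_ge0.
have E3 : rho%:E * \int[nu]_x (h x * (v x / rho))%:E <= \int[nu]_x (h x * v x)%:E.
  rewrite -ge0_integralZl//; last by move=> x _; rewrite lee_fin mulr_ge0.
  apply: ge0_le_integral => //.
  - by move=> x _; rewrite -EFinM lee_fin !mulr_ge0// invr_ge0.
  - by apply: emeasurable_funM.
  - by apply/measurable_EFinP; exact: measurable_funM.
  move=> x _; rewrite -EFinM lee_fin.
  have -> : (rho * (h x * (v x / rho)) = h x * v x * (rho / rho))%R by ring.
  by rewrite ler_piMr// mulr_ge0.
apply: le_trans (leeD E1 (leeD (le_trans E2 T1) (le_trans E3 T2))) _.
rewrite (_ : (e + _)%:E = e%:E + ((S * rho)%:E + (S * rho)%:E)); last first.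
  by rewrite -!EFinD; congr EFin; rewrite -/rho; ring.
by rewrite addeACA !addeA.
Qed.

End cell_coupling.

(** * Euclidean norm and partitions into small cells *)

Section euclidean_norm.
Context (R : realType) (d : nat).
Local Notation V := 'rV[R]_d.
Implicit Types x y : V.

Lemma enorm_ge0 x : 0 <= enorm x.
Proof. exact: sqrtr_ge0. Qed.

Lemma enorm_sqr x : enorm x ^+ 2 = \sum_(i < d) x ord0 i ^+ 2.
Proof. by rewrite sqr_sqrtr// sumr_ge0// => i _; exact: sqr_ge0. Qed.

Lemma enorm0 : enorm (0 : V) = 0.
Proof. by rewrite /enorm big1 ?sqrtr0// => i _; rewrite mxE expr0n. Qed.

(** From (a - b)^2 <= 2 a^2 + 2 b^2 in each coordinate. The maximum makes the p-th power split into
    a sum in the next lemma. *)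
Lemma enorm_sub_le_max x y : enorm (x - y) <= 2 * Num.max (enorm x) (enorm y).
Proof.
have M0 : 0 <= Num.max (enorm x) (enorm y) by rewrite le_max enorm_ge0.
rewrite -ler_sqr ?nnegrE ?mulr_ge0 ?enorm_ge0// enorm_sqr.
apply: (@le_trans _ _ (2 * enorm x ^+ 2 + 2 * enorm y ^+ 2)).
  rewrite !enorm_sqr !mulr_sumr -big_split/=; apply: ler_sum => i _.
  by rewrite !mxE; have := sqr_ge0 (x ord0 i + y ord0 i); nra.
rewrite exprMn.
have : enorm x ^+ 2 <= Num.max (enorm x) (enorm y) ^+ 2.
  by rewrite ler_sqr ?nnegrE ?enorm_ge0// le_max lexx.
have : enorm y ^+ 2 <= Num.max (enorm x) (enorm y) ^+ 2.
  by rewrite ler_sqr ?nnegrE ?enorm_ge0// le_max lexx orbT.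
lra.
Qed.

Lemma enorm_sub_powR_le (p : R) x y : 1 <= p ->
  enorm (x - y) `^ p <= 2 `^ p * enorm x `^ p + 2 `^ p * enorm y `^ p.
Proof.
move=> p1; have p0 : 0 <= p by apply: le_trans p1.
have M0 : 0 <= Num.max (enorm x) (enorm y) by rewrite le_max enorm_ge0.
apply: (@le_trans _ _ ((2 * Num.max (enorm x) (enorm y)) `^ p)).
  by apply: ge0_ler_powR; rewrite ?nnegrE ?mulr_ge0 ?enorm_ge0// enorm_sub_le_max.
rewrite powRM// -mulrDr ler_wpM2l ?powR_ge0//.
have [_|_] := leP (enorm x) (enorm y); by rewrite ?lerDl ?lerDr powR_ge0.
Qed.

Lemma measurable_coordinate (i : 'I_d) :
  measurable_fun setT ((fun x : V => x ord0 i) : borel V -> R).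
Proof.
by apply: continuous_borel_measurableR => x; exact: coord_continuous.
Qed.

Lemma measurable_enorm_sub :
  measurable_fun setT (fun z : borel V * borel V => enorm (z.1 - z.2 : V)).
Proof.
rewrite /enorm; apply: (@measurableT_comp _ _ _ _ _ _ (@Num.sqrt R)).
  by apply: continuous_measurable_fun; exact: sqrt_continuous.
apply: measurable_sum => i; apply: measurable_funX.
rewrite [X in measurable_fun _ X](_ : _ = (fun z : borel V * borel V => (z.1 : V) ord0 i - (z.2 : V) ord0 i)); last first.
  by apply/funext => z; rewrite !mxE.
apply: measurable_funB.
- exact: (measurableT_comp (measurable_coordinate i) (@measurable_fst _ _ _ _)).
- exact: (measurableT_comp (measurable_coordinate i) (@measurable_snd _ _ _ _)).
Qed.

Lemma measurable_enorm_sub_powR (p : R) :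
  measurable_fun setT (fun z : borel V * borel V => enorm (z.1 - z.2 : V) `^ p).
Proof. exact: measurableT_comp (measurable_powR p) measurable_enorm_sub. Qed.

Lemma measurable_enorm_powRR (p : R) :
  measurable_fun setT ((fun x => enorm x `^ p) : borel V -> R).
Proof. by apply/measurable_EFinP; exact: measurable_enorm_powR. Qed.

Lemma small_cells (e : R) : 0 < e -> exists A : (set (borel V))^nat,
  [/\ forall i, measurable (A i), trivIset setT A, \bigcup_i A i = setT
    & forall i (x y : V), A i x -> A i y -> enorm (x - y) <= e].
Proof.
move=> e0.
(* A grid of step [h]: a cell has diameter at most sqrt(d) h <= e. Cells are indexed by vectors of
   floors and numbered by [pickle]; integers that are no code get the empty cell. *)
pose h := e / d.+1%:R.
have h0 : 0 < h by rewrite divr_gt0.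
pose cell (k : {ffun 'I_d -> int}) : set (borel V) :=
  \bigcap_(i in [set: 'I_d]) [set x : V | (k i)%:~R <= x ord0 i / h < (k i + 1)%:~R].
pose code (x : V) : {ffun 'I_d -> int} := [ffun i => Num.floor (x ord0 i / h)].
have cellP k x : cell k x <-> code x = k.
  split => [cx|<- i _]; last by rewrite /= ffunE floor_itv.
  by apply/ffunP => i; rewrite ffunE; apply/floor_def; exact: (cx i).
exists (fun n => if pickle_inv n is Some k then cell k else set0); split.
- move=> n; case: pickle_inv => // k.
  apply: fin_bigcap_measurable => // i _.
  rewrite (_ : [set x | _] = ((fun x : V => x ord0 i / h) : borel V -> R) @^-1` `[(k i)%:~R, (k i + 1)%:~R[); last first.
    by apply/seteqP; split => x /=; rewrite in_itv.
  rewrite -[X in measurable X]setTI.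
  have mc : measurable_fun setT ((fun x : V => x ord0 i / h) : borel V -> R).
    by apply: measurable_funM => //; exact: measurable_coordinate.
  by apply: mc => //; exact: measurable_itv.
- move=> m n _ _ [x []].
  have := pickle_invK (T := {ffun 'I_d -> int}) m; have := pickle_invK (T := {ffun 'I_d -> int}) n.
  case: pickle_inv => [k|//] /= kn; case: pickle_inv => [l|//] /= lm.
  by move=> /cellP xl /cellP xk; rewrite -kn -lm -xl -xk.
- rewrite -subTset => x _; exists (pickle (code x)) => //.
  by rewrite pickleK_inv; apply/cellP.
move=> n x y; case: pickle_inv => // k cx cy.
rewrite -ler_sqr ?nnegrE ?enorm_ge0 ?(ltW e0)// enorm_sqr.
apply: (@le_trans _ _ (\sum_(i < d) h ^+ 2)).
  apply: ler_sum => i _; rewrite !mxE.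
  have /andP[] := cx i I; have /andP[] := cy i I.
  rewrite !ler_pdivlMr// !ltr_pdivrMr// intrD mulrDl mul1r.
  set t := _ * h => a1 a2 a3 a4.
  rewrite -[X in X <= _]real_normK ?num_real// ler_sqr ?nnegrE ?normr_ge0// ?ltW//.
  by rewrite ltr_norml; lra.
rewrite sumr_const card_ord -mulr_natl.
have -> : e = d.+1%:R * h by rewrite /h mulrC mulfVK// pnatr_eq0.
rewrite [X in _ <= X]exprMn; apply: ler_wpM2r; first exact: sqr_ge0.
rewrite -natrX ler_nat.
by apply: (leq_trans (leqnSn d)); rewrite expnS expn1 leq_pmulr.
Qed.

End euclidean_norm.

(** * Wasserstein neighbourhoods *)

Section wasserstein.
Context (R : realType) (d : nat) (p : R).
Hypothesis p1 : 1 <= p.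
Local Notation V := 'rV[R]_d.
Implicit Types (mu nu : P_Rd d p).

Let p0 : 0 < p. Proof. exact: lt_le_trans p1. Qed.

(** One coupling of cost at most (e/2)^p bounds the infimum; halving [e] makes the final inequality
    strict. *)
Lemma wasserstein_lt (mu nu : probability (borel V) R) pi (e : R) : 0 < e -> coupling mu nu pi ->
  (\int[pi]_z (enorm (z.1 - z.2 : V) `^ p)%:E <= ((e / 2) `^ p)%:E)%E ->
  (wasserstein p mu nu < e%:E)%E.
Proof.
move=> e0 cpi h; rewrite /wasserstein.
apply: (@le_lt_trans _ _ (poweR ((e / 2) `^ p)%:E p^-1)).
  apply: gt0_ler_poweR; first by rewrite invr_ge0 ltW.
  - rewrite in_itv/= leey andbT; apply: le_ereal_inf_tmp => _ [q _ <-].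
    by apply: integral_ge0 => z _; rewrite lee_fin powR_ge0.
  - by rewrite in_itv/= leey andbT lee_fin powR_ge0.
  by apply: le_trans h; apply: ereal_inf_lbound; exists pi.
rewrite poweR_EFin -powRrM divff ?gt_eqF// powRr1 ?divr_ge0 ?(ltW e0)//.
by rewrite lte_fin ltr_pdivrMr// ltr_pMr// ltr1n.
Qed.

Lemma measure_eq_wasserstein_lt (mu nu : probability (borel V) R) (e : R) : 0 < e -> mu ≡μ nu ->
  (wasserstein p mu nu < e%:E)%E.
Proof.
move=> e0 mn.
pose D (x : borel V) : borel V * borel V := (x, x).
have mD : measurable_fun setT D by apply: measurable_fun_pair.
pose Dm : {mfun borel V >-> (borel V * borel V)%type} :=
  HB.pack_for {mfun borel V >-> (borel V * borel V)%type} D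
    (isMeasurableFun.Build _ _ _ _ _ mD).
apply: (@wasserstein_lt mu nu (distribution mu Dm)) => //.
rewrite ge0_integral_distribution//; last 2 first.
- by apply/measurable_EFinP; exact: measurable_enorm_sub_powR.
- by move=> z; rewrite lee_fin powR_ge0.
rewrite integral0_eq ?lee_fin ?powR_ge0// => x _.
by rewrite /= subrr enorm0 powR0// gt_eqF.
Qed.

Lemma nbhs_wasserstein mu (W : set (P_Rd d p)) : nbhs mu W ->
  exists2 e : R, 0 < e & forall nu : P_Rd d p, (wasserstein p mu nu < e%:E)%E -> W nu.
Proof.
rewrite nbhsE => -[U [oU Umu] UW]; have [e e0 h] := oU mu Umu.
by exists e => // nu /h; exact: UW.
Qed.

(** Two elements of [P_Rd] with the same masses on measurable sets may differ as records, yet the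
    diagonal coupling puts them at distance 0, and a lower semi-continuous function cannot separate
    such points. *)
Lemma lsc_measure_eq_le (Psi : P_Rd d p -> R) mu nu :
  lower_semicontinuous (EFin \o Psi) -> mu ≡μ nu -> Psi mu <= Psi nu.
Proof.
move=> lsc mn; rewrite leNgt; apply/negP => h.
have [W /nbhs_wasserstein[e e0 hW] /(_ nu)] := lsc mu (Psi nu) h.
move=> /(_ (hW _ (measure_eq_wasserstein_lt e0 mn))).
by rewrite /= ltxx.
Qed.

Lemma lsc_measure_eq (Psi : P_Rd d p -> R) mu nu :
  lower_semicontinuous (EFin \o Psi) -> mu ≡μ nu -> Psi mu = Psi nu.
Proof.
move=> lsc mn; apply/eqP; rewrite eq_le !lsc_measure_eq_le//.
by move=> A mA; rewrite mn.
Qed.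

(** Finitely many small cells carry almost all the mass of [mu]. Their masses converge, so the
    masses shared with [mu_ n] do too, and the residual of [cell_coupling] is small; the uniform
    tails pay for its unbounded cost. *)
Lemma setwise_cvg_wasserstein (U : set_system nat) (mu_ : nat -> probability (borel V) R)
    (mu : probability (borel V) R) (e : R) : ProperFilter U ->
  setwise_cvg U mu_ mu -> 0 < e ->
  (forall c : R, 0 < c -> exists2 S : R, 0 <= S &
    forall P, P = mu \/ (exists n, P = mu_ n) ->
      (\int[P]_x ((2 `^ p * enorm (x : V) `^ p) *
         \1_[set x | (S < 2 `^ p * enorm (x : V) `^ p)%R] x)%:E <= c%:E)%E) ->
  \forall n \near U, (wasserstein p mu (mu_ n) < e%:E)%E.
Proof.
move=> FU hmu e0 htail.
pose c := (e / 2) `^ p.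
have c0 : 0 < c by apply: powR_gt0; rewrite divr_gt0.
have c4 : 0 < c / 4 by rewrite divr_gt0.
have [S S0 hS] := htail _ c4.
(* The budget [c] is split in four: cells, 2 S times the residual mass, and two tails. In cells of
   diameter at most 1, |x - y|^p <= |x - y|. *)
pose e1 := Num.min 1 (c / 4).
have e10 : 0 < e1 by rewrite lt_min ltr01.
have [A [mA tA covA dA]] := small_cells d e10.
pose k := (c / 4) / (2 * S + 1).
have S1 : 0 < 2 * S + 1 by rewrite ltr_wpDl// mulr_ge0.
have k0 : 0 < k by rewrite divr_gt0.
have Sk : 2 * S * k <= c / 4.
  have : (2 * S + 1) * k = c / 4 by rewrite /k mulrCA divff ?mulr1// gt_eqF.
  by move: k0; lra.
have [N hN] : exists N : nat, 1 - k < \sum_(i < N) fine (mu (A i)).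
  have h := @measure_semi_sigma_additive _ _ _ mu A mA tA (bigcupT_measurable _ mA).
  move: h; rewrite [X in _ --> X](_ : _ = 1%E); last by rewrite covA; exact: probability_setT.
  move=> /fine_cvgP[_ /cvgrPdist_lt/(_ k k0)] [N _ /(_ N (leqnn N))] /=.
  rewrite big_mkord (_ : fine _ = \sum_(i < N) fine (mu (A i))).
    by rewrite ltr_norml => /andP[_]; exists N; lra.
  rewrite (eq_bigr (fun i : 'I_N => (fine (mu (A i)))%:E)) ?sumEFin//.
  by move=> i _; rewrite fineK// fin_num_measure.
have mcv : \sum_(i < N) Num.min (fine (mu (A i))) (fine (mu_ n (A i))) @[n --> U] -->
    \sum_(i < N) fine (mu (A i)).
  apply: cvg_sum_filter => i.
  rewrite -[X in _ --> X]minxx minr_absE; under eq_fun do rewrite minr_absE.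
  apply: cvgMl; apply: cvgB.
    by apply: cvgD; [exact: cvg_cst|exact: hmu].
  by apply: cvg_norm; apply: cvgB; [exact: cvg_cst|exact: hmu].
have : \forall n \near U, 1 - k < \sum_(i < N) Num.min (fine (mu (A i))) (fine (mu_ n (A i))).
  exact: cvgr_gt mcv _ hN.
apply: filterS => n hn.
have [pi [cpi hpi]] := cell_coupling mu (mu_ n) N mA tA.
apply: (wasserstein_lt e0 cpi).
refine (le_trans (hpi (fun z => enorm (z.1 - z.2 : V) `^ p)
  (fun x => 2 `^ p * enorm (x : V) `^ p) (c / 4) S _ _ _ _ _ _ _ _) _).
- exact: measurable_enorm_sub_powR.
- by apply: measurable_funM => //; exact: measurable_enorm_powRR.
- by move=> z; exact: powR_ge0.
- by move=> x; rewrite mulr_ge0 ?powR_ge0.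
- exact: ltW.
- by [].
- move=> i x y _ Ax Ay /=.
  have := dA i x y Ax Ay; rewrite /e1 le_min => /andP[h1 h2].
  have [->|xy] := eqVneq (enorm (x - y : V)) 0; first by rewrite powR0 ?ltW// gt_eqF.
  apply: le_trans h2; apply: ge1r_powR => //.
  by rewrite h1 andbT lt_neqAle eq_sym xy enorm_ge0.
- by move=> x y; exact: enorm_sub_powR_le.
have := hS mu (or_introl erefl).
have := hS (mu_ n) (or_intror (ex_intro _ n erefl)).
move=> t1 t2; apply: (le_trans (leeD (leeD (lexx _) t2) t1)).
rewrite -!EFinD lee_fin -/c.
have : 1 - \sum_(i < N) Num.min (fine (mu (A i))) (fine (mu_ n (A i))) <= k by lra.
have S2 : 0 <= 2 * S by rewrite mulr_ge0.
move=> /(ler_wpM2l S2); lra.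
Qed.

End wasserstein.

(** * Existence and uniqueness of minimisers *)

Section exponential_moments.
Context d (T : measurableType d) (R : realType).
Variables (nu : probability T R) (g : T -> R).
Hypotheses (mg : measurable_fun setT g) (g0 : forall x, 0 <= g x).
Hypothesis nug : forall a : R, 0 < a -> (\int[nu]_x (expR (a * g x))%:E < +oo)%E.

Let integrable_exp a : 0 < a -> nu.-integrable setT (fun x => (expR (a * g x))%:E).
Proof.
move=> a0; apply/integrableP; split.
  apply/measurable_EFinP; apply: measurableT_comp => //; exact: measurable_funM.
under eq_integral do rewrite gee0_abs ?lee_fin ?expR_ge0//.
exact: nug.
Qed.

Lemma entropy_moment (P : probability T R) : (entropy P nu < +oo)%E ->
  (\int[P]_x (g x)%:E < +oo)%E.
Proof.
move=> h; apply: (le_lt_trans (entropy_young P nu mg g0)).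
apply: lte_add_pinfty => //.
have := nug ltr01; apply: le_lt_trans; apply: ge0_le_integral => //.
- by move=> x _; rewrite lee_fin subr_ge0 -expR0 ler_expR.
- by apply/measurable_EFinP; apply: measurable_funB => //; exact: measurableT_comp.
- by apply/measurable_EFinP; apply: measurableT_comp => //; exact: measurable_funM.
by move=> x _; rewrite lee_fin mul1r lerBlDr lerDl.
Qed.

Lemma entropy_uniform_tail (C c : R) : 0 < c -> exists2 S : R, 0 <= S &
  forall P : probability T R, (entropy P nu <= C%:E)%E ->
    (\int[P]_x (g x * \1_[set y | S < g y] x)%:E <= c%:E)%E.
Proof.
move=> c0.
have mS S : measurable [set y | S < g y].
  rewrite (_ : [set x | _] = g @^-1` `]S, +oo[); last first.
    by apply/seteqP; split => x /=; rewrite in_itv /= andbT.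
  by rewrite -[X in measurable X]setTI; apply: mg => //; exact: measurable_itv.
(* With this slope, [entropy_young] at q = a g 1_{g > n} bounds [a] times the tail by C + 1 <= a c
   once the exponential integral is at most 1; dominated convergence provides this for large [n]. *)
pose a := (`|C| + 1) / c.
have a0 : 0 < a by rewrite divr_gt0// ltr_wpDl.
pose q n x := a * (g x * \1_[set y | n%:R < g y] x).
have mq n : measurable_fun setT (q n).
  by apply: measurable_funM => //; apply: measurable_funM => //; exact: measurable_indic.
have q0 n x : 0 <= q n x by rewrite mulr_ge0 ?(ltW a0)// mulr_ge0.
have qg n x : q n x <= a * g x.
  by rewrite ler_wpM2l ?(ltW a0)// indicE; case: (_ \in _); rewrite ?mulr1 ?mulr0.
have me n : measurable_fun setT (fun x => expR (q n x) - 1).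
  by apply: measurable_funB => //; exact: measurableT_comp.
have e0 n x : 0 <= expR (q n x) - 1 by rewrite subr_ge0 -expR0 ler_expR.
have [||||_ _] := @dominated_convergence _ _ _ nu setT measurableT
  (fun n x => (expR (q n x) - 1)%:E) (cst 0%E) (fun x => (expR (a * g x))%:E) _ _ _ (integrable_exp a0) _.
- by move=> n; exact/measurable_EFinP.
- exact: measurable_cst.
- apply: aeW => x _; apply: (@cvg_near_cst _ _ _ _ _ _).
  near=> n.
  rewrite /q indicE memNset ?mulr0 ?expR0 ?subrr//=; apply/negP; rewrite -leNgt.
  apply: ltW; apply: lt_le_trans (archi_boundP (g0 x)) _; rewrite ler_nat.
  by near: n; exact: nbhs_infty_ge.
- apply: aeW => x n _; rewrite gee0_abs ?lee_fin//.
  by apply: (@le_trans _ _ (expR (q n x))); [rewrite lerBlDr lerDl|rewrite ler_expR].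
rewrite integral0 => /fine_cvgP[fin /cvgrPdist_lt/(_ 1 ltr01) lim1].
near \oo => n.
exists n%:R => // P HP.
have In : (\int[nu]_x (expR (q n x) - 1)%:E <= 1%:E)%E.
  have fn : (\int[nu]_x (expR (q n x) - 1)%:E)%E \is a fin_num by near: n.
  rewrite -(fineK fn) lee_fin.
  have : `|0 - fine (\int[nu]_x (expR (q n x) - 1)%:E)%E| < 1 by near: n.
  by rewrite sub0r normrN => /ltW; apply: le_trans; exact: ler_norm.
have := entropy_young P nu (mq n) (q0 n).
under eq_integral do rewrite /q EFinM.
rewrite ge0_integralZl//; last 3 first.
- by apply/measurable_EFinP; apply: measurable_funM => //; exact: measurable_indic.
- by move=> x _; rewrite lee_fin mulr_ge0.
- by rewrite lee_fin ltW.
move=> /le_trans/(_ (leeD HP In)) h.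
rewrite -(@lee_pmul2l _ a%:E) ?lte_fin//; apply: (le_trans h).
rewrite -EFinD -EFinM lee_fin /a mulfVK ?gt_eqF// lerD2r ler_norm//.
Unshelve. all: end_near. Qed.

End exponential_moments.

(** * Mixtures of measures and of densities *)

Section mixture.
Context dX (X : measurableType dX) (R : realType).
Implicit Types (mu nu : probability X R).

Lemma mixmE (e : R) mu1 mu2 (A : set X) : 0 <= e <= 1 ->
  mixm e mu1 mu2 A = ((1 - e)%:E * mu1 A + e%:E * mu2 A)%E.
Proof.
move=> /andP[e0 e1].
have -> : mixm e mu1 mu2 A = ((1 - clamp01 e)%:E * mu1 A + (clamp01 e)%:E * mu2 A)%E.
  exact: measure_addE.
by rewrite /clamp01 (min_r e1) max_r.
Qed.

Lemma ge0_integral_mixm (e : R) mu1 mu2 (g : X -> \bar R) : 0 <= e <= 1 ->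
  measurable_fun setT g -> (forall x, 0 <= g x)%E ->
  (\int[mixm e mu1 mu2]_x g x = (1 - e)%:E * \int[mu1]_x g x + e%:E * \int[mu2]_x g x)%E.
Proof.
move=> /andP[e0 e1] mg g0.
rewrite ge0_integral_measure_add// !ge0_integral_mscale//=.
by rewrite /clamp01 (min_r e1) max_r.
Qed.

Lemma has_density_mixm (e : R) mu1 mu2 nu (f1 f2 : X -> R) : 0 <= e <= 1 ->
  has_density mu1 nu f1 -> has_density mu2 nu f2 ->
  has_density (mixm e mu1 mu2) nu (fun x => (1 - e) * f1 x + e * f2 x).
Proof.
move=> e01 [mf1 f10 h1] [mf2 f20 h2]; have /andP[e0 e1] := e01.
have e1' : 0 <= 1 - e by rewrite subr_ge0.
split.
- by apply: measurable_funD; exact: measurable_funM.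
- by move=> x; rewrite addr_ge0// mulr_ge0.
move=> A mA; transitivity ((1 - e)%:E * mu1 A + e%:E * mu2 A)%E; first exact: mixmE.
rewrite h1// h2//.
under [RHS]eq_integral do rewrite EFinD !EFinM.
have m1 : measurable_fun A (fun x => (f1 x)%:E) by apply/measurable_EFinP; exact: measurable_funTS.
have m2 : measurable_fun A (fun x => (f2 x)%:E) by apply/measurable_EFinP; exact: measurable_funTS.
rewrite ge0_integralD//; last 4 first.
- by move=> x _; rewrite -EFinM lee_fin mulr_ge0.
- exact: emeasurable_funM.
- by move=> x _; rewrite -EFinM lee_fin mulr_ge0.
- exact: emeasurable_funM.
by rewrite !ge0_integralZl//; move=> x _; rewrite lee_fin.
Qed.

End mixture.

Section path_mixture.
Context (R : realType) (T : {posnum R}) (d : nat) (p : R).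
Implicit Types mu nu : P_path T d p.

Lemma measurable_supnorm_powR :
  measurable_fun setT ((fun x => supnorm x `^ p) : borel (path_space T d) -> R).
Proof. exact: measurableT_comp (measurable_powR p) (@measurable_supnorm R T d). Qed.

Lemma supnorm_ge0 (x : path_space T d) : 0 <= supnorm x.
Proof. by apply: le_trans (enorm_le_supnorm (time_ini T) x); exact: enorm_ge0. Qed.

Fact path_mix_moment (e : R) (mu1 mu2 : P_path T d p) :
  (\int[mixm e mu1 mu2]_x (supnorm x `^ p)%:E < +oo)%E.
Proof.
rewrite ge0_integral_measure_add//; last 2 first.
- by move=> x _; rewrite lee_fin powR_ge0.
- by apply/measurable_EFinP; exact: measurable_supnorm_powR.
rewrite !ge0_integral_mscale//=; try (by apply/measurable_EFinP; exact: measurable_supnorm_powR);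
  try by move=> x _; rewrite lee_fin powR_ge0.
have fin (m : P_path T d p) : (\int[m]_x (supnorm x `^ p)%:E)%E \is a fin_num.
  rewrite ge0_fin_numE; first exact: wprob_moment.
  by apply: integral_ge0 => x _; rewrite lee_fin powR_ge0.
by rewrite -(fineK (fin mu1)) -(fineK (fin mu2)) -!EFinM -EFinD ltry.
Qed.

Definition path_mix (e : R) mu1 mu2 : P_path T d p := WProb (path_mix_moment e mu1 mu2).

(** An equality of laws, not of records: values of [Psi] are carried across it by
    [lsc_measure_eq]. *)
Lemma marginal_path_mix (hp : 1 <= p) e mu1 mu2 t :
  marginal hp (path_mix e mu1 mu2) t ≡μ mix e (marginal hp mu1 t) (marginal hp mu2 t).
Proof.
move=> A mA.
transitivity ((1 - clamp01 e)%:E * mu1 (coord_at t @^-1` A) + (clamp01 e)%:E * mu2 (coord_at t @^-1` A))%E.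
  exact: measure_addE.
exact/esym/measure_addE.
Qed.

End path_mixture.

(** * The minimisation problem *)

Section minimisers.
Context (R : realType) (T : {posnum R}) (d : nat) (p : R).
Hypothesis hp : 1 <= p.
Variable nu : P_path T d p.
Hypothesis hnu : forall alpha : R, 0 < alpha ->
  (\int[nu]_x (expR (alpha * supnorm x `^ p))%:E < +oo)%E.
Variable Psi : P_Rd d p -> R.
Hypothesis hPsi : lower_semicontinuous (EFin \o Psi).
Variables mu_ini mu_fin : P_Rd d p.
Local Notation value := (problem_value hp nu Psi mu_ini mu_fin).

Let p0 : 0 < p. Proof. exact: lt_le_trans hp. Qed.

Let sup0 (x : path_space T d) : 0 <= supnorm x `^ p. Proof. exact: powR_ge0. Qed.

(** Limits and perturbations are built as bare probabilities; their p-th moment comes from the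
    exponential moments of [nu]. *)
Lemma finite_entropy_P_path (P : probability (borel (path_space T d)) R) :
  (entropy P nu < +oo)%E -> exists mu : P_path T d p, wprob_prob mu = P.
Proof.
move=> h.
have mom := entropy_moment (@measurable_supnorm_powR R T d p) sup0 hnu h.
by exists (WProb mom).
Qed.

(** |x_t| is dominated by the sup norm, so one level [S] serves all times and all measures of
    entropy at most [C]. *)
Lemma finite_entropy_law_tail (C c : R) : 0 < c -> exists2 S : R, 0 <= S &
  forall (P : probability (borel (path_space T d)) R) (t : time T),
   (entropy P nu <= C%:E)%E ->
   (\int[law_at P t]_x ((2 `^ p * enorm x `^ p) *
     \1_[set x | (S < 2 `^ p * enorm (x : 'rV[R]_d) `^ p)%R] x)%:E <= c%:E)%E.
Proof.
move=> c0.
pose g (x : borel (path_space T d)) := 2 `^ p * supnorm x `^ p.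
have mg : measurable_fun setT g.
  by apply: measurable_funM => //; exact: measurable_supnorm_powR.
have g0 x : 0 <= g x by rewrite mulr_ge0 ?powR_ge0.
have hg a : 0 < a -> (\int[nu]_x (expR (a * g x))%:E < +oo)%E.
  move=> a0; under eq_integral do rewrite /g mulrA.
  by apply: hnu; rewrite mulr_gt0// powR_gt0.
have [S S0 hS] := entropy_uniform_tail mg g0 hg C c0.
exists S => // P t /hS; apply: le_trans.
pose h (x : borel 'rV[R]_d) := 2 `^ p * enorm (x : 'rV[R]_d) `^ p.
have mh : measurable_fun setT h.
  by apply: measurable_funM => //; exact: measurable_enorm_powRR.
have h0 x : 0 <= h x by rewrite mulr_ge0 ?powR_ge0.
have mS (dZ : measure_display) (Z : measurableType dZ) (q : Z -> R) :
    measurable_fun setT q -> measurable [set y | S < q y].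
  move=> mq; rewrite (_ : [set x | _] = q @^-1` `]S, +oo[); last first.
    by apply/seteqP; split => x /=; rewrite in_itv /= andbT.
  by rewrite -[X in measurable X]setTI; apply: mq => //; exact: measurable_itv.
rewrite ge0_integral_distribution; last 2 first.
- apply/measurable_EFinP; apply: measurable_funM => //; apply: measurable_indic.
  exact: (mS _ _ h).
- by move=> x; rewrite lee_fin mulr_ge0// mulr_ge0// powR_ge0.
have hgx x : h (coord_at t x) <= g x.
  rewrite ler_wpM2l ?powR_ge0//; apply: ge0_ler_powR; rewrite ?nnegrE ?enorm_ge0 ?supnorm_ge0 ?(ltW p0)//.
  exact: enorm_le_supnorm.
apply: ge0_le_integral => //.
- by move=> x _; rewrite lee_fin mulr_ge0// mulr_ge0// powR_ge0.
- apply: measurableT_comp; last exact: measurable_coord_at.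
  apply/measurable_EFinP; apply: measurable_funM => //; apply: measurable_indic.
  exact: (mS _ _ h).
- apply/measurable_EFinP; apply: measurable_funM => //; apply: measurable_indic.
  exact: mS.
move=> x _; rewrite /= lee_fin -/(h _).
rewrite [X in h _ * X <= _]indicE.
have [Sh|hS'] := ltP S (h (coord_at t x)).
  rewrite [X in h _ * X <= _](_ : _ = 1).
    rewrite indicE mem_set /=; first by rewrite !mulr1.
    exact: lt_le_trans Sh (hgx x).
  by rewrite mem_set.
rewrite memNset /= ?mulr0 ?mulr_ge0//.
by apply/negP; rewrite -leNgt.
Qed.

Lemma minimiser_exists : value \is a fin_num ->
  exists mubar : P_path T d p, minimiser hp nu Psi mu_ini mu_fin mubar.
Proof.
move=> vfin; set v := fine value.
have vE : value = v%:E by rewrite /v fineK.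
have approx (n : nat) : exists mu : P_path T d p,
    admissible hp Psi mu_ini mu_fin mu /\ (entropy mu nu <= (v + n.+1%:R^-1)%:E)%E.
  have n0 : 0 < n.+1%:R^-1 :> R by rewrite invr_gt0.
  have [_ [mu amu <-] h] := lb_ereal_inf_adherent n0 vfin.
  by exists mu; split => //; apply: ltW; rewrite EFinD -vE.
have [mu_ hmu] := choice approx.
(* The ultrafilter is finer than [\oo]: the masses of all sets converge along it at once, and what
   holds for large [n] holds along [U]. *)
have [U [UU oU]] := ultraFilterLemma (eventually_filter : ProperFilter \oo).
have HC n : (entropy (mu_ n) nu <= (v + 1)%:E)%E.
  have [_ /le_trans] := hmu n; apply; rewrite lee_fin lerD2l invf_le1// ler1n//.
have [P [Pcv Pnu]] := entropy_bounded_setwise_limit UU HC.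
have HP : (entropy P nu <= v%:E)%E.
  apply/lee_addgt0Pr => e e0; rewrite -EFinD.
  apply: (entropy_lsc _ Pcv Pnu).
  apply: oU; near=> n.
  have [_ /le_trans] := hmu n; apply; rewrite lee_fin lerD2l.
  rewrite invf_ple ?posrE//; apply: ltW; apply: lt_le_trans (archi_boundP _) _.
    by rewrite invr_ge0 ltW.
  rewrite ler_nat; apply: leq_trans (leqnSn _); near: n; exact: nbhs_infty_ge.
have HPoo : (entropy P nu < +oo)%E by apply: le_lt_trans HP (ltry _).
have [mubar mubarE] := finite_entropy_P_path HPoo.
have law_cvg t : setwise_cvg U (fun n => law_at (mu_ n) t) (law_at P t).
  move=> A mA; apply: Pcv; rewrite -[X in measurable X]setTI.
  exact: measurable_coord_at.
have lim_const (t : time T) (m : P_Rd d p) : (forall n, marginal hp (mu_ n) t ≡μ m) ->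
    marginal hp mubar t ≡μ m.
  move=> h A mA.
  have E : fine (law_at P t A) = fine (m A).
    have : cst (fine (m A)) n @[n --> U] --> fine (law_at P t A).
      rewrite (_ : cst _ = (fun n => fine (law_at (mu_ n) t A))); first exact: law_cvg.
      by apply/funext => n /=; rewrite -(h n A mA).
    by move=> /cvg_lim <- //; rewrite lim_cst.
  transitivity (law_at P t A); first by rewrite -mubarE.
  by rewrite -(fineK (fin_num_measure (law_at P t) A mA)) E fineK// fin_num_measure.
have amubar : admissible hp Psi mu_ini mu_fin mubar.
  split.
  - by apply: lim_const => n; have [[]] := hmu n.
  - by apply: lim_const => n; have [[]] := hmu n.
  (* If the constraint failed at [t], [Psi] would be positive on a Wasserstein ball around the limit
     marginal, and this ball contains marginals of admissible measures. Each time is treated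
     separately. *)
  move=> t; rewrite leNgt; apply/negP => h.
  have [W /nbhs_wasserstein[e e0 hW] Wpos] := hPsi (x := marginal hp mubar t) h.
  have : \forall n \near U, (wasserstein p (law_at P t) (law_at (mu_ n) t) < e%:E)%E.
    apply: (setwise_cvg_wasserstein hp _ (law_cvg t) e0) => c c0.
    have [S S0 hS] := finite_entropy_law_tail (v + 1) c0.
    exists S => // Q [->|[n ->]]; apply: hS => //.
    by apply: le_trans HP _; rewrite lee_fin lerDl.
  move=> /filter_ex[n]; rewrite -mubarE => /(hW (marginal hp (mu_ n) t))/Wpos.
  by rewrite lte_fin ltNge; have [[_ _ /(_ t) ->]] := hmu n.
exists mubar; split => //.
apply/eqP; rewrite eq_le; apply/andP; split; first by rewrite vE mubarE.
by apply: ereal_inf_lbound; exists mubar.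
Unshelve. all: end_near. Qed.

Lemma path_mix_marginal (e : R) (mu1 mu2 : P_path T d p) (m : P_Rd d p) (t : time T) :
  0 <= e <= 1 -> marginal hp mu1 t ≡μ m -> marginal hp mu2 t ≡μ m ->
  marginal hp (path_mix e mu1 mu2) t ≡μ m.
Proof.
move=> e01 h1 h2 A mA; rewrite marginal_path_mix//.
transitivity ((1 - e)%:E * marginal hp mu1 t A + e%:E * marginal hp mu2 t A)%E.
  exact: mixmE.
rewrite h1// h2// -ge0_muleDl ?lee_fin; last 2 first.
- by rewrite subr_ge0; have /andP[] := e01.
- by have /andP[] := e01.
by rewrite -EFinD subrK mul1e.
Qed.

Lemma minimiser_unique : convex_on_P Psi -> forall mu1 mu2 : P_path T d p,
  minimiser hp nu Psi mu_ini mu_fin mu1 ->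
  minimiser hp nu Psi mu_ini mu_fin mu2 -> mu1 ≡μ mu2.
Proof.
move=> cPsi mu1 mu2 [[i1 f1 c1] E1 vfin] [[i2 f2 c2] E2 _].
have h01 : 0 <= (2^-1 : R) <= 1 by apply/andP; split; lra.
have voo : (value < +oo)%E by rewrite ltey_eq vfin.
have [|g1 hg1 G1] := @entropy_density _ _ _ mu1 nu; first by rewrite E1.
have [|g2 hg2 G2] := @entropy_density _ _ _ mu2 nu; first by rewrite E2.
have hm := has_density_mixm h01 hg1 hg2.
set mu := path_mix 2^-1 mu1 mu2.
have amu : admissible hp Psi mu_ini mu_fin mu.
  split; [exact: path_mix_marginal|exact: path_mix_marginal|move=> t].
  rewrite (lsc_measure_eq hp hPsi (marginal_path_mix hp _ _ _ t)).
  apply: le_trans (cPsi _ _ _ h01) _.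
  by have := c1 t; have := c2 t; lra.
have Hmu : (value <= entropy mu nu)%E by apply: ereal_inf_lbound; exists mu.
have [mg1 g10 d1] := hg1; have [mg2 g20 d2] := hg2.
move: Hmu; rewrite (entropyE hm) => Hmu.
pose gm x := (1 - 2^-1) * g1 x + 2^-1 * g2 x.
have gmE x : gm x = (g1 x + g2 x) / 2 by rewrite /gm; lra.
have gm0 x : 0 <= gm x by rewrite gmE divr_ge0// addr_ge0.
have mgm : measurable_fun setT gm by have [] := hm.
(* Convexity defect at the midpoint. It is nonnegative, and its integral is at most 2 [value] - 2
   [value] because the midpoint is admissible; hence it vanishes almost everywhere. *)
pose D x := theta (g1 x) + theta (g2 x) - 2 * theta (gm x).
have D0 x : 0 <= D x.
  have := theta_convex (g10 x) (g20 x) h01; rewrite -/(gm x) /D.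
  by rewrite -[1 - 2^-1](_ : 2^-1 = _); [|lra]; lra.
have mD : measurable_fun setT D.
  apply: measurable_funB; first by apply: measurable_funD; exact: measurableT_comp measurable_theta _.
  by apply: measurable_funM => //; exact: measurableT_comp measurable_theta _.
have ID : (\int[nu]_x (D x)%:E = 0)%E.
  have : (\int[nu]_x ((D x)%:E + 2%:E * (theta (gm x))%:E) = \int[nu]_x ((theta (g1 x))%:E + (theta (g2 x))%:E))%E.
    by apply: eq_integral => x _; rewrite -EFinM -!EFinD; congr EFin; rewrite /D subrK.
  have t0 (q : path_space T d -> R) : (forall x, 0 <= q x) -> forall x, (0 <= (theta (q x))%:E)%E.
    by move=> q0 x; rewrite lee_fin theta_ge0.
  rewrite !ge0_integralD//; try (by move=> x _; exact: t0);
    try exact: measurable_theta_comp; try exact/measurable_EFinP;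
    try (by move=> x _; rewrite lee_fin);
    try (by move=> x _; apply: mule_ge0 => //; exact: t0);
    try (by apply: emeasurable_funM => //; exact: measurable_theta_comp).
  rewrite ge0_integralZl//; last 2 first.
  - exact: measurable_theta_comp.
  - by move=> x _; exact: t0.
  rewrite -G1 -G2 E1 E2.
  have Hmu' : (value <= \int[nu]_x (theta (gm x))%:E)%E by [].
  have : (0 <= \int[nu]_x (D x)%:E)%E by apply: integral_ge0 => x _; rewrite lee_fin.
  move: vfin Hmu'.
  move: (\int[nu]_x (D x)%:E)%E (\int[nu]_x (theta (gm x))%:E)%E value.
  move=> [u| |] [w| |] [v| |] //= _; rewrite ?leeNy_eq ?leye_eq ?gt0_muley ?lte_fin// => vw u0 [] h.
  move: vw u0; rewrite !lee_fin => vw u0.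
  by congr EFin; move: u0 vw h; lra.
have D_ae : ae_eq nu setT (fun x => (D x)%:E) (cst 0%E).
  apply/ae_eq_integral_abs => //; first exact/measurable_EFinP.
  by rewrite -[RHS]ID; apply: eq_integral => x _; rewrite gee0_abs ?lee_fin.
move=> A mA; rewrite d1// d2//; apply: ge0_ae_eq_integral => //.
- by apply/measurable_EFinP; exact: measurable_funTS.
- by apply/measurable_EFinP; exact: measurable_funTS.
- by move=> x _; rewrite lee_fin.
- by move=> x _; rewrite lee_fin.
apply: filterS D_ae => x /(_ I) [Dx] _; congr EFin.
apply: theta_midpoint_eq => //; rewrite -gmE.
by move: Dx; rewrite /D; lra.
Qed.

End minimisers.

(** * First variation of the entropy *)

Section first_variation.
Context dX (X : measurableType dX) (R : realType) (nu : probability X R).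
Variables (f q : X -> R) (e0 : R).
Hypotheses (mf : measurable_fun setT f) (mq : measurable_fun setT q).
Hypotheses (f0 : forall x, 0 <= f x) (q0 : forall x, 0 <= q x).
Hypotheses (fi : nu.-integrable setT (EFin \o f)) (qi : nu.-integrable setT (EFin \o q)).
Hypotheses (Hf : (\int[nu]_x (theta (f x))%:E < +oo)%E)
  (Hq : (\int[nu]_x (theta (q x))%:E < +oo)%E).
Hypothesis e0_gt0 : 0 < e0.

Let fe (e : R) (x : X) : R := (1 - e) * f x + e * q x.

Hypothesis fmin : forall e : R, 0 < e <= e0 ->
  (\int[nu]_x (theta (f x))%:E <= \int[nu]_x (theta (fe e x))%:E)%E.

(** Derivative in [e] of [theta (fe e x)]. At e = 0 it would be the first variation, but there it
    should be -oo where f = 0 < q, which the convention [ln 0 = 0] hides; hence a passage to the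
    limit from e > 0. *)
Let psi (e : R) (x : X) : R := ln (fe e x) * (q x - f x).

Let mfe e : measurable_fun setT (fe e).
Proof. by apply: measurable_funD; exact: measurable_funM. Qed.

Let mpsi e : measurable_fun setT (psi e).
Proof.
apply: measurable_funM; last exact: measurable_funB.
exact: measurableT_comp (@measurable_ln R) (mfe e).
Qed.

Let fe0 e x : 0 <= e <= 1 -> 0 <= fe e x.
Proof. by move=> /andP[a b]; rewrite addr_ge0// mulr_ge0// subr_ge0. Qed.

Let theta_integrable (g : X -> R) : measurable_fun setT g -> (forall x, 0 <= g x) ->
  (\int[nu]_x (theta (g x))%:E < +oo)%E -> nu.-integrable setT (fun x => (theta (g x))%:E).
Proof.
move=> mg g0 Hg; apply/integrableP; split; first exact: measurable_theta_comp.
by under eq_integral do rewrite gee0_abs ?lee_fin ?theta_ge0//.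
Qed.

Let fei e : nu.-integrable setT (EFin \o fe e).
Proof.
have -> : EFin \o fe e = (fun x => (1 - e)%:E * (EFin \o f) x + e%:E * (EFin \o q) x)%E.
  by apply/funext => x; rewrite /= -!EFinM -EFinD.
by apply: integrableD => //; exact: integrableZl.
Qed.

Let theta_fei e : 0 <= e <= 1 -> nu.-integrable setT (fun x => (theta (fe e x))%:E).
Proof.
move=> e01; have /andP[e_ge0 e_le1] := e01.
apply: (@le_integrable _ _ _ _ _ measurableT _
  (fun x => (1 - e)%:E * (theta (f x))%:E + e%:E * (theta (q x))%:E)%E).
- exact: measurable_theta_comp.
- move=> x _; rewrite -!EFinM -EFinD lee_fin !ger0_norm.
  + exact: theta_convex.
  + by rewrite addr_ge0// mulr_ge0 ?theta_ge0// subr_ge0.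
  + exact/theta_ge0/fe0.
by apply: integrableD => //; apply: integrableZl => //; exact: theta_integrable.
Qed.

Let xlnx_le (y : R) : 0 <= y -> `|y * ln y| <= theta y + y + 1.
Proof.
by move=> y0; have := theta_ge0 y0; rewrite /theta ler_norml; set z := y * ln y; lra.
Qed.

(** As 0 < e < 1, both [f] and [q] are at most a multiple of [fe e], so [psi] is dominated by a
    multiple of fe |ln fe|. The multiples blow up at e = 0. *)
Let psii e : 0 < e < 1 -> nu.-integrable setT (EFin \o psi e).
Proof.
move=> /andP[ep e1]; have e01 : 0 <= e <= 1 by rewrite !ltW.
pose c := e^-1 + (1 - e)^-1.
have ie : 0 < e^-1 by rewrite invr_gt0.
have ie1 : 0 < (1 - e)^-1 by rewrite invr_gt0 subr_gt0.
have c0 : 0 <= c by rewrite /c addr_ge0// ltW.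
apply: (@le_integrable _ _ _ _ _ measurableT _
  (fun x => c%:E * ((theta (fe e x))%:E + (EFin \o fe e) x + 1%:E))%E).
- exact/measurable_EFinP.
- move=> x _; rewrite /= lee_fin.
  have fex := fe0 x e01.
  have h0 : 0 <= theta (fe e x) + fe e x + 1 by have := theta_ge0 fex; lra.
  rewrite [X in _ <= X]ger0_norm ?mulr_ge0//.
  apply: le_trans (ler_wpM2l c0 (xlnx_le fex)).
  rewrite /psi !normrM mulrA [X in _ <= X]mulrC ler_wpM2l//.
  rewrite [`|fe e x|]ger0_norm//.
  have h1 : q x <= e^-1 * fe e x.
    by rewrite mulrC ler_pdivlMr// mulrC /fe lerDr mulr_ge0// subr_ge0 ltW.
  have h2 : f x <= (1 - e)^-1 * fe e x.
    by rewrite mulrC ler_pdivlMr ?subr_gt0// mulrC /fe lerDl mulr_ge0// ltW.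
  have := f0 x; have := q0 x.
  by move: h1 h2; rewrite /c mulrDl ler_norml; set a := e^-1 * _; set b := _^-1 * _; lra.
apply: integrableZl => //; apply: integrableD => //; last exact: finite_measure_integrable_cst.
by apply: integrableD => //; exact: theta_fei.
Qed.

Let psi_mono e e' x : 0 < e -> e <= e' -> e' < 1 -> psi e x <= psi e' x.
Proof.
move=> ep ee e1.
have e'p : 0 < e' by apply: lt_le_trans ee.
have eT : 0 <= e <= 1 by rewrite ltW//= (le_trans ee)// ltW.
have := fe0 x eT; rewrite le_eqVlt => /predU1P[h|h].
  have hf : (1 - e) * f x = 0.
    apply/eqP; rewrite eq_le mulr_ge0// ?subr_ge0 ?andbT; last by case/andP: eT.
    by have := mulr_ge0 (ltW ep) (q0 x); move: h; rewrite /fe; lra.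
  have hq : e * q x = 0 by move: h; rewrite /fe hf add0r => <-.
  have fx : f x = 0.
    by apply/eqP; move/eqP: hf; rewrite mulf_eq0 subr_eq0 (gt_eqF (le_lt_trans ee e1)).
  have qx : q x = 0 by apply/eqP; move/eqP: hq; rewrite mulf_eq0 (gt_eqF ep).
  by rewrite /psi fx qx subrr !mulr0.
have e'T : 0 <= e' <= 1 by rewrite !ltW.
have fE s : fe s x = f x + s * (q x - f x) by rewrite /fe; ring.
rewrite /psi; have [fq|qf] := leP (f x) (q x).
  have fe_le : fe e x <= fe e' x by rewrite !fE lerD2l ler_wpM2r// subr_ge0.
  rewrite ler_wpM2r ?subr_ge0// ler_ln ?posrE//; exact: lt_le_trans fe_le.
have fe_le : fe e' x <= fe e x by rewrite !fE lerD2l ler_wnM2r// subr_le0 ltW.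
have fe'p : 0 < fe e' x.
  apply: ltr_wpDr; first exact: mulr_ge0 (ltW e'p) (q0 x).
  by apply: mulr_gt0; [rewrite subr_gt0|exact: le_lt_trans (q0 x) qf].
by rewrite ler_wnM2r ?subr_le0 ?(ltW qf)// ler_ln ?posrE.
Qed.

Let psi_tangent e x : 0 < e < 1 -> theta (fe e x) - theta (f x) <= e * psi e x.
Proof.
move=> /andP[ep e1]; have e01 : 0 <= e <= 1 by rewrite !ltW.
have fE : f x = fe e x - e * (q x - f x) by rewrite /fe; ring.
have := fe0 x e01; rewrite le_eqVlt => /predU1P[h|h].
  have : f x <= 0.
    have h' : (1 - e) * f x <= 0.
      by have := mulr_ge0 (ltW ep) (q0 x); move: h; rewrite /fe; lra.
    by rewrite -(pmulr_rle0 _ (_ : 0 < 1 - e)) ?subr_gt0.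
  move=> fx; have fx0 : f x = 0 by apply/eqP; rewrite eq_le fx f0.
  by rewrite /psi -h fx0 theta0 ln0// mul0r mulr0 subrr.
have := theta_tangent (f0 x) h.
have mE : e * (q x - f x) = fe e x - f x by rewrite /fe; ring.
by rewrite /psi mulrCA mE {2}/theta; lra.
Qed.

Let e1 : R := Num.min e0 2^-1.

Let e1_gt0 : 0 < e1. Proof. by rewrite lt_min e0_gt0 invr_gt0 ltr0n. Qed.

Let en (n : nat) : R := e1 / n.+1%:R.

Let en_gt0 n : 0 < en n. Proof. by rewrite divr_gt0. Qed.

Let en_le n : en n <= e1.
Proof.
rewrite /en ler_pdivrMr// -[X in X <= _]mulr1.
by apply: ler_wpM2l; [exact: ltW|rewrite ler1n].
Qed.

Let e1_lt1 : e1 < 1.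
Proof. by rewrite gt_min invf_lt1 ?ltr1n ?orbT. Qed.

Let en01 n : 0 < en n < 1.
Proof. by rewrite en_gt0 (le_lt_trans (en_le n)). Qed.

(** Minimality makes the increment of the entropy nonnegative, and [psi_tangent] bounds it above by
    [en n] times the integral of [psi]. *)
Let psi_ge0 n : (0 <= \int[nu]_x (psi (en n) x)%:E)%E.
Proof.
have e01 : 0 <= en n <= 1 by have /andP[a b] := en01 n; rewrite !ltW.
have H : (0 <= \int[nu]_x (theta (fe (en n) x) - theta (f x))%:E)%E.
  under eq_integral do rewrite EFinB.
  rewrite integralB//; [|exact: theta_fei|exact: theta_integrable].
  rewrite sube_ge0.
    apply: fmin; rewrite en_gt0/= (le_trans (en_le n))//.
    by rewrite ge_min lexx.
  by rewrite (integrable_fin_num measurableT (theta_integrable mf f0 Hf)).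
rewrite -(@pmule_rge0 _ (en n)%:E) ?lte_fin//.
rewrite -integralZl//; last exact: psii.
apply: (le_trans H); apply: le_integral => //.
- have := integrableB measurableT (theta_fei e01) (theta_integrable mf f0 Hf).
  by apply: eq_integrable => // x _; rewrite EFinB.
- by apply: integrableZl => //; exact: psii.
- by move=> x _; rewrite -EFinM lee_fin psi_tangent.
Qed.

(** Nonnegative by [psi_mono], so Fatou's lemma applies as [en] decreases to 0, before anything is
    known about the limit. *)
Let u (n : nat) (x : X) : R := psi e1 x - psi (en n) x.

Let u0 n x : 0 <= u n x.
Proof. by rewrite subr_ge0; exact: (psi_mono _ (en_gt0 n) (en_le n) e1_lt1). Qed.

Let mu' n : measurable_fun setT (fun x => (u n x)%:E).
Proof. by apply/measurable_EFinP; exact: measurable_funB. Qed.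

Let psi1 : nu.-integrable setT (EFin \o psi e1).
Proof. by apply: psii; rewrite e1_gt0. Qed.

(** Extended values matter: U = +oo where f = 0 < q, and the finite integral of [U] shows that this
    set is null. *)
Let U (x : X) : \bar R := limn_einf (fun n => (u n x)%:E).

Let mU : measurable_fun setT U.
Proof.
have -> : U = (fun x => - limn_esup (fun n => (- u n x)%:E))%E.
  by apply/funext => x; rewrite -limn_einfN; congr limn_einf; apply/funext => n; rewrite /= opprK.
apply: measurableT_comp => //; apply: measurable_fun_limn_esup => n.
apply/measurable_EFinP; apply: measurableT_comp => //; exact: measurable_funB.
Qed.

Let U0 x : (0 <= U x)%E.
Proof.
rewrite /U limn_einf_lim; apply: lime_ge; first exact: is_cvg_einfs.
apply: nearW => n; apply: le_ereal_inf_tmp => _ [k /= _ <-].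
by rewrite lee_fin; exact: u0.
Qed.

Let IU : (\int[nu]_x U x <= \int[nu]_x (psi e1 x)%:E)%E.
Proof.
apply: le_trans (fatou nu measurableT mu' _) _.
  by move=> n x _; rewrite lee_fin.
apply: limn_einf_le => n.
under eq_integral do rewrite /u EFinB.
rewrite integralB//; last by apply: psii.
rewrite -[X in (_ <= X)%E]sube0; apply: leeB => //.
Qed.

Let Ui : nu.-integrable setT U.
Proof.
apply/integrableP; split; first exact: mU.
under eq_integral do rewrite gee0_abs//.
apply: le_lt_trans IU _; rewrite ltey_eq.
by rewrite (integrable_fin_num measurableT psi1).
Qed.

Let en_cvg : en n @[n --> \oo] --> (0 : R).
Proof.
rewrite -[X in _ --> X](mulr0 e1); apply: cvgMr; exact: cvg_harmonic.
Qed.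

Let fe_cvg x : fe (en n) x @[n --> \oo] --> f x.
Proof.
have fE s : fe s x = f x + s * (q x - f x) by rewrite /fe; ring.
have -> : (fun n => fe (en n) x) = (fun n => f x + en n * (q x - f x)).
  by apply/funext => n; exact: fE.
suff : f x + en n * (q x - f x) @[n --> \oo] --> f x + 0 * (q x - f x).
  by rewrite mul0r addr0.
by apply: cvgD; [exact: cvg_cst|exact: cvgMl].
Qed.

Let U_pos x : 0 < f x -> U x = (psi e1 x - ln (f x) * (q x - f x))%:E.
Proof.
move=> fx.
suff : (u n x)%:E @[n --> \oo] --> (psi e1 x - ln (f x) * (q x - f x))%:E.
  by move=> /cvg_limn_einf_sup[].
apply: cvg_EFin; first exact: nearW.
apply: cvgB; first exact: cvg_cst.
apply: cvgMl.
have H : (@ln R \o (fun n => fe (en n) x)) n @[n --> \oo] --> ln (f x).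
  by apply: continuous_cvg; [exact: continuous_ln|exact: fe_cvg].
exact: H.
Qed.

Let U_bad x : f x = 0 -> 0 < q x -> U x = +oo%E.
Proof.
move=> fx qx.
suff : (u n x)%:E @[n --> \oo] --> +oo%E.
  by move=> /cvg_limn_einf_sup[].
apply/cvgeryP/cvgryPge => A.
have E n : fe (en n) x = en n * q x by rewrite /fe fx mulr0 add0r.
pose B := expR (- (A - psi e1 x) / q x).
have B0 : 0 < B by exact: expR_gt0.
have Bq : 0 < B / q x by rewrite divr_gt0.
have /cvgrPdist_lt/(_ _ Bq) := en_cvg.
apply: filterS => n; rewrite sub0r normrN gtr0_norm// => hn.
have h : ln (fe (en n) x) <= - (A - psi e1 x) / q x.
  rewrite -[X in _ <= X]expRK ler_ln ?posrE ?expR_gt0 ?E ?mulr_gt0//.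
  by rewrite -ler_pdivlMr// ltW.
rewrite /u /psi fx subr0 lerBrDr -lerBrDl.
move: h; rewrite ler_pdivlMr//.
have -> : psi e1 x = ln (fe e1 x) * q x by rewrite /psi fx subr0.
lra.
Qed.

Let U_zero x : f x = 0 -> q x = 0 -> U x = (psi e1 x - ln (f x) * (q x - f x))%:E.
Proof.
move=> fx qx; rewrite /psi fx qx subrr !mulr0 subrr.
suff : (u n x)%:E @[n --> \oo] --> 0%:E.
  by move=> /cvg_limn_einf_sup[].
rewrite (_ : (fun n => _) = cst 0%:E); first exact: cvg_cst.
by apply/funext => n; rewrite /u /psi fx qx subrr !mulr0 subrr.
Qed.

Let V x : R := psi e1 x - ln (f x) * (q x - f x).

Let mV : measurable_fun setT V.
Proof.
apply: measurable_funB => //; apply: measurable_funM; last exact: measurable_funB.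
exact: measurableT_comp (@measurable_ln R) mf.
Qed.

Let Ufin : {ae nu, forall x, (U x < +oo)%E}.
Proof.
have := integrable_ae measurableT Ui.
by apply: filterS => x /(_ I); rewrite ge0_fin_numE.
Qed.

Lemma first_variation_support : {ae nu, forall x, f x = 0 -> q x = 0}.
Proof.
move: Ufin; apply: filterS => x Ux fx; apply/eqP; rewrite eq_le q0 andbT leNgt.
by apply/negP => qx; move: Ux; rewrite U_bad// ltxx.
Qed.

Let UV : ae_eq nu setT U (EFin \o V).
Proof.
move: first_variation_support; apply: filterS => x h _.
have := f0 x; rewrite le_eqVlt => /predU1P[fx|fx]; last exact: U_pos.
by apply: U_zero => //; exact: h.
Qed.

Let Vi : nu.-integrable setT (EFin \o V).
Proof.
have mEV : measurable_fun setT (EFin \o V) by exact/measurable_EFinP.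
apply/integrableP; split=> //.
rewrite -(@ae_eq_integral _ _ _ nu setT (fun x => `|(EFin \o V) x|)%E (fun x => `|U x|)%E) //.
- by have /integrableP[] := Ui.
- by apply: measurableT_comp.
- by apply: measurableT_comp.
- by have := ae_eq_abse UV.
Qed.

(** Finite entropies of [f] and [q] do not bound the integral of q ln f from below; minimality and
    Fatou's lemma do. *)
Lemma first_variation_integrable :
  nu.-integrable setT (fun x => (ln (f x) * (q x - f x))%:E).
Proof.
have := integrableB measurableT psi1 Vi; apply: eq_integrable => // x _.
by rewrite /= -EFinB; congr EFin; rewrite /V opprB addrCA subrr addr0.
Qed.

Lemma first_variation_ge0 : 0 <= \int[nu]_x (ln (f x) * (q x - f x)).
Proof.
have -> : \int[nu]_x (ln (f x) * (q x - f x)) = \int[nu]_x (psi e1 x - V x).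
  by apply: eq_Rintegral => x _; rewrite /V opprB addrCA subrr addr0.
rewrite RintegralB// subr_ge0 /Rintegral fine_le//.
- exact: (integrable_fin_num measurableT Vi).
- exact: (integrable_fin_num measurableT psi1).
rewrite -(@ae_eq_integral _ _ _ nu setT (EFin \o V) U) //.
exact/measurable_EFinP.
Qed.

Lemma integrable_ln_mul : nu.-integrable setT (fun x => (ln (f x) * f x)%:E).
Proof.
apply: (@le_integrable _ _ _ _ _ measurableT _
  (fun x => (theta (f x))%:E + (EFin \o f) x + 1%:E)%E).
- apply/measurable_EFinP; apply: measurable_funM => //.
  exact: measurableT_comp (@measurable_ln R) mf.
- move=> x _; rewrite /= lee_fin.
  have h0 : 0 <= theta (f x) + f x + 1 by have := theta_ge0 (f0 x); have := f0 x; lra.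
  by rewrite [X in _ <= X]ger0_norm// mulrC xlnx_le.
apply: integrableD => //; last exact: finite_measure_integrable_cst.
by apply: integrableD => //; exact: theta_integrable.
Qed.

End first_variation.

(** * Path functionals *)

Section time_interval.
Context (R : realType) (T : {posnum R}).

(** Continuity is tested on sequences because dominated convergence is a statement about
    sequences. *)
Lemma time_seq_continuous (f : time T -> R) :
  (forall (s : nat -> time T) t, s n @[n --> \oo] --> t ->
    f (s n) @[n --> \oo] --> f t) -> continuous f.
Proof.
move=> h t.
have FF : Filter (nbhs t) by exact: nbhs_filter.
apply/cvgrPdist_lt => e e0.
apply: contrapT => nh.
have bad (n : nat) : exists s : time T, ball t n.+1%:R^-1 s /\ e <= `|f t - f s|.
  apply: contrapT => nn; apply: nh.
  suff : nbhs t [set s | `|f t - f s| < e] by [].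
  apply/nbhs_ballP.
  exists n.+1%:R^-1 => /=; first by rewrite invr_gt0.
  move=> s bs; rewrite /= ltNge; apply/negP => es.
  by apply: nn; exists s.
have [s hs] := choice bad.
have st : s n @[n --> \oo] --> t.
  apply/cvg_ballP => r r0; near=> n.
  have [+ _] := hs n; apply: le_ball.
  rewrite invf_ple ?posrE//; apply: ltW; apply: lt_le_trans (archi_boundP _) _.
    by rewrite invr_ge0 ltW.
  rewrite ler_nat; apply: leq_trans (leqnSn _); near: n; exact: nbhs_infty_ge.
have /cvgrPdist_lt/(_ e e0) := h s t st.
move=> [N _ /(_ N (leqnn N))] /=; rewrite ltNge.
by have [_ ->] := hs N.
Unshelve. all: end_near. Qed.

Lemma time_EVT_max (f : time T -> R) : continuous f -> exists c, forall t, f t <= f c.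
Proof.
move=> cf.
have /subspace_valL_continuousP'-/(_ 0) cf' := cf.
have [c c01 cmax] := EVT_max (ltW [gt0 of T%:num]) cf'.
have cin : c \in `[0, T%:num]%classic by rewrite inE.
exists (SigSub cin) => t.
have := cmax (\val t) (set_valP t).
have E (s : time T) : 'valL_0 f (\val s) = f s.
  by rewrite -[LHS]/(sigL _ ('valL_0 f) s) valLK.
by rewrite E -[X in 'valL_0 f X]/(\val (SigSub cin : time T)) E.
Qed.

Lemma time_negative_bound (f : time T -> R) : continuous f -> (forall t, f t < 0) ->
  exists2 c : R, 0 < c & forall t, f t <= - c.
Proof.
move=> cf f0; have [t ht] := time_EVT_max cf.
by exists (- f t); [rewrite oppr_gt0|move=> s; rewrite opprK].
Qed.

End time_interval.

(** * Means and marginals as continuous functions of time *)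

Section path_functionals.
Context (R : realType) (T : {posnum R}) (d : nat) (p : R).
Hypothesis hp : 1 <= p.
Variable g : time T -> 'rV[R]_d -> R.
Hypothesis cg : continuous (fun z : time T * 'rV[R]_d => g z.1 z.2).
Variable D : R.
Hypothesis D0 : 0 <= D.
Hypothesis gD : forall x : 'rV[R]_d,
  (ereal_sup (range (fun t : time T => `|g t x|%:E)) <= (D * (1 + enorm x `^ p))%:E)%E.
Implicit Types (mu : P_path T d p) (t : time T).

Let p0 : 0 < p. Proof. exact: lt_le_trans hp. Qed.

Let g_bound t x : `|g t x| <= D * (1 + enorm x `^ p).
Proof.
rewrite -lee_fin; apply: le_trans (gD x); apply: ereal_sup_ubound.
by exists t.
Qed.

Definition path_bound (w : path_space T d) : R := D * (1 + supnorm w `^ p).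

Lemma path_functional_bound t (w : path_space T d) : `|g t (coord_at t w)| <= path_bound w.
Proof.
apply: le_trans (g_bound t _) _; rewrite ler_wpM2l// lerD2l.
by apply: ge0_ler_powR; rewrite ?nnegrE ?enorm_ge0 ?supnorm_ge0 ?(ltW p0)//; exact: enorm_le_supnorm.
Qed.

Lemma measurable_path_bound : measurable_fun setT (path_bound : borel (path_space T d) -> R).
Proof.
apply: measurable_funM => //; apply: measurable_funD => //.
exact: measurable_supnorm_powR.
Qed.

Lemma path_bound_ge0 w : 0 <= path_bound w.
Proof. by rewrite mulr_ge0// addr_ge0// powR_ge0. Qed.

Lemma integrable_path_bound mu :
  mu.-integrable setT (fun w : borel (path_space T d) => (path_bound w)%:E).
Proof.
have H : mu.-integrable setT (fun w : borel (path_space T d) => (supnorm w `^ p)%:E).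
  apply/integrableP; split.
    by apply/measurable_EFinP; exact: measurable_supnorm_powR.
  under eq_integral do rewrite gee0_abs ?lee_fin ?powR_ge0//.
  exact: wprob_moment.
have := integrableZl measurableT D (integrableD measurableT (finite_measure_integrable_cst mu 1 measurableT) H).
by apply: eq_integrable.
Qed.

Lemma measurable_functional t : measurable_fun setT (g t : borel 'rV[R]_d -> R).
Proof.
apply: continuous_borel_measurableR => x.
apply: (@continuous_comp _ _ _ (fun x => (t, x)) (fun z : time T * 'rV[R]_d => g z.1 z.2)).
  have Fx : Filter (nbhs x) by exact: nbhs_filter.
  have Ft : Filter (nbhs t) by exact: nbhs_filter.
  by apply: (@cvg_pair _ _ _ (nbhs x) (nbhs t) (nbhs x) Fx Ft Fx); [exact: cvg_cst|exact: cvg_id].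
exact: cg.
Qed.

Lemma measurable_path_functional t :
  measurable_fun setT ((fun w => g t (coord_at t w)) : borel (path_space T d) -> R).
Proof. exact: measurableT_comp (measurable_functional t) (@measurable_coord_at R T d t). Qed.

Lemma integrable_path_functional mu t :
  mu.-integrable setT (fun w : borel (path_space T d) => (g t (coord_at t w))%:E).
Proof.
apply: (@le_integrable _ _ _ _ _ measurableT _ (fun w : borel (path_space T d) => (path_bound w)%:E)).
- by apply/measurable_EFinP; exact: measurable_path_functional.
- by move=> w _; rewrite lee_fin [X in _ <= X]ger0_norm ?path_bound_ge0 ?path_functional_bound.
- exact: integrable_path_bound.
Qed.

Definition path_mean mu t : R := \int[mu]_w g t (coord_at t w).

Lemma marginal_mean mu t : \int[marginal hp mu t]_x g t x = path_mean mu t.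
Proof.
rewrite /Rintegral /path_mean; congr fine.
apply: (@integral_pushforward _ _ _ _ _ _ (@measurable_coord_at R T d t)
  mu setT (EFin \o g t)) => //.
- by apply/measurable_EFinP; exact: measurable_functional.
- rewrite preimage_setT; exact: integrable_path_functional.
Qed.

Lemma path_functional_continuous (w : path_space T d) :
  continuous (fun t => g t (coord_at t w)).
Proof.
move=> t.
apply: (@continuous_comp _ _ _ (fun t => (t, coord_at t w)) (fun z : time T * 'rV[R]_d => g z.1 z.2)).
  have Ft : Filter (nbhs t) by exact: nbhs_filter.
  have Fw : Filter (nbhs (coord_at t w)) by exact: nbhs_filter.
  apply: (@cvg_pair _ _ _ (nbhs t) (nbhs t) (nbhs (coord_at t w)) Ft Ft Fw); first exact: cvg_id.
  exact: cts_fun.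
exact: cg.
Qed.

Lemma path_mean_continuous mu : continuous (path_mean mu).
Proof.
apply: time_seq_continuous => s t st.
have [||||_ _ H] := @dominated_convergence _ _ _ mu setT measurableT
  (fun n (w : borel (path_space T d)) => (g (s n) (coord_at (s n) w))%:E)
  (fun w => (g t (coord_at t w))%:E) (fun w => (path_bound w)%:E) _ _ _
  (integrable_path_bound mu) _.
- by move=> n; apply/measurable_EFinP; exact: measurable_path_functional.
- by apply/measurable_EFinP; exact: measurable_path_functional.
- apply: aeW => w _; apply: cvg_EFin; first exact: nearW.
  exact: (continuous_cvg _ (@path_functional_continuous w t) st).
- by apply: aeW => w n _; rewrite lee_fin path_functional_bound.
by apply: fine_cvg; rewrite fineK//; exact: integrable_fin_num (integrable_path_functional mu t).
Qed.

Lemma path_mean_mix (e : R) mu1 mu2 t : 0 <= e <= 1 ->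
  path_mean (path_mix e mu1 mu2) t = (1 - e) * path_mean mu1 t + e * path_mean mu2 t.
Proof.
move=> e01; have /andP[e0 e1] := e01.
have i1 := integrable_path_functional mu1 t.
have i2 := integrable_path_functional mu2 t.
(* Integrals against a mixture split for nonnegative functions. Both the bound [b] and the
   functional shifted by it, [gp], are of that kind, and subtraction gives the claim. *)
pose b (w : borel (path_space T d)) := path_bound w.
pose gp (w : borel (path_space T d)) := g t (coord_at t w) + b w.
have mgp : measurable_fun setT gp.
  by apply: measurable_funD; [exact: measurable_path_functional|exact: measurable_path_bound].
have gp0 w : 0 <= gp w.
  by have := path_functional_bound t w; rewrite ler_norml /gp /b; lra.
have E mu : (\int[mu]_w (gp w)%:E = (path_mean mu t + \int[mu]_w b w)%:E)%E.
  have ig := integrable_path_functional mu t.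
  have ib := integrable_path_bound mu.
  under eq_integral do rewrite EFinD.
  rewrite integralD// EFinD /path_mean /Rintegral !fineK//; exact: integrable_fin_num.
have Eb mu : (\int[mu]_w (b w)%:E = (\int[mu]_w b w)%:E)%E.
  by rewrite fineK//; apply: integrable_fin_num => //; exact: integrable_path_bound.
have H1 : (\int[path_mix e mu1 mu2]_w (gp w)%:E =
    (1 - e)%:E * \int[mu1]_w (gp w)%:E + e%:E * \int[mu2]_w (gp w)%:E)%E.
  apply: ge0_integral_mixm => //; first exact/measurable_EFinP.
have H2 : (\int[path_mix e mu1 mu2]_w (b w)%:E =
    (1 - e)%:E * \int[mu1]_w (b w)%:E + e%:E * \int[mu2]_w (b w)%:E)%E.
  apply: ge0_integral_mixm => //; first by apply/measurable_EFinP; exact: measurable_path_bound.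
  by move=> w; rewrite lee_fin path_bound_ge0.
move: H1 H2; rewrite !E !Eb -!EFinM -!EFinD => -[+] [].
set x := path_mean (path_mix _ _ _) t; set y := Rintegral (path_mix _ _ _) _ _.
lra.
Qed.

(** Under [mu], the pair of positions at times [t] and [s n] couples the two marginals; its cost
    tends to 0 by dominated convergence, paths being continuous. *)
Lemma law_continuous (Psi : P_Rd d p -> R) mu : continuous Psi ->
  continuous (fun t => Psi (marginal hp mu t)).
Proof.
move=> cPsi; apply: time_seq_continuous => s t st.
move=> W /cPsi /nbhs_wasserstein[e e0 hW].
pose c := (e / 2) `^ p.
have c0 : 0 < c by apply: powR_gt0; rewrite divr_gt0.
pose K n (w : borel (path_space T d)) := enorm (coord_at t w - coord_at (s n) w) `^ p.
pose pr n (w : borel (path_space T d)) : borel 'rV[R]_d * borel 'rV[R]_d :=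
  (coord_at t w, coord_at (s n) w).
have mpr n : measurable_fun setT (pr n).
  by apply: measurable_fun_pair; exact: measurable_coord_at.
have mK n : measurable_fun setT (K n).
  exact: measurableT_comp (@measurable_enorm_sub_powR R d p) (mpr n).
have i1 := integrable_path_bound mu.
pose B (w : borel (path_space T d)) := 2 * 2 `^ p * supnorm w `^ p.
have iB : mu.-integrable setT (fun w => (B w)%:E).
  apply/integrableP; split.
    apply/measurable_EFinP; apply: measurable_funM => //; exact: measurable_supnorm_powR.
  under eq_integral do rewrite gee0_abs ?lee_fin ?mulr_ge0 ?powR_ge0// EFinM.
  rewrite ge0_integralZl//; last 2 first.
  - by apply/measurable_EFinP; exact: measurable_supnorm_powR.
  - by move=> x _; rewrite lee_fin powR_ge0.
  by apply: lte_mul_pinfty; rewrite ?lee_fin ?mulr_ge0 ?powR_ge0//; exact: wprob_moment.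
have [||||_ _] := @dominated_convergence _ _ _ mu setT measurableT
  (fun n w => (K n w)%:E) (cst 0%E) (fun w => (B w)%:E) _ _ _ iB _.
- by move=> n; exact/measurable_EFinP.
- exact: measurable_cst.
- apply: aeW => w _; apply: cvg_EFin; first exact: nearW.
  have cw : coord_at (s n) w @[n --> \oo] --> coord_at t w.
    exact: (continuous_cvg _ (@cts_fun _ _ (w : continuousType (time T) 'rV[R]_d) t) st).
  have ce : enorm (coord_at t w - coord_at (s n) w) @[n --> \oo] --> 0.
    rewrite -(enorm0 R d) -[X in _ --> enorm X](subrr (coord_at t w)).
    apply: (continuous_cvg _ (@enorm_continuous R d _)).
    by apply: cvgB; [exact: cvg_cst|exact: cw].
  apply/cvgrPdist_lt => r r0.
  have rp0 : 0 < Num.min r 1 by rewrite lt_min r0 ltr01.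
  have /cvgrPdist_lt/(_ _ rp0) := ce.
  apply: filterS => n; rewrite !sub0r !normrN !ger0_norm ?enorm_ge0 ?powR_ge0//.
  rewrite lt_min => /andP[h1 h2].
  rewrite /= /K; have [->|h3] := eqVneq (enorm (coord_at t w - coord_at (s n) w)) 0.
    by rewrite powR0// gt_eqF.
  apply: le_lt_trans h1; apply: ge1r_powR => //.
  by rewrite (ltW h2) andbT lt_neqAle eq_sym h3 enorm_ge0.
- apply: aeW => w n _; rewrite gee0_abs ?lee_fin ?powR_ge0//.
  apply: le_trans (enorm_sub_powR_le _ _ hp) _.
  have le_sup r : enorm (coord_at r w) `^ p <= supnorm w `^ p.
    by apply: ge0_ler_powR; rewrite ?nnegrE ?enorm_ge0 ?supnorm_ge0 ?(ltW p0)//; exact: enorm_le_supnorm.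
  have p2 : 0 <= 2 `^ p :> R by exact: powR_ge0.
  have := ler_wpM2l p2 (le_sup t); have := ler_wpM2l p2 (le_sup (s n)).
  by rewrite /B -[2 * 2 `^ p * _]mulrA; lra.
rewrite integral0 => /fine_cvgP[fin /cvgrPdist_lt/(_ c c0) hlim].
suff : \forall n \near \oo, W (Psi (marginal hp mu (s n))) by [].
near=> n.
apply: hW.
pose prm : {mfun borel (path_space T d) >-> (borel 'rV[R]_d * borel 'rV[R]_d)%type} :=
  HB.pack_for {mfun borel (path_space T d) >-> (borel 'rV[R]_d * borel 'rV[R]_d)%type} (pr n)
    (isMeasurableFun.Build _ _ _ _ _ (mpr n)).
apply: (@wasserstein_lt _ _ _ hp _ _ (distribution mu prm) e e0).
  by split.
rewrite ge0_integral_distribution; last 2 first.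
- by apply/measurable_EFinP; exact: measurable_enorm_sub_powR.
- by move=> z; rewrite lee_fin powR_ge0.
have fn : (\int[mu]_w (K n w)%:E)%E \is a fin_num by near: n.
have : `|0 - fine (\int[mu]_w (K n w)%:E)%E| < c by near: n.
rewrite sub0r normrN => /(le_lt_trans (ler_norm _))/ltW.
by rewrite -lee_fin fineK.
Unshelve. all: end_near. Qed.

End path_functionals.

(** * Rectangular perturbations *)

Section bounded_transport.
Context d1 d2 (Y : measurableType d1) (E : measurableType d2) (R : realType).
Local Open Scope ereal_scope.

(** On the set where a density exceeds [c], the excess has nonpositive integral; so this set is null
    and the density can be truncated at [c] everywhere. *)
Lemma has_density_bounded (q pi : {finite_measure set E -> \bar R}) (c : R) :
  (0 <= c)%R -> (forall A, measurable A -> q A <= c%:E * pi A) ->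
  exists2 k, has_density q pi k & forall x, (k x <= c)%R.
Proof.
move=> c0 qpi.
have dom : q `<< pi.
  apply/null_content_dominatesP => A mA piA; apply/eqP.
  by rewrite eq_le measure_ge0 andbT (le_trans (qpi _ mA))// piA mule0.
have [k [mk k0 kE]] := has_density_exists dom.
pose A := [set x | (c < k x)%R].
have mA : measurable A.
  rewrite (_ : A = k @^-1` `]c, +oo[); last by apply/seteqP; split => x /=; rewrite in_itv/= andbT.
  by rewrite -[X in measurable X]setTI; exact: mk.
have mkA : measurable_fun A (fun x => (k x - c)%:E).
  by apply/measurable_EFinP; apply: measurable_funB => //; exact: measurable_funTS.
have I0 : \int[pi]_(x in A) `|(k x - c)%:E| = 0.
  have e1 : \int[pi]_(x in A) `|(k x - c)%:E| = \int[pi]_(x in A) (k x - c)%:E.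
    by apply: eq_integral => x; rewrite inE /A/= => cx; rewrite ger0_norm ?subr_ge0 ?ltW.
  have e2 : \int[pi]_(x in A) (k x)%:E = \int[pi]_(x in A) (k x - c)%:E + c%:E * pi A.
    rewrite -integral_cst//= -ge0_integralD//=.
    - by apply: eq_integral => x _; rewrite -EFinD subrK.
    - by move=> x cx; rewrite lee_fin subr_ge0 ltW.
  have := qpi _ mA; rewrite kE// e2 e1 => H.
  apply/eqP; rewrite eq_le; apply/andP; split; last first.
    by apply: integral_ge0 => x cx; rewrite lee_fin subr_ge0 ltW.
  have fA : c%:E * pi A \is a fin_num by rewrite fin_numM// fin_num_measure.
  by move: H; rewrite -[X in _ <= X]add0e leeD2rE.
have kc : {ae pi, forall x, (k x <= c)%R}.
  have /ae_eq_integral_abs := I0 => /(_ mA mkA) [N [mN N0 hN]].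
  exists N; split => // x /= /negP; rewrite -ltNge => cx; apply: hN => /= /(_ cx)[].
  by move/eqP; rewrite subr_eq0 => /eqP kx; rewrite kx ltxx in cx.
exists (fun x => Num.min (k x) c); last by move=> x; rewrite ge_min lexx orbT.
split.
- by apply: measurable_minr.
- by move=> x; rewrite le_min k0.
- move=> B mB; rewrite kE//; apply: ae_eq_integral => //.
  + by apply/measurable_EFinP; exact: measurable_funTS.
  + apply/measurable_EFinP; apply: measurable_funTS; exact: measurable_minr.
  + by apply: filterS kc => x kx _; rewrite /= min_l.
Qed.

(** [k] is the density of the image under [u] of [M] restricted to [S], presented through its change
    of variables formula. *)
Lemma bounded_transport (M : {measure set Y -> \bar R}) (S : set Y) (u : Y -> E)
    (pi : {finite_measure set E -> \bar R}) (c : R) :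
  measurable S -> measurable_fun setT u -> (0 <= c)%R ->
  (forall A, measurable A -> M (S `&` u @^-1` A) <= c%:E * pi A) ->
  exists k : E -> R, [/\ measurable_fun setT k, forall x, (0 <= k x <= c)%R
    & forall phi : E -> \bar R, measurable_fun setT phi -> (forall x, 0 <= phi x) ->
      \int[M]_y (phi (u y) * (\1_S y)%:E) = \int[pi]_x (phi x * (k x)%:E)].
Proof.
move=> mS mu c0 Mpi.
pose q : {measure set E -> \bar R} :=
  measure_function_pushforward__canonical__measure_function_Measure (mrestr M mS) mu.
have qE A : q A = M (S `&` u @^-1` A) by rewrite setIC.
have qf : fin_num_fun q.
  move=> A mA; rewrite ge0_fin_numE// qE; apply: le_lt_trans (Mpi _ mA) _.
  by rewrite ltey_eq fin_numM// fin_num_measure.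
pose q' : {finite_measure set E -> \bar R} := as_finite_measure qf.
have [A mA|k hk kc] := @has_density_bounded q' pi c c0.
  by rewrite (_ : q' A = M (S `&` u @^-1` A)) ?Mpi//; exact: qE.
have [mk k0 kE] := hk.
exists k; split => //; first by move=> x; rewrite k0 kc.
move=> phi mphi phi0.
rewrite -(ge0_integral_density hk)//.
transitivity (\int[mrestr M mS]_y phi (u y)); last first.
  symmetry; apply: (@ge0_integral_pushforward _ _ _ _ _ u mu (mrestr M mS) setT phi) => //.
have hS : has_density (mrestr M mS) M \1_S.
  split => //= A mA; rewrite /mrestr integral_indic//.
  by rewrite setIC.
rewrite (ge0_integral_density hS)//.
exact: measurableT_comp.
Qed.

End bounded_transport.

Lemma product_measure_ysection d1 d2 (E1 : measurableType d1) (E2 : measurableType d2)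
    (R : realType) (a : probability E1 R) (b : probability E2 R) (A : set (E1 * E2)%type) :
  measurable A -> ((a \x b) A = \int[b]_y a (ysection A y))%E.
Proof.
move=> mA; apply: (@product_measure_unique _ _ _ _ _ a b (product_measure2 a b)) => // B C mB mC.
exact: product_measure2E.
Qed.

Section quadruple.
Context d d1 d2 (W : measurableType d) (E1 : measurableType d1) (E2 : measurableType d2)
  (R : realType).
Local Open Scope ereal_scope.
Variables (u1 : W -> E1) (u2 : W -> E2).
Hypotheses (mu1 : measurable_fun setT u1) (mu2 : measurable_fun setT u2).
Variables (a : probability E1 R) (b : probability E2 R).
Variable alpha : {finite_measure set W -> \bar R}.
Hypotheses (alpha1 : forall A, measurable A -> alpha (u1 @^-1` A) <= a A)
  (alpha2 : forall A, measurable A -> alpha (u2 @^-1` A) <= b A).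

Let m : probability (E1 * E2)%type R := (a \x b).
Let M : {measure set (W * (E1 * E2))%type -> \bar R} := (alpha \x m).

Lemma measurable_swap_left : measurable_fun setT (fun y : W * (E1 * E2) => (u1 y.1, y.2.2)).
Proof.
apply/measurable_fun_pairP; split.
  exact: (measurableT_comp mu1 measurable_fst).
exact: (measurableT_comp measurable_snd measurable_snd).
Qed.

Lemma measurable_swap_right : measurable_fun setT (fun y : W * (E1 * E2) => (y.2.1, u2 y.1)).
Proof.
apply/measurable_fun_pairP; split; last exact: (measurableT_comp mu2 measurable_fst).
exact: (measurableT_comp measurable_fst measurable_snd).
Qed.

Let le_integral_image d' (F : measurableType d') (u : W -> F) (c : probability F R)
    (f : F -> \bar R) : measurable_fun setT u ->
  (forall A, measurable A -> alpha (u @^-1` A) <= c A) ->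
  measurable_fun setT f -> (forall x, 0 <= f x) ->
  \int[alpha]_w f (u w) <= \int[c]_x f x.
Proof.
move=> mu ac mf f0.
pose um : {mfun W >-> F} := HB.pack_for {mfun W >-> F} u (isMeasurableFun.Build _ _ _ _ _ mu).
rewrite -(@ge0_integral_pushforward _ _ _ _ _ um mu alpha setT f)//.
exact: ge0_le_measure_integral.
Qed.

(** The second coordinate of the product factor is independent of [w] and has law [b], so the image
    is the first marginal of [alpha] times [b]; that marginal is below [a]. *)
Lemma swap_left_le A : measurable A -> M ((fun y => (u1 y.1, y.2.2)) @^-1` A) <= m A.
Proof.
move=> mA.
have mB : measurable ((fun y : W * (E1 * E2) => (u1 y.1, y.2.2)) @^-1` A).
  by rewrite -[X in measurable X]setTI; exact: measurable_swap_left.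
have -> : M ((fun y => (u1 y.1, y.2.2)) @^-1` A) = \int[alpha]_w b (xsection A (u1 w)).
  apply: eq_integral => w _ /=.
  rewrite (_ : xsection _ w = setT `*` xsection A (u1 w)); last first.
    by apply/seteqP; split => [[x y]|[x y]] /=; rewrite /xsection/= !inE//= => -[].
  transitivity (a setT * b (xsection A (u1 w))).
    by apply: product_measure1E => //; exact: measurable_xsection.
  by rewrite probability_setT mul1e.
apply: (le_integral_image (f := fun x => b (xsection A x)) mu1 alpha1) => //.
exact: measurable_fun_xsection.
Qed.

Lemma swap_right_le A : measurable A -> M ((fun y => (y.2.1, u2 y.1)) @^-1` A) <= m A.
Proof.
move=> mA.
have -> : M ((fun y => (y.2.1, u2 y.1)) @^-1` A) = \int[alpha]_w a (ysection A (u2 w)).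
  apply: eq_integral => w _ /=.
  rewrite (_ : xsection _ w = ysection A (u2 w) `*` setT); last first.
    by apply/seteqP; split => [[x y]|[x y]] /=; rewrite /xsection/ysection/= !inE//= => -[].
  transitivity (a (ysection A (u2 w)) * b setT).
    by apply: product_measure1E => //; exact: measurable_ysection.
  by rewrite probability_setT mule1.
apply: le_trans (le_integral_image (f := fun x => a (ysection A x)) mu2 alpha2 _ _) _ => //.
  exact: measurable_fun_ysection.
by rewrite le_eqVlt; apply/orP; left; apply/eqP; symmetry; exact: product_measure_ysection.
Qed.

Lemma second_le A : measurable A -> M (snd @^-1` A) <= m A.
Proof.
move=> mA; rewrite (_ : snd @^-1` A = setT `*` A); last by apply/seteqP; split => [[x y]|[x y]] //= [].
have -> : M (setT `*` A) = alpha setT * m A by exact: product_measure1E.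
rewrite -[leRHS]mul1e lee_wpmul2r//.
by rewrite -(probability_setT a) -(preimage_setT u1) alpha1.
Qed.

Lemma first_eq A : measurable A -> M (fst @^-1` A) = alpha A.
Proof.
move=> mA; rewrite (_ : fst @^-1` A = A `*` setT); last by apply/seteqP; split => [[x y]|[x y]] //= [].
have -> : M (A `*` setT) = alpha A * m setT by exact: product_measure1E.
by rewrite probability_setT mule1.
Qed.

(* [k2], [k3], [k4] are the densities of the images of [M] restricted to [S] under
   (w, z) |-> (u1 w, z.2), (z.1, u2 w), z.  Adding [s alpha + k4 beta'] and removing
   [(k2 + k3) beta] preserves both marginals: the four image points are the corners
   of a rectangle. *)
Lemma quadruple (beta beta' : {finite_measure set (E1 * E2)%type -> \bar R}) (B B' : set (E1 * E2)%type)
    (c : R) (S : set (W * (E1 * E2))%type) :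
  (0 <= c)%R -> measurable B -> measurable B' -> measurable S ->
  (forall A, measurable A -> m (A `&` B) <= c%:E * beta A) ->
  (forall A, measurable A -> m (A `&` B') <= c%:E * beta' A) ->
  (forall y, S y -> [/\ B (u1 y.1, y.2.2), B (y.2.1, u2 y.1) & B' y.2]) ->
  exists (s : W -> R) (k2 k3 k4 : E1 * E2 -> R),
  [/\ [/\ measurable_fun setT s, measurable_fun setT k2, measurable_fun setT k3
        & measurable_fun setT k4],
      [/\ forall w, (0 <= s w <= 1)%R, forall e, (0 <= k2 e <= c)%R, forall e, (0 <= k3 e <= c)%R
        & forall e, (0 <= k4 e <= c)%R],
      forall psi : W -> \bar R, measurable_fun setT psi -> (forall x, 0 <= psi x) ->
        \int[M]_y (psi y.1 * (\1_S y)%:E) = \int[alpha]_w (psi w * (s w)%:E)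
    & forall phi : E1 * E2 -> \bar R, measurable_fun setT phi -> (forall x, 0 <= phi x) ->
      [/\ \int[M]_y (phi (u1 y.1, y.2.2) * (\1_S y)%:E) = \int[beta]_e (phi e * (k2 e)%:E),
          \int[M]_y (phi (y.2.1, u2 y.1) * (\1_S y)%:E) = \int[beta]_e (phi e * (k3 e)%:E)
        & \int[M]_y (phi y.2 * (\1_S y)%:E) = \int[beta']_e (phi e * (k4 e)%:E)] ].
Proof.
move=> c0 mB mB' mS hB hB' SB.
have mI (u : W * (E1 * E2) -> E1 * E2) A : measurable_fun setT u -> measurable A ->
    measurable (u @^-1` A) by move=> mu mA; rewrite -[X in measurable X]setTI; exact: mu.
have leM A A' : measurable A -> measurable A' -> A `<=` A' -> M A <= M A'.
  by move=> mA mA' AA'; apply: le_measure => //; rewrite inE.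
have [|s [ms s01 sE]] := @bounded_transport _ _ _ _ R M S fst alpha 1 mS measurable_fst ler01.
  move=> A mA; rewrite mul1e; apply: le_trans (_ : M (fst @^-1` A) <= _); last first.
    by rewrite (first_eq mA).
  have mfA : measurable (fst @^-1` A : set (W * (E1 * E2))%type).
    by rewrite -[X in measurable X]setTI; exact: measurable_fst.
  by apply: leM => //; exact: measurableI.
have [|k2 [mk2 k20 k2E]] := @bounded_transport _ _ _ _ R M S _ beta c mS measurable_swap_left c0.
  move=> A mA; apply: le_trans (hB _ mA); apply: le_trans (swap_left_le (measurableI _ _ mA mB)).
  apply: leM.
  - by apply: measurableI => //; apply: mI => //; exact: measurable_swap_left.
  - by apply: mI; [exact: measurable_swap_left|exact: measurableI].
  - by move=> y [/SB[h _ _] h']; split.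
have [|k3 [mk3 k30 k3E]] := @bounded_transport _ _ _ _ R M S _ beta c mS measurable_swap_right c0.
  move=> A mA; apply: le_trans (hB _ mA); apply: le_trans (swap_right_le (measurableI _ _ mA mB)).
  apply: leM.
  - by apply: measurableI => //; apply: mI => //; exact: measurable_swap_right.
  - by apply: mI; [exact: measurable_swap_right|exact: measurableI].
  - by move=> y [/SB[_ h _] h']; split.
have [|k4 [mk4 k40 k4E]] := @bounded_transport _ _ _ _ R M S snd beta' c mS measurable_snd c0.
  move=> A mA; apply: le_trans (hB' _ mA); apply: le_trans (second_le (measurableI _ _ mA mB')).
  apply: leM.
  - by apply: measurableI => //; apply: mI => //; exact: measurable_snd.
  - by apply: mI; [exact: measurable_snd|exact: measurableI].
  - by move=> y [/SB[_ _ h] h']; split.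
exists s, k2, k3, k4; split => // phi mphi phi0; split; [exact: k2E|exact: k3E|exact: k4E].
Qed.

End quadruple.

Section transport.
Context d1 d2 (Y : measurableType d1) (E : measurableType d2) (R : realType).
Local Open Scope ereal_scope.

Lemma transport_integrable (M : {measure set Y -> \bar R}) (S : set Y) (u : Y -> E)
    (pi : {measure set E -> \bar R}) (k : E -> R) (c : R) (phi : E -> R) :
  measurable S -> measurable_fun setT u -> measurable_fun setT k ->
  (forall x, 0 <= k x <= c)%R ->
  (forall psi : E -> \bar R, measurable_fun setT psi -> (forall x, 0 <= psi x) ->
    \int[M]_y (psi (u y) * (\1_S y)%:E) = \int[pi]_x (psi x * (k x)%:E)) ->
  pi.-integrable setT (EFin \o phi) ->
  M.-integrable setT (fun y => (phi (u y) * \1_S y)%:E) /\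
  (\int[M]_y (phi (u y) * \1_S y) = \int[pi]_x (phi x * k x))%R.
Proof.
move=> mS mu mk kc H ip.
have mphi : measurable_fun setT phi by apply/measurable_EFinP; exact: (measurable_int pi).
have mu1 : measurable_fun setT (fun y => (phi (u y) * \1_S y)%R).
  by apply: measurable_funM => //; exact: measurableT_comp.
have k0 x : (0 <= k x)%R by have /andP[] := kc x.
have i1 : M.-integrable setT (fun y => (phi (u y) * \1_S y)%:E).
  apply/integrableP; split; first exact/measurable_EFinP.
  rewrite (_ : \int[M]_y _ = \int[pi]_x (`|(phi x)%:E| * (k x)%:E)); last first.
    rewrite -(H (fun x => `|(phi x)%:E|))//.
      by apply: eq_integral => y _; rewrite -EFinM/= normrM (ger0_norm (_ : (0 <= \1_S y)%R)).
    by apply: measurableT_comp => //; exact/measurable_EFinP.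
  apply: (@le_lt_trans _ _ (\int[pi]_x (c%:E * `|(phi x)%:E|))).
    apply: ge0_le_integral => //.
    - by move=> x _; rewrite -EFinM lee_fin mulr_ge0.
    - apply/measurable_EFinP; apply: measurable_funM => //.
      exact: measurableT_comp (@normr_measurable R setT) mphi.
    - apply: measurable_funeM; apply: measurableT_comp => //; exact/measurable_EFinP.
    - move=> x _; rewrite /= -!EFinM lee_fin mulrC ler_wpM2r//; by have /andP[] := kc x.
  have := integrableP _ _ _ ip => -[_ ifin].
  have [c0|c0] := leP 0%R c; last first.
    rewrite integral0_eq ?ltry// => x _.
    by have /andP[h1 h2] := kc x; have := le_lt_trans (le_trans h1 h2) c0; rewrite ltxx.
  rewrite ge0_integralZl//; last by apply: measurableT_comp => //; exact/measurable_EFinP.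
  by rewrite ltey_eq fin_numM// ge0_fin_numE//; exact: integral_ge0.
split => //; rewrite /Rintegral; congr fine.
rewrite [LHS]integralE [RHS]integralE.
have mp : measurable_fun setT (EFin \o phi) by exact/measurable_EFinP.
congr (_ - _).
  rewrite (eq_integral (fun y => (EFin \o phi)^\+ (u y) * (\1_S y)%:E)); last first.
    move=> y _; rewrite !funeposE /= indicE; case: (y \in S) => /=; last by rewrite mulr0 mule0 maxxx.
    by rewrite mulr1 mule1.
  rewrite H//; last exact: measurable_funepos.
  apply: eq_integral => x _; rewrite !funeposE /= -EFin_max -EFinM -EFin_max; congr EFin.
  by rewrite maxr_pMl// mul0r.
rewrite (eq_integral (fun y => (EFin \o phi)^\- (u y) * (\1_S y)%:E)); last first.
  move=> y _; rewrite !funenegE /= indicE; case: (y \in S) => /=; last by rewrite mulr0 mule0 oppr0 maxxx.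
  by rewrite mulr1 mule1.
rewrite H//; last exact: measurable_funeneg.
apply: eq_integral => x _; rewrite !funenegE /= -EFin_max -EFinM -EFin_max; congr EFin.
by rewrite maxr_pMl// mul0r mulNr.
Qed.

Lemma integral_mul1_indic (M : {measure set Y -> \bar R}) (S : set Y) : measurable S ->
  \int[M]_y (cst 1%:E y * (\1_S y : R)%:E) = M S.
Proof. by move=> mS; under eq_integral do rewrite mul1e; rewrite integral_indic// setIT. Qed.

Lemma measure0_cover (M : {measure set Y -> \bar R}) (A C : set Y) (B : (set Y)^nat) :
  measurable A -> measurable C -> (forall n, measurable (B n)) ->
  A `<=` \bigcup_n B n `|` C -> (forall n, M (B n) = 0) -> M C = 0 -> M A = 0.
Proof.
move=> mA mC mB AB B0 C0; apply: measure_negligible => //.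
apply: (negligibleS AB); apply: negligibleU.
  by apply: negligible_bigcup => n; exists (B n); split.
by exists C; split.
Qed.

Lemma measure0_setU3 (M : {measure set Y -> \bar R}) (A B C : set Y) :
  measurable A -> measurable B -> measurable C -> M A = 0 -> M B = 0 -> M C = 0 ->
  measurable (A `|` B `|` C) /\ M (A `|` B `|` C) = 0.
Proof.
move=> mA mB mC A0 B0 C0.
have mU : measurable (A `|` B `|` C) by apply: measurableU => //; exact: measurableU.
split => //; apply: measure_negligible => //; apply: negligibleU; last by exists C; split.
by apply: negligibleU; [exists A; split|exists B; split].
Qed.

Lemma measurable_superlevel (r : E -> R) (s : R) : measurable_fun setT r ->
  measurable [set x | (s <= r x)%R].
Proof.
move=> mr; rewrite (_ : [set x | _] = r @^-1` `[s, +oo[%classic); last first.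
  by apply/seteqP; split => x /=; rewrite in_itv/= andbT.
by rewrite -[X in measurable X]setTI; exact: mr.
Qed.

Lemma measurable_pos_level (r : E -> R) : measurable_fun setT r ->
  measurable [set x | (0 < r x)%R].
Proof.
move=> mr; rewrite (_ : [set x | _] = r @^-1` `]0%R, +oo[%classic); last first.
  by apply/seteqP; split => x /=; rewrite in_itv/= andbT.
by rewrite -[X in measurable X]setTI; exact: mr.
Qed.

(** Markov's inequality. It turns positivity of a density into the domination by c times [beta] that
    [quadruple] asks for, with c = 1/s. *)
Lemma density_superlevel (beta m : {measure set E -> \bar R}) (r : E -> R) (s : R) A :
  has_density beta m r -> (0 < s)%R -> measurable A ->
  m (A `&` [set x | (s <= r x)%R]) <= (s^-1)%:E * beta A.
Proof.
move=> [mr r0 h] s0 mA.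
have mS := measurable_superlevel s mr.
rewrite -[leLHS]mul1e -(mulVf (lt0r_neq0 s0)) EFinM -muleA lee_pmul2l//; last first.
  by rewrite lte_fin invr_gt0.
rewrite -integral_cst//=; last exact: measurableI.
rewrite h//; apply: le_trans (_ : \int[m]_(x in A `&` [set x | (s <= r x)%R]) (r x)%:E <= _).
  apply: ge0_le_integral => //; try exact: measurableI.
  - by move=> x _; rewrite lee_fin ltW.
  - by apply/measurable_EFinP; exact: measurable_funTS.
  - by move=> x [_]; rewrite lee_fin.
apply: ge0_subset_integral => //; first exact: measurableI.
  by apply/measurable_EFinP; exact: measurable_funTS.
by move=> x _; rewrite lee_fin.
Qed.

Lemma density_zero_level (beta m : {measure set E -> \bar R}) (r : E -> R) :
  has_density beta m r -> beta [set x | r x = 0%R] = 0.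
Proof.
move=> [mr r0 h].
have mZ : measurable [set x | r x = 0%R].
  rewrite (_ : [set x | _] = r @^-1` [set 0%R]); last by [].
  by rewrite -[X in measurable X]setTI; exact: mr.
by rewrite h// integral0_eq// => x /= ->.
Qed.

End transport.

Section rectangles.
Context d d1 d2 (W : measurableType d) (E1 : measurableType d1) (E2 : measurableType d2)
  (R : realType).
Local Open Scope ereal_scope.
Variables (a : probability E1 R) (b : probability E2 R).

Variables (u1 : W -> E1) (u2 : W -> E2).
Hypotheses (mu1 : measurable_fun setT u1) (mu2 : measurable_fun setT u2).
Variable alpha : {finite_measure set W -> \bar R}.
Hypotheses (alpha1 : forall A, measurable A -> alpha (u1 @^-1` A) <= a A)
  (alpha2 : forall A, measurable A -> alpha (u2 @^-1` A) <= b A).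
Variables (beta : {measure set (E1 * E2)%type -> \bar R}) (r : E1 * E2 -> R).
Hypothesis hr : has_density beta (a \x b) r.
Hypotheses (beta1 : forall A, measurable A -> beta (fst @^-1` A) = a A)
  (beta2 : forall A, measurable A -> beta (snd @^-1` A) = b A).

Let P : set (E1 * E2)%type := [set z | (0 < r z)%R].

Let mP : measurable P. Proof. by apply: measurable_pos_level; have [] := hr. Qed.

Let beta_null (A : set (E1 * E2)%type) : measurable A -> (a \x b) (A `&` P) = 0 -> beta A = 0.
Proof.
have [mr r0 h] := hr => mA A0.
rewrite h// (_ : A = (A `&` P) `|` (A `&` ~` P)); last by rewrite -setIUr setUv setIT.
have mAP : measurable (A `&` P) by exact: measurableI.
have mAC : measurable (A `&` ~` P) by apply: measurableI => //; exact: measurableC.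
rewrite ge0_integral_setU//=.
- rewrite null_set_integral//; last by apply/measurable_EFinP; exact: measurable_funTS.
  rewrite add0e integral0_eq// => z [_ /negP]; rewrite -leNgt => z0.
  by congr EFin; apply/eqP; rewrite eq_le z0 r0.
- by apply/measurable_EFinP; exact: measurable_funTS.
- by move=> z _; rewrite lee_fin.
- by apply/disj_setPS => z [[_ h1] [_ h2]].
Qed.

(** Mass of the section above [x] of the positivity region [P]. As [beta] lives on [P] and has first
    marginal [a], [R1] is positive [a]-almost everywhere; likewise for [R2] and [b]. *)
Let R1 x := b (xsection P x).
Let R2 y := a (ysection P y).

Let mR1 : measurable_fun setT R1. Proof. exact: measurable_fun_xsection. Qed.
Let mR2 : measurable_fun setT R2. Proof. exact: measurable_fun_ysection. Qed.

Let mZ dE (F : measurableType dE) (h : F -> \bar R) : measurable_fun setT h ->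
  measurable [set x | h x = 0].
Proof.
move=> mh; rewrite (_ : [set x | _] = h @^-1` [set 0]); last by [].
by rewrite -[X in measurable X]setTI; exact: mh.
Qed.

Let aR1 : a [set x | R1 x = 0] = 0.
Proof.
rewrite -beta1; last exact: mZ.
apply: beta_null; first by rewrite -[X in measurable X]setTI; apply: measurable_fst => //; exact: mZ.
apply: integral0_eq => x _ /=.
have [x0|x0] := pselect (R1 x = 0).
  rewrite -x0; congr (b _); apply/seteqP; split => y; rewrite /xsection/= !inE/=; first by case.
  by move=> ?; split.
rewrite (_ : xsection _ x = set0) ?measure0//.
by apply/seteqP; split => y //; rewrite /xsection/= !inE/= => -[].
Qed.

Let bR2 : b [set y | R2 y = 0] = 0.
Proof.
rewrite -beta2; last exact: mZ.
have mA : measurable (snd @^-1` [set y | R2 y = 0] : set (E1 * E2)%type).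
  by rewrite -[X in measurable X]setTI; apply: measurable_snd => //; exact: mZ.
apply: beta_null => //; rewrite product_measure_ysection; last exact: measurableI.
apply: integral0_eq => y _ /=.
have [y0|y0] := pselect (R2 y = 0).
  rewrite -y0; congr (a _); apply/seteqP; split => x; rewrite /ysection/= !inE/=; first by case.
  by move=> ?; split.
rewrite (_ : ysection _ y = set0) ?measure0//.
by apply/seteqP; split => x //; rewrite /ysection/= !inE/= => -[].
Qed.

(** By Fubini's theorem, the mass of rectangles with both swapped corners in [P] is the integral of
    R1(u1) R2(u2) against [alpha]. Both factors are positive almost everywhere, so a null integral
    leaves no mass to [alpha]. *)
Lemma rectangle_null :
  (alpha \x (a \x b)) [set y : W * (E1 * E2) | (0 < r (u1 y.1, y.2.2))%R /\ (0 < r (y.2.1, u2 y.1))%R] = 0 ->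
  alpha setT = 0.
Proof.
move=> M0.
have mi : measurable_fun setT (fun w => R1 (u1 w) * R2 (u2 w)).
  by apply: emeasurable_funM; exact: measurableT_comp.
have I0 : \int[alpha]_w (R1 (u1 w) * R2 (u2 w)) = 0.
  rewrite -M0; apply: eq_integral => w _ /=.
  rewrite (_ : xsection _ w = ysection P (u2 w) `*` xsection P (u1 w)); last first.
    apply/seteqP; split => -[x y]; rewrite /xsection/ysection/P/= !inE/=; by case.
  rewrite muleC; symmetry; apply: product_measure1E; first exact: measurable_ysection.
  exact: measurable_xsection.
have ae0 : ae_eq alpha setT (fun w => R1 (u1 w) * R2 (u2 w)) (cst 0).
  apply/ae_eq_integral_abs => //; rewrite -[RHS]I0.
  by apply: eq_integral => w _; rewrite gee0_abs// mule_ge0.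
have h1 : {ae alpha, forall w, R1 (u1 w) <> 0}.
  exists (u1 @^-1` [set x | R1 x = 0]); split.
  - by rewrite -[X in measurable X]setTI; apply: mu1 => //; exact: mZ.
  - by apply/eqP; rewrite eq_le measure_ge0 andbT; apply: le_trans (alpha1 (mZ mR1)) _; rewrite aR1.
  - by move=> w /= /contrapT.
have h2 : {ae alpha, forall w, R2 (u2 w) <> 0}.
  exists (u2 @^-1` [set x | R2 x = 0]); split.
  - by rewrite -[X in measurable X]setTI; apply: mu2 => //; exact: mZ.
  - by apply/eqP; rewrite eq_le measure_ge0 andbT; apply: le_trans (alpha2 (mZ mR2)) _; rewrite bR2.
  - by move=> w /= /contrapT.
have [N [mN N0 hN]] : {ae alpha, forall w, False}.
  apply: filterS3 ae0 h1 h2 => w /(_ I) /eqP; rewrite mule_eq0 => /orP[/eqP h|/eqP h] //.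
by apply/eqP; rewrite eq_le measure_ge0 andbT -N0 le_measure ?inE// => w _; apply: hN.
Qed.

End rectangles.

Section quadruple_perturbation.
Context d d1 d2 (W : measurableType d) (E1 : measurableType d1) (E2 : measurableType d2)
  (R : realType).
Local Open Scope ereal_scope.
Variables (u1 : W -> E1) (u2 : W -> E2).
Hypotheses (mu1 : measurable_fun setT u1) (mu2 : measurable_fun setT u2).
Variable nu : probability W R.

Let e (w : W) : E1 * E2 := (u1 w, u2 w).

Let me : measurable_fun setT e. Proof. by apply/measurable_fun_pairP. Qed.

Definition joint_mfun : {mfun W >-> (E1 * E2)%type} :=
  HB.pack_for {mfun W >-> (E1 * E2)%type} e (isMeasurableFun.Build _ _ _ _ _ me).

Definition joint_law (mu : probability W R) : probability (E1 * E2)%type R :=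
  distribution mu joint_mfun.

Lemma ge0_integral_joint_law mu (psi : E1 * E2 -> \bar R) : measurable_fun setT psi ->
  (forall z, 0 <= psi z) ->
  \int[joint_law mu]_z psi z = \int[mu]_w psi (u1 w, u2 w).
Proof.
by move=> mpsi psi0; rewrite (@ge0_integral_distribution _ _ _ _ _ _ joint_mfun psi).
Qed.

Variables (a : probability E1 R) (b : probability E2 R).
Variable alpha : {finite_measure set W -> \bar R}.
Hypotheses (alpha1 : forall A, measurable A -> alpha (u1 @^-1` A) <= a A)
  (alpha2 : forall A, measurable A -> alpha (u2 @^-1` A) <= b A).
Variables (beta beta' : probability W R) (kap r r' : W -> R).
Hypotheses (ha : has_density alpha nu kap) (hb : has_density beta nu r)
  (hb' : has_density beta' nu r').

(** Weights depending on the endpoints alone lift masses on pairs back to paths, through [beta] and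
    [beta']. The added and the removed corners have the same abscissas and the same ordinates, hence
    the null marginals of [sigma]. *)
Lemma quadruple_perturbation (B B' : set (E1 * E2)) (c : R) (S : set (W * (E1 * E2))%type) :
  (0 <= c)%R -> measurable B -> measurable B' -> measurable S ->
  (forall A, measurable A -> (a \x b) (A `&` B) <= c%:E * joint_law beta A) ->
  (forall A, measurable A -> (a \x b) (A `&` B') <= c%:E * joint_law beta' A) ->
  (forall y, S y -> [/\ B (u1 y.1, y.2.2), B (y.2.1, u2 y.1) & B' y.2]) ->
  exists (s : W -> R) (k2 k3 k4 : E1 * E2 -> R),
  [/\ [/\ measurable_fun setT s, measurable_fun setT k2, measurable_fun setT k3
        & measurable_fun setT k4],
      [/\ forall w, (0 <= s w <= 1)%R, forall z, (0 <= k2 z <= c)%R, forall z, (0 <= k3 z <= c)%R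
        & forall z, (0 <= k4 z <= c)%R],
      forall psi : W -> \bar R, measurable_fun setT psi -> (forall x, 0 <= psi x) ->
        \int[(alpha \x (a \x b))]_y (psi y.1 * (\1_S y)%:E) = \int[alpha]_w (psi w * (s w)%:E),
      forall phi : E1 * E2 -> \bar R, measurable_fun setT phi -> (forall x, 0 <= phi x) ->
      [/\ \int[(alpha \x (a \x b))]_y (phi (u1 y.1, y.2.2) * (\1_S y)%:E) =
            \int[joint_law beta]_z (phi z * (k2 z)%:E),
          \int[(alpha \x (a \x b))]_y (phi (y.2.1, u2 y.1) * (\1_S y)%:E) =
            \int[joint_law beta]_z (phi z * (k3 z)%:E)
        & \int[(alpha \x (a \x b))]_y (phi y.2 * (\1_S y)%:E) =
            \int[joint_law beta']_z (phi z * (k4 z)%:E)]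
    & let sigma w := (s w * kap w + k4 (u1 w, u2 w) * r' w
                      - (k2 (u1 w, u2 w) + k3 (u1 w, u2 w)) * r w)%R in
      [/\ measurable_fun setT sigma,
          forall A, measurable A -> \int[nu]_(w in u1 @^-1` A) (sigma w)%:E = 0
        & forall A, measurable A -> \int[nu]_(w in u2 @^-1` A) (sigma w)%:E = 0]].
Proof.
move=> c0 mB mB' mS hB hB' SB.
have [s [k2 [k3 [k4 [[ms mk2 mk3 mk4] [s01 k20 k30 k40] sE kE]]]]] :=
  @quadruple _ _ _ _ _ _ _ _ _ mu1 mu2 a b alpha alpha1 alpha2 (joint_law beta) (joint_law beta')
    B B' c S c0 mB mB' mS hB hB' SB.
exists s, k2, k3, k4; split => // sigma.
have [mkap kap0 _] := ha; have [mr r0 _] := hb; have [mr' r'0 _] := hb'.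
have mke (k : E1 * E2 -> R) : measurable_fun setT k -> measurable_fun setT (fun w => k (u1 w, u2 w)).
  by move=> mk; exact: (measurableT_comp mk me).
have mk23 : measurable_fun setT (fun w => (k2 (u1 w, u2 w) + k3 (u1 w, u2 w))%R).
  by apply: measurable_funD; exact: mke.
have msig : measurable_fun setT sigma.
  apply: measurable_funB; last exact: measurable_funM.
  apply: measurable_funD; apply: measurable_funM => //; exact: mke.
have bound (k : W -> R) (C : R) (dens : W -> R) : measurable_fun setT k -> (forall w, 0 <= k w <= C)%R ->
    measurable_fun setT dens -> (forall w, 0 <= dens w)%R -> \int[nu]_w (dens w)%:E < +oo ->
    nu.-integrable setT (fun w => (k w * dens w)%:E).
  move=> mk kC md d0 dfin.
  have idens : nu.-integrable setT (EFin \o dens).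
    apply/integrableP; split; first exact/measurable_EFinP.
    by under eq_integral do rewrite gee0_abs ?lee_fin//.
  apply: (@le_integrable _ _ _ _ _ measurableT _ (fun w => C%:E * (EFin \o dens) w)).
  - by apply/measurable_EFinP; exact: measurable_funM.
  - move=> w _; have /andP[kw0 kwC] := kC w.
    rewrite /= lee_fin !ger0_norm ?mulr_ge0 ?(le_trans kw0 kwC)//.
    by rewrite ler_wpM2r.
  - exact: integrableZl.
have kapfin : \int[nu]_w (kap w)%:E < +oo.
  by have [_ _ h] := ha; rewrite -h//; rewrite ltey_eq fin_num_measure.
have rfin : \int[nu]_w (r w)%:E < +oo by rewrite (has_density_int hb) ltry.
have r'fin : \int[nu]_w (r' w)%:E < +oo by rewrite (has_density_int hb') ltry.
have law_nu (mu : probability W R) (rr : W -> R) (k : E1 * E2 -> R) (phi : E1 * E2 -> R) :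
    has_density mu nu rr -> measurable_fun setT k -> (forall z, 0 <= k z)%R ->
    measurable_fun setT phi -> (forall z, 0 <= phi z)%R ->
    \int[joint_law mu]_z ((phi z)%:E * (k z)%:E) =
    \int[nu]_w (phi (u1 w, u2 w) * k (u1 w, u2 w) * rr w)%:E.
  move=> hmu mk kk0 mphi phi0.
  have mpk : measurable_fun setT (fun z => (phi z * k z)%:E).
    by apply/measurable_EFinP; exact: measurable_funM.
  transitivity (\int[joint_law mu]_z (phi z * k z)%:E); first by apply: eq_integral => z _; rewrite EFinM.
  rewrite ge0_integral_joint_law//; last by move=> z; rewrite lee_fin mulr_ge0.
  rewrite (ge0_integral_density hmu)//; last 2 first.
  - exact: (measurableT_comp mpk me).
  - by move=> w; rewrite lee_fin mulr_ge0.
(* Tested against a function of the endpoints, [sigma] integrates to added corners minus removed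
   corners under the measure of rectangles; the last hypothesis says that the two sums agree. *)
have zero (phi : E1 * E2 -> R) (D : set W) : measurable_fun setT phi -> (forall z, 0 <= phi z <= 1)%R ->
    measurable D -> (forall w, \1_D w = phi (u1 w, u2 w)) ->
    (\int[(alpha \x (a \x b))]_y ((phi (u1 y.1, u2 y.1))%:E * (\1_S y)%:E) +
     \int[(alpha \x (a \x b))]_y ((phi y.2)%:E * (\1_S y)%:E) =
     \int[(alpha \x (a \x b))]_y ((phi (u1 y.1, y.2.2))%:E * (\1_S y)%:E) +
     \int[(alpha \x (a \x b))]_y ((phi (y.2.1, u2 y.1))%:E * (\1_S y)%:E)) ->
    \int[nu]_(w in D) (sigma w)%:E = 0.
  move=> mphi phi01 mD D1.
  have phi0 z : (0 <= phi z)%R by have /andP[] := phi01 z.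
  have mEphi : measurable_fun setT (EFin \o phi) by exact/measurable_EFinP.
  have [->  -> ->] := kE (EFin \o phi) mEphi phi0.
  have -> : \int[(alpha \x (a \x b))]_y ((phi (u1 y.1, u2 y.1))%:E * (\1_S y)%:E) =
      \int[nu]_w (phi (u1 w, u2 w) * s w * kap w)%:E.
    rewrite (sE (fun w => (phi (u1 w, u2 w))%:E))//; last 2 first.
    - exact: (measurableT_comp mEphi me).
    - by move=> w; rewrite lee_fin.
    transitivity (\int[alpha]_w (phi (u1 w, u2 w) * s w)%:E).
      by apply: eq_integral => w _; rewrite EFinM.
    rewrite (ge0_integral_density ha)//.
    - by apply/measurable_EFinP; apply: measurable_funM => //; exact: mke.
    - by move=> w; rewrite lee_fin mulr_ge0//; have /andP[] := s01 w.
  have g0 (k : E1 * E2 -> R) : (forall z, 0 <= k z <= c)%R -> forall z, (0 <= k z)%R.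
    by move=> h z; have /andP[] := h z.
  rewrite (law_nu _ _ _ _ hb mk2 (g0 _ k20) mphi phi0) (law_nu _ _ _ _ hb mk3 (g0 _ k30) mphi phi0).
  rewrite (law_nu _ _ _ _ hb' mk4 (g0 _ k40) mphi phi0) => H.
  have pk01 (k : E1 * E2 -> R) : (forall z, 0 <= k z <= c)%R ->
      forall w, (0 <= phi (u1 w, u2 w) * k (u1 w, u2 w) <= c)%R.
    move=> h w; have /andP[h1 h2] := h (u1 w, u2 w); have /andP[p0 p1] := phi01 (u1 w, u2 w).
    by rewrite mulr_ge0//= -[leRHS]mul1r ler_pM.
  have mpk (k : E1 * E2 -> R) : measurable_fun setT k ->
      measurable_fun setT (fun w => (phi (u1 w, u2 w) * k (u1 w, u2 w))%R).
    by move=> mk; apply: measurable_funM; exact: mke.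
  have i1 := bound _ 1%R _ (_ : measurable_fun setT (fun w => (phi (u1 w, u2 w) * s w)%R)) _ mkap kap0 kapfin.
  have {}i1 : nu.-integrable setT (fun w => (phi (u1 w, u2 w) * s w * kap w)%:E).
    apply: i1; first by apply: measurable_funM => //; exact: mke.
    move=> w; have /andP[h1 h2] := s01 w; have /andP[p0 p1] := phi01 (u1 w, u2 w).
    by rewrite mulr_ge0//= -[leRHS]mul1r ler_pM.
  have i4 := bound _ c _ (mpk _ mk4) (pk01 _ k40) mr' r'0 r'fin.
  have i2 := bound _ c _ (mpk _ mk2) (pk01 _ k20) mr r0 rfin.
  have i3 := bound _ c _ (mpk _ mk3) (pk01 _ k30) mr r0 rfin.
  rewrite integral_mkcond.
  transitivity (\int[nu]_w (((phi (u1 w, u2 w) * s w * kap w)%:E +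
      (phi (u1 w, u2 w) * k4 (u1 w, u2 w) * r' w)%:E) -
     ((phi (u1 w, u2 w) * k2 (u1 w, u2 w) * r w)%:E + (phi (u1 w, u2 w) * k3 (u1 w, u2 w) * r w)%:E))).
    apply: eq_integral => w _; rewrite patchE -!EFinD.
    have := D1 w; rewrite indicE; case: (w \in D) => /= <-; congr EFin; last by rewrite !mul0r !addr0 subr0.
    by rewrite /sigma !mul1r mulrDl.
  have i14 := integrableD measurableT i1 i4; have i23 := integrableD measurableT i2 i3.
  rewrite (integralB measurableT i14 i23) (integralD measurableT i1 i4) (integralD measurableT i2 i3) H subee//.
  by rewrite fin_numD; apply/andP; split; apply: integrable_fin_num.
split => // A mA.
- apply: (zero (fun z => \1_A z.1)).
  + exact: (measurableT_comp (measurable_indic mA) measurable_fst).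
  + by move=> z; rewrite indicE; case: (_ \in _); rewrite ?lexx ?ler01.
  + by rewrite -[X in measurable X]setTI; exact: mu1.
  + by move=> w; rewrite !indicE; congr (_ %:R); apply/idP/idP; rewrite !inE.
  + by rewrite /=; congr (_ + _).
- apply: (zero (fun z => \1_A z.2)).
  + exact: (measurableT_comp (measurable_indic mA) measurable_snd).
  + by move=> z; rewrite indicE; case: (_ \in _); rewrite ?lexx ?ler01.
  + by rewrite -[X in measurable X]setTI; exact: mu2.
  + by move=> w; rewrite !indicE; congr (_ %:R); apply/idP/idP; rewrite !inE.
  + by rewrite /= addeC.
Qed.

End quadruple_perturbation.

Section perturbation_bounds.
Context (R : realType) (N x k2 k3 k4 q : R).
Hypotheses (k20 : 0 <= k2 <= N) (k30 : 0 <= k3 <= N) (k40 : 0 <= k4 <= N) (q0 : 0 <= q).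

(** The factor 1 in [k4 * 1] is the density of [nu] with respect to itself, [nu] being the source of
    the fourth corner. The bounds have the shape expected by [perturbation]. *)
Lemma perturbation_bounds : 0 <= x <= 1 ->
  - ((1 + 2 * N) * q) <= x + k4 * 1 - (k2 + k3) * q <= (1 + 2 * N) * (1 + q).
Proof.
move=> /andP[x0 x1]; have /andP[a2 b2] := k20; have /andP[a3 b3] := k30.
have /andP[a4 b4] := k40.
have h2 : 0 <= (k2 + k3) * q by rewrite mulr_ge0// addr_ge0.
have h3 : (k2 + k3) * q <= (2 * N) * q by apply: ler_wpM2r => //; lra.
have N0 : 0 <= N by lra.
have h4 : 0 <= 2 * N * q by rewrite !mulr_ge0.
have -> : (1 + 2 * N) * q = q + 2 * N * q by ring.
have -> : (1 + 2 * N) * (1 + q) = 1 + 2 * N + q + 2 * N * q by ring.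
move: ((k2 + k3) * q) (2 * N * q) h2 h3 h4 => v u h2 h3 h4.
have q00 := q0; clear k20 k30 k40; rewrite mulr1; apply/andP; split.
  by rewrite lerBrDr; apply: (@le_trans _ _ 0); lra.
by lra.
Qed.

(** Meant for points where the perturbed density is 0: for small [eta] the removed mass eta (k2 +
    k3) q is at most [q], so the added mass must vanish. *)
Lemma perturbation_vanish (eta : R) : 0 < eta -> eta * (1 + 2 * N) <= 1 -> 0 <= x ->
  q + eta * (x + k4 * 1 - (k2 + k3) * q) = 0 -> x = 0.
Proof.
move=> eta0 etaK x0; have /andP[a2 b2] := k20; have /andP[a3 b3] := k30.
have /andP[a4 b4] := k40.
have h1 : 0 <= eta * x by rewrite mulr_ge0// ltW.
have h2 : 0 <= eta * k4 by rewrite mulr_ge0// ltW.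
have h3 : eta * (k2 + k3) <= 1.
  by apply: le_trans etaK; apply: ler_wpM2l; [exact: ltW|lra].
have h4 : eta * (k2 + k3) * q <= q by rewrite -[leRHS]mul1r ler_wpM2r.
move=> H; have h5 : eta * x = 0 by lra.
by move/eqP: h5; rewrite mulf_eq0 gt_eqF//= => /eqP.
Qed.

End perturbation_bounds.

Lemma perturbation_norm_bound (R : realType) (N x k2 k3 k4 q : R) : 0 <= x <= 1 ->
  0 <= k2 <= N -> 0 <= k3 <= N -> 0 <= k4 <= N -> 0 <= q ->
  `|x * q + k4 * q - (k2 + k3) * q| <= (1 + 2 * N) * q.
Proof.
move=> /andP[x0 x1] /andP[a2 b2] /andP[a3 b3] /andP[a4 b4] q0.
rewrite -mulrDl -mulrBl normrM (ger0_norm q0) ler_wpM2r// ler_norml.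
by apply/andP; split; lra.
Qed.

(** * Conditional means given the endpoints *)

Section conditional_mean.
Context d d1 d2 (W : measurableType d) (E1 : measurableType d1) (E2 : measurableType d2)
  (R : realType).
Local Open Scope ereal_scope.
Variables (u1 : W -> E1) (u2 : W -> E2).
Hypotheses (mu1 : measurable_fun setT u1) (mu2 : measurable_fun setT u2).
Variable P : probability W R.

Let e (w : W) : E1 * E2 := (u1 w, u2 w).

Let me : measurable_fun setT e. Proof. by apply/measurable_fun_pairP. Qed.

(** The conditional expectation given the endpoints is obtained as a Radon-Nikodym derivative: that
    of the image of F P with respect to the image of P. *)
Lemma ge0_joint_conditional_mean (F : W -> R) : measurable_fun setT F ->
  (forall w, 0 <= F w)%R -> \int[P]_w (F w)%:E < +oo ->
  exists phi : E1 * E2 -> R, [/\ measurable_fun setT phi, forall z, (0 <= phi z)%R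
    & forall k : E1 * E2 -> \bar R, measurable_fun setT k -> (forall z, 0 <= k z) ->
      \int[P]_w (k (u1 w, u2 w) * (F w)%:E) = \int[joint_law mu1 mu2 P]_z (k z * (phi z)%:E)].
Proof.
move=> mF F0 Ffin.
have [rho hrho] := finite_measure_density mF F0 Ffin.
pose q0 : {measure set (E1 * E2)%type -> \bar R} :=
  measure_function_pushforward__canonical__measure_function_Measure rho me.
have q0f : fin_num_fun q0.
  move=> A mA; have -> : q0 A = rho (e @^-1` A) by [].
  by rewrite fin_num_measure//; rewrite -[X in measurable X]setTI; exact: me.
pose q : {finite_measure set (E1 * E2)%type -> \bar R} := as_finite_measure q0f.
have dom : q `<< joint_law mu1 mu2 P.
  apply/null_content_dominatesP => A mA A0.
  have -> : q A = rho (e @^-1` A) by [].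
  move/has_density_dominates/null_content_dominatesP: (hrho); apply => //.
  by rewrite -[X in measurable X]setTI; exact: me.
have [phi hphi] := has_density_exists dom.
have [mphi phi0 _] := hphi.
exists phi; split => // k mk k0.
rewrite -(ge0_integral_density hphi)//.
rewrite -(ge0_integral_density hrho)//; last exact: measurableT_comp mk me.
transitivity (\int[q0]_z k z); last by [].
symmetry; exact: (@ge0_integral_pushforward _ _ _ _ _ e me rho setT k).
Qed.

Lemma joint_conditional_mean (F : W -> R) : P.-integrable setT (EFin \o F) ->
  exists phi : E1 * E2 -> R, (joint_law mu1 mu2 P).-integrable setT (EFin \o phi) /\
    forall (k : E1 * E2 -> R) (c : R), measurable_fun setT k -> (forall z, 0 <= k z <= c)%R ->
      (\int[P]_w (F w * k (u1 w, u2 w)) = \int[joint_law mu1 mu2 P]_z (phi z * k z))%R.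
Proof.
move=> iF.
have mF : measurable_fun setT F by apply/measurable_EFinP; exact: (measurable_int P).
have [_ Ffin] := integrableP _ _ _ iF.
pose Fp w := Num.max (F w) 0%R; pose Fn w := Num.max (- F w)%R 0%R.
have mFp : measurable_fun setT Fp by apply: measurable_maxr.
have mFn : measurable_fun setT Fn by apply: measurable_maxr => //; exact: measurable_funN.
have Fp0 w : (0 <= Fp w)%R by rewrite le_max lexx orbT.
have Fn0 w : (0 <= Fn w)%R by rewrite le_max lexx orbT.
have FE w : F w = (Fp w - Fn w)%R.
  by rewrite /Fp /Fn; case: (leP (F w) 0%R) => h;
    [rewrite max_l ?oppr_ge0// sub0r opprK|rewrite max_r ?subr0// oppr_le0 ltW].
have Fpl w : (Fp w <= `|F w|)%R by rewrite ge_max ler_norm normr_ge0.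
have Fnl w : (Fn w <= `|F w|)%R by rewrite ge_max -normrN ler_norm normr_ge0.
have fin (G : W -> R) : measurable_fun setT G -> (forall w, 0 <= G w)%R -> (forall w, G w <= `|F w|)%R ->
    \int[P]_w (G w)%:E < +oo.
  move=> mG G0 GF; apply: le_lt_trans Ffin; apply: ge0_le_integral => //.
  - by move=> w _; rewrite lee_fin.
  - exact/measurable_EFinP.
  - by apply: measurableT_comp => //; exact/measurable_EFinP.
  - by move=> w _; rewrite lee_fin.
have fp := fin _ mFp Fp0 Fpl; have fn := fin _ mFn Fn0 Fnl.
have [p [mp p0 pE]] := ge0_joint_conditional_mean mFp Fp0 fp.
have [n [mn n0 nE]] := ge0_joint_conditional_mean mFn Fn0 fn.
have E1' (G : W -> R) (h : E1 * E2 -> R) (k : E1 * E2 -> R) (c : R) :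
    (forall k : E1 * E2 -> \bar R, measurable_fun setT k -> (forall z, 0 <= k z) ->
      \int[P]_w (k (u1 w, u2 w) * (G w)%:E) = \int[joint_law mu1 mu2 P]_z (k z * (h z)%:E)) ->
    measurable_fun setT G -> (forall w, 0 <= G w)%R -> \int[P]_w (G w)%:E < +oo ->
    measurable_fun setT h -> (forall z, 0 <= h z)%R ->
    measurable_fun setT k -> (forall z, 0 <= k z <= c)%R ->
    [/\ P.-integrable setT (fun w => (G w * k (u1 w, u2 w))%:E),
     (joint_law mu1 mu2 P).-integrable setT (fun z => (h z * k z)%:E)
     & (\int[P]_w (G w * k (u1 w, u2 w)) = \int[joint_law mu1 mu2 P]_z (h z * k z))%R].
  move=> H mG G0 Gf mh h0 mk kc.
  have k0 z : (0 <= k z)%R by have /andP[] := kc z.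
  have mk' : measurable_fun setT (EFin \o k) by exact/measurable_EFinP.
  have H1 : \int[P]_w (G w * k (u1 w, u2 w))%:E = \int[joint_law mu1 mu2 P]_z (h z * k z)%:E.
    have := H (EFin \o k) mk' k0 => H'.
    transitivity (\int[P]_w ((k (u1 w, u2 w))%:E * (G w)%:E)).
      by apply: eq_integral => w _; rewrite EFinM muleC.
    by rewrite H'; apply: eq_integral => w _; rewrite EFinM muleC.
  have mke : measurable_fun setT (fun w => k (u1 w, u2 w)) by exact: measurableT_comp mk me.
  have i1 : P.-integrable setT (fun w => (G w * k (u1 w, u2 w))%:E).
    apply: (@le_integrable _ _ _ _ _ measurableT _ (fun w => c%:E * (EFin \o G) w)).
    - by apply/measurable_EFinP; exact: measurable_funM.
    - move=> w _; have /andP[h1 h2] := kc (u1 w, u2 w).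
      rewrite /= lee_fin !ger0_norm ?mulr_ge0 ?(le_trans h1 h2)//.
      by rewrite mulrC ler_wpM2r.
    - apply: integrableZl => //; apply/integrableP; split; first exact/measurable_EFinP.
      by under eq_integral do rewrite gee0_abs ?lee_fin//.
  split => //; last by rewrite /Rintegral H1.
  apply/integrableP; split; first by apply/measurable_EFinP; exact: measurable_funM.
  under eq_integral do rewrite gee0_abs ?lee_fin ?mulr_ge0//.
  rewrite -H1; have [_] := integrableP _ _ _ i1; apply: le_lt_trans.
  rewrite le_eqVlt; apply/orP; left; apply/eqP; apply: eq_integral => w _.
  by rewrite gee0_abs// lee_fin mulr_ge0.
exists (fun z => p z - n z)%R; split.
  have k1 : forall z : E1 * E2, (0 <= (1%R : R) <= 1)%R by move=> z; rewrite ler01 lexx.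
  have mk1 : measurable_fun setT (fun _ : E1 * E2 => 1%R : R) by exact: measurable_cst.
  have [_ ip _] := E1' _ _ _ _ pE mFp Fp0 fp mp p0 mk1 k1.
  have [_ in_ _] := E1' _ _ _ _ nE mFn Fn0 fn mn n0 mk1 k1.
  have := integrableB measurableT ip in_; apply: eq_integrable => // z _.
  by rewrite /= !mulr1 EFinB.
move=> k c mk kc.
have [ip jp Ep] := E1' _ _ _ _ pE mFp Fp0 fp mp p0 mk kc.
have [in_ jn En] := E1' _ _ _ _ nE mFn Fn0 fn mn n0 mk kc.
transitivity (\int[P]_w (Fp w * k (u1 w, u2 w) - Fn w * k (u1 w, u2 w)))%R.
  by apply: eq_Rintegral => w _; rewrite FE mulrBl.
rewrite RintegralB// Ep En -RintegralB//.
by apply: eq_Rintegral => z _; rewrite mulrBl.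
Qed.

End conditional_mean.

Section null_sets.
Context d (Y : measurableType d) (R : realType).
Local Open Scope ereal_scope.

(** The hypothesis is tested on the part of [A] where [F] is positive, then on the part where it is
    negative. *)
Lemma integral_indic_null (M : {measure set Y -> \bar R}) (F : Y -> R) (A : set Y) :
  measurable_fun setT F -> measurable A ->
  (forall S, measurable S -> S `<=` A -> M.-integrable setT (fun y => (F y * \1_S y)%:E) /\
    (\int[M]_y (F y * \1_S y) = 0)%R) ->
  M (A `&` [set y | F y != 0%R]) = 0.
Proof.
move=> mF mA H.
have pos (G : Y -> R) : measurable_fun setT G ->
  (forall S, measurable S -> S `<=` A -> M.-integrable setT (fun y => (G y * \1_S y)%:E) /\
    (\int[M]_y (G y * \1_S y) = 0)%R) -> M (A `&` [set y | (0 < G y)%R]) = 0.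
  move=> mG HG; set S := A `&` _.
  have mS : measurable S by apply: measurableI => //; exact: measurable_pos_level.
  have SA : S `<=` A by move=> y [].
  have [iS S0] := HG _ mS SA.
  have G0 y : (0 <= G y * \1_S y)%R.
    rewrite indicE; case: (boolP (y \in S)); last by rewrite mulr0.
    by rewrite inE => -[_ /= h]; rewrite mulr1 ltW.
  have I0 : \int[M]_y `|(G y * \1_S y)%:E| = 0.
    transitivity (\int[M]_y (G y * \1_S y)%:E).
      by apply: eq_integral => y _; rewrite gee0_abs ?lee_fin.
    by rewrite -[LHS]fineK ?(integrable_fin_num _ iS)//; congr EFin.
  have /(ae_eq_integral_abs M measurableT)/iffLR : measurable_fun setT (fun y => (G y * \1_S y)%:E).
    exact: (measurable_int M iS).
  move=> /(_ I0) [N [mN N0 hN]].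
  apply: measure_negligible => //; exists N; split => // y Sy; apply: hN => /= /(_ I)/eqP.
  rewrite eqe indicE mem_set// mulr1 => /eqP h; move: Sy => -[_ /=]; by rewrite h ltxx.
have Hp := pos _ mF H.
have Hn : M (A `&` [set y | (0 < - F y)%R]) = 0.
  apply: pos => [|S mS SA]; first exact: measurable_funN.
  have [iS S0] := H _ mS SA; split.
    have := integrableN iS; apply: eq_integrable => // y _.
    by rewrite /= mulNr.
  have := RintegralZl (-1)%R measurableT iS; rewrite S0 mulr0 => <-.
  by apply: eq_Rintegral => y _; rewrite mulN1r mulNr.
have mP (G : Y -> R) : measurable_fun setT G -> measurable (A `&` [set y | (0 < G y)%R]).
  by move=> mG; apply: measurableI => //; exact: measurable_pos_level.
have mNF : measurable_fun setT (fun y => - F y)%R by exact: measurable_funN.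
apply: measure_negligible.
  apply: measurableI => //; rewrite (_ : [set y | _] = ~` (F @^-1` [set 0%R])).
    by apply: measurableC; rewrite -[X in measurable X]setTI; exact: mF.
  by apply/seteqP; split => y /= /eqP.
apply: (@negligibleS _ _ _ _ ((A `&` [set y | (0 < F y)%R]) `|` (A `&` [set y | (0 < - F y)%R]))).
  move=> y [Ay /= h]; have [Fy|Fy] := ltP 0%R (F y); first by left.
  by right; split => //=; rewrite oppr_gt0 lt_neqAle h.
apply: negligibleU; [exists (A `&` [set y | (0 < F y)%R])|exists (A `&` [set y | (0 < - F y)%R])].
  by split => //; exact: mP.
by split => //; exact: mP.
Qed.

Lemma probability_ae_ex (P : probability Y R) (Q : Y -> Prop) : {ae P, forall y, Q y} -> exists y, Q y.
Proof.
move=> [N [mN N0 hN]]; apply: contrapT => h.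
have : P setT <= P N.
  by apply: le_measure; rewrite ?inE// => y _; apply: hN => Qy; apply: h; exists y.
by rewrite N0 (@probability_setT _ _ _ P) leNgt lte01.
Qed.

End null_sets.

(** * Separation and representation of functionals of time *)

Section minimal_sublinear.
Context (R : realType) (X : Type).
Implicit Types (f g : X -> R) (P p q L : (X -> R) -> R) (a : R).

(** All bounded functions, continuous or not: the linear functional obtained by Zorn's lemma is
    later evaluated at indicators of [0, t]. *)
Definition bdd_fun f := exists M, forall x, `|f x| <= M.

Lemma bdd_funD f g : bdd_fun f -> bdd_fun g -> bdd_fun (f \+ g).
Proof.
move=> [M hM] [N hN]; exists (M + N) => x.
by apply: le_trans (ler_normD _ _) _; exact: lerD.
Qed.

Lemma bdd_funZ a f : bdd_fun f -> bdd_fun (fun x => a * f x).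
Proof. by move=> [M hM]; exists (`|a| * M) => x; rewrite normrM ler_wpM2l. Qed.

Definition sublinear p :=
  (forall f g, bdd_fun f -> bdd_fun g -> p (f \+ g) <= p f + p g) /\
  (forall a f, 0 <= a -> bdd_fun f -> p (fun x => a * f x) <= a * p f).

Let z : X -> R := fun=> 0.

Let bz : bdd_fun z. Proof. by exists 0 => x; rewrite normr0. Qed.

Let sublinear0 p : sublinear p -> p z = 0.
Proof.
move=> [pD pZ]; apply/eqP; rewrite eq_le; apply/andP; split.
  have := pZ 0 z (lexx _) bz; rewrite mul0r (_ : (fun x => _) = z)//.
  by apply/funext => x; rewrite mul0r.
have := pD z z bz bz; rewrite (_ : z \+ z = z); first by lra.
by apply/funext => x /=; rewrite addr0.
Qed.

Let sublinearZ p : sublinear p -> forall a f, 0 <= a -> bdd_fun f ->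
  p (fun x => a * f x) = a * p f.
Proof.
move=> sp a f a0 bf; have [pD pZ] := sp.
have [->|an0] := eqVneq a 0.
  rewrite mul0r (_ : (fun x => _) = z) ?sublinear0//.
  by apply/funext => x; rewrite mul0r.
have ap : 0 < a by rewrite lt_neqAle eq_sym an0.
apply/eqP; rewrite eq_le pZ//=.
have := pZ a^-1 _ _ (bdd_funZ a bf); rewrite invr_ge0 => /(_ a0).
rewrite (_ : (fun x => a^-1 * _) = f); last by apply/funext => x; rewrite mulKf.
by rewrite mulrC ler_pdivlMr// mulrC.
Qed.

Let sublinearN p f : sublinear p -> bdd_fun f -> - p (fun x => - f x) <= p f.
Proof.
move=> sp bf; have [pD _] := sp.
have bNf : bdd_fun (fun x => - f x) by move: bf => [M hM]; exists M => x; rewrite normrN.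
have := pD _ _ bf bNf; rewrite (_ : f \+ _ = z); last by apply/funext => x /=; rewrite subrr.
by rewrite sublinear0//; lra.
Qed.

(** Zorn's lemma downwards. Everything below [P] is bounded below by -P(-f), so the pointwise
    infimum of a chain is finite; comparability of any two members makes it subadditive. *)
Lemma exists_minimal_sublinear P : sublinear P -> exists p,
  [/\ sublinear p, forall f, bdd_fun f -> p f <= P f
    & forall q, sublinear q -> (forall f, bdd_fun f -> q f <= p f) ->
        forall f, bdd_fun f -> p f <= q f].
Proof.
move=> sP.
pose S := {p | sublinear p /\ forall f, bdd_fun f -> p f <= P f}.
pose r (p q : S) := `[< forall f, bdd_fun f -> sval q f <= sval p f >].
have t0 : S by exists P; split.
have [| |A tA|[p [sp pP]] pmax] := @ZL_preorder S t0 r.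
- by move=> p; apply/asboolP.
- move=> q p s /asboolP pq /asboolP qs; apply/asboolP => f bf.
  exact: le_trans (qs _ bf) (pq _ bf).
- have [[p0 Ap0]|A0] := pselect (exists q : S, A q); last first.
    by exists t0 => s As; exfalso; apply: A0; exists s.
  pose V f := [set sval p f | p in A].
  have V0 f : V f !=set0 by exists (sval p0 f); exists p0.
  have lbV f : bdd_fun f -> has_lbound (V f).
    move=> bf; exists (- P (fun x => - f x)) => _ [[p [sp pP]] Ap <-] /=.
    have bNf : bdd_fun (fun x => - f x) by move: bf => [M hM]; exists M => x; rewrite normrN.
    by apply: le_trans (sublinearN sp bf); rewrite lerN2 pP.
  have infV (p : S) f : A p -> bdd_fun f -> inf (V f) <= sval p f.
    by move=> Ap bf; apply: ge_inf; [exact: lbV|exists p].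
  have si : sublinear (fun f => inf (V f)).
    split=> [f g bf bg|a f a0 bf].
      rewrite -lerBlDr; apply: lb_le_inf => // _ [p1 Ap1 <-].
      rewrite lerBlDr addrC -lerBlDr; apply: lb_le_inf => // _ [p2 Ap2 <-].
      rewrite lerBlDr addrC.
      have bfg := bdd_funD bf bg.
      have [/asboolP h|/asboolP h] := tA _ _ Ap1 Ap2.
        apply: le_trans (infV _ _ Ap2 bfg) _.
        apply: le_trans ((svalP p2).1.1 _ _ bf bg) _; rewrite lerD2r; exact: h.
      apply: le_trans (infV _ _ Ap1 bfg) _.
      apply: le_trans ((svalP p1).1.1 _ _ bf bg) _; rewrite lerD2l; exact: h.
    have [->|an0] := eqVneq a 0.
      rewrite mul0r; apply: le_trans (infV p0 _ Ap0 (bdd_funZ 0 bf)) _.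
      by rewrite (sublinearZ (svalP p0).1)// mul0r.
    have ap : 0 < a by rewrite lt_neqAle eq_sym an0.
    rewrite mulrC -ler_pdivrMr//; apply: lb_le_inf => // _ [p1 Ap1 <-].
    rewrite ler_pdivrMr// mulrC; apply: le_trans (infV p1 _ Ap1 (bdd_funZ a bf)) _.
    exact: (svalP p1).1.2.
  have iP f : bdd_fun f -> inf (V f) <= P f.
    by move=> bf; apply: le_trans (infV _ _ Ap0 bf) _; exact: (svalP p0).2.
  exists (exist _ (fun f => inf (V f)) (conj si iP)) => s As.
  by apply/asboolP => f bf /=; exact: infV.
exists p; split => // q sq qp f bf.
have qP : forall f, bdd_fun f -> q f <= P f by move=> g bg; exact: le_trans (qp _ bg) (pP _ bg).
have := pmax (exist _ q (conj sq qP)) _ => /(_ _)/asboolP; apply => //.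
by apply/asboolP.
Qed.

Lemma sublinear_dominates_linear P : sublinear P -> exists L,
  [/\ forall f g, bdd_fun f -> bdd_fun g -> L (f \+ g) = L f + L g,
      forall a f, bdd_fun f -> L (fun x => a * f x) = a * L f
    & forall f, bdd_fun f -> L f <= P f].
Proof.
move=> /exists_minimal_sublinear[p [sp pP pmin]].
have [pD pZ] := sp.
have pDE f g : bdd_fun f -> bdd_fun g -> p (f \+ g) = p f + p g.
  move=> bf bg; apply/eqP; rewrite eq_le pD//=.
  have bgt (t : R) : bdd_fun (fun x => t * g x) by exact: bdd_funZ.
  (* For fixed [g], the infimum over t >= 0 of p(h + t g) - t p(g) is again sublinear and below [p];
     by minimality it is not smaller, and t = 1 gives superadditivity. *)
  pose V h := [set p (h \+ (fun x => t * g x)) - t * p g | t in [set t | 0 <= t]].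
  have V0 h : V h !=set0 by exists (p (h \+ (fun x => 0 * g x)) - 0 * p g); exists 0 => //=.
  have lbV h : bdd_fun h -> lbound (V h) (- p (fun x => - h x)).
    move=> bh _ [t /= t0 <-].
    have bNh : bdd_fun (fun x => - h x) by move: bh => [M hM]; exists M => x; rewrite normrN.
    rewrite -(sublinearZ sp)// lerBrDl -lerBrDr opprK.
    apply: le_trans (_ : p ((h \+ (fun x => t * g x)) \+ (fun x => - h x)) <= _).
      rewrite le_eqVlt; apply/orP; left; apply/eqP; congr p.
      by apply/funext => x /=; rewrite addrAC subrr add0r.
    by apply: pD => //; exact: bdd_funD.
  have infV h t : bdd_fun h -> 0 <= t -> inf (V h) <= p (h \+ (fun x => t * g x)) - t * p g.
    by move=> bh t0; apply: ge_inf; [exists (- p (fun x => - h x)); exact: lbV|exists t].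
  have si : sublinear (fun h => inf (V h)).
    split=> [h k bh bk|a h a0 bh].
      rewrite -lerBlDr; apply: lb_le_inf => // _ [t /= t0 <-].
      rewrite lerBlDr addrC -lerBlDr; apply: lb_le_inf => // _ [s /= s0 <-].
      rewrite lerBlDr addrC.
      apply: le_trans (infV _ (t + s) (bdd_funD bh bk) (addr_ge0 t0 s0)) _.
      have := pD _ _ (bdd_funD bh (bgt t)) (bdd_funD bk (bgt s)).
      rewrite (_ : (h \+ _) \+ _ = (h \+ k) \+ (fun x => (t + s) * g x)); first by lra.
      by apply/funext => x /=; ring.
    have [->|an0] := eqVneq a 0.
      rewrite mul0r; apply: le_trans (infV _ 0 (bdd_funZ 0 bh) (lexx _)) _.
      rewrite mul0r subr0 (_ : _ \+ _ = z) ?sublinear0//.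
      by apply/funext => x /=; rewrite !mul0r addr0.
    have ap : 0 < a by rewrite lt_neqAle eq_sym an0.
    rewrite mulrC -ler_pdivrMr//; apply: lb_le_inf => // _ [t /= t0 <-].
    rewrite ler_pdivrMr// mulrC.
    apply: le_trans (infV _ (a * t) (bdd_funZ a bh) (mulr_ge0 a0 t0)) _.
    rewrite mulrBr mulrA lerD2r -(sublinearZ sp)//; last exact: bdd_funD.
    rewrite le_eqVlt; apply/orP; left; apply/eqP; congr p.
    by apply/funext => x /=; ring.
  have ip h : bdd_fun h -> inf (V h) <= p h.
    move=> bh; apply: le_trans (infV _ 0 bh (lexx _)) _.
    rewrite mul0r subr0 (_ : _ \+ _ = h)//.
    by apply/funext => x /=; rewrite mul0r addr0.
  have := pmin _ si ip _ bf; have := infV _ 1 bf ler01.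
  rewrite mul1r (_ : f \+ (fun x => 1 * g x) = f \+ g); first by lra.
  by apply/funext => x /=; rewrite mul1r.
exists p; split => // a f bf.
have [a0|a0] := leP 0 a; first exact: sublinearZ.
have := pDE _ _ (bdd_funZ a bf) (bdd_funZ (- a) bf).
rewrite (_ : _ \+ _ = z); last by apply/funext => x /=; rewrite mulNr subrr.
rewrite (sublinear0 sp) (sublinearZ sp (a := - a))//; first by lra.
by rewrite oppr_ge0 ltW.
Qed.

(* The cost [C * s] of relaxing the constraint [psi <= 0] to [psi <= s] makes the
   sublinear functional below finite. *)
Lemma cone_separation (K : set ((X -> R) * R)) (C : R) : 0 <= C ->
  (forall c, K c -> bdd_fun c.1) ->
  K (fun=> 0, 0) ->
  (forall c1 c2, K c1 -> K c2 -> K (c1.1 \+ c2.1, c1.2 + c2.2)) ->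
  (forall a c, 0 <= a -> K c -> K ((fun x => a * c.1 x), a * c.2)) ->
  (forall c s, K c -> 0 <= s -> (forall x, c.1 x <= s) -> 0 <= c.2 + C * s) ->
  exists L, [/\ forall f g, bdd_fun f -> bdd_fun g -> L (f \+ g) = L f + L g,
      forall a f, bdd_fun f -> L (fun x => a * f x) = a * L f,
      forall f s, bdd_fun f -> 0 <= s -> (forall x, f x <= s) -> L f <= C * s
    & forall c, K c -> 0 <= c.2 + L c.1].
Proof.
move=> C0 Kb K0 KD KZ Ks.
pose V f := [set v | exists c s, [/\ K c, 0 <= s, forall x, c.1 x + f x <= s & v = c.2 + C * s]].
have V0 f : bdd_fun f -> V f !=set0.
  move=> [M hM]; exists (0 + C * `|M|); exists (fun=> 0, 0), `|M|; split => // x /=.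
  by rewrite add0r (le_trans (ler_norm _))// (le_trans (hM x))// ler_norm.
have lbV f : bdd_fun f -> has_lbound (V f).
  move=> [M hM]; exists (- (C * `|M|)) => _ [c [s [Kc s0 cs ->]]].
  have /Ks-/(_ (s + `|M|)) : K c by [].
  have -> : 0 <= s + `|M| by rewrite addr_ge0.
  move=> /(_ isT) h; have {h} : 0 <= c.2 + C * (s + `|M|).
    apply: h => x; have := cs x; have := hM x; rewrite ler_norml => /andP[h1 _] h2.
    have := ler_norm M; lra.
  rewrite mulrDr; lra.
have infV f c s : bdd_fun f -> K c -> 0 <= s -> (forall x, c.1 x + f x <= s) ->
    inf (V f) <= c.2 + C * s.
  by move=> bf Kc s0 cs; apply: ge_inf; [exact: lbV|exists c, s].
have sV : sublinear (fun f => inf (V f)).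
  split=> [f g bf bg|a f a0 bf].
    rewrite -lerBlDr; apply: lb_le_inf; first exact: V0.
    move=> _ [c1 [s1 [K1 s10 h1 ->]]].
    rewrite lerBlDr addrC -lerBlDr; apply: lb_le_inf; first exact: V0.
    move=> _ [c2 [s2 [K2 s20 h2 ->]]].
    rewrite lerBlDr.
    apply: le_trans (infV _ _ (s1 + s2) (bdd_funD bf bg) (KD _ _ K1 K2) (addr_ge0 s10 s20) _) _.
      by move=> x /=; have := h1 x; have := h2 x; lra.
    by rewrite /= mulrDr; lra.
  have [->|an0] := eqVneq a 0.
    rewrite mul0r.
    apply: le_trans (infV _ (fun=> 0, 0) 0 (bdd_funZ 0 bf) K0 (lexx _) _) _ => [x /=|/=].
      by rewrite mul0r addr0.
    by rewrite mulr0 addr0.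
  have ap : 0 < a by rewrite lt_neqAle eq_sym an0.
  rewrite mulrC -ler_pdivrMr//; apply: lb_le_inf; first exact: V0.
  move=> _ [c [s [Kc s0 h ->]]].
  rewrite ler_pdivrMr// mulrC.
  apply: le_trans (infV _ _ (a * s) (bdd_funZ a bf) (KZ _ _ a0 Kc) (mulr_ge0 a0 s0) _) _.
    by move=> x /=; rewrite -mulrDr ler_wpM2l.
  by rewrite /=; lra.
have [L [LD LZ LP]] := sublinear_dominates_linear sV.
exists L; split => // [f s bf s0 fs|c Kc].
  apply: le_trans (LP _ bf) _.
  apply: le_trans (infV _ (fun=> 0, 0) s bf K0 s0 _) _ => [x /=|/=]; by rewrite add0r.
have bc := Kb _ Kc.
have bNc : bdd_fun (fun x => -1 * c.1 x) by exact: bdd_funZ.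
have := LP _ bNc; rewrite LZ// mulN1r.
have := infV _ c 0 bNc Kc (lexx _); rewrite mulr0 addr0.
have h : forall x, c.1 x + -1 * c.1 x <= 0 by move=> x; rewrite mulN1r subrr.
by move=> /(_ h); lra.
Qed.

End minimal_sublinear.

(** * Positive functionals of time as measures *)

Section positive_functional.
Context (R : realType) (U : Type).

(** The domain is a parameter because the notion serves twice: for a functional of bounded functions
    of time and for the Lebesgue integral of bounded measurable functions. *)
Definition positive_linear (D : set (U -> R)) (L : (U -> R) -> R) :=
  [/\ D (fun=> 1), forall a f g, D f -> D g -> D (fun x => a * f x + g x),
      forall a f g, D f -> D g -> L (fun x => a * f x + g x) = a * L f + L g
    & forall f, D f -> (forall x, 0 <= f x) -> 0 <= L f].

Variables (D : set (U -> R)) (L : (U -> R) -> R).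
Hypothesis DL : positive_linear D L.

Lemma positive_linear0 : D (fun=> 0) /\ L (fun=> 0) = 0.
Proof.
have [D1 DD LD _] := DL.
have E : (fun=> 0) = (fun x : U => -1 * 1 + 1) :> (U -> R).
  by apply/funext => x; rewrite mulN1r addNr.
split; rewrite E; first exact: (DD (-1) (fun=> 1)).
by rewrite (LD (-1) (fun=> 1) (fun=> 1))//; lra.
Qed.

Lemma positive_linear_sum n (c : nat -> R) (E : nat -> U -> R) : (forall i, D (E i)) ->
  D (fun x => \sum_(i < n) c i * E i x) /\
  L (fun x => \sum_(i < n) c i * E i x) = \sum_(i < n) c i * L (E i).
Proof.
have [D1 DD LD _] := DL; have [D0 L0] := positive_linear0.
move=> DE; elim: n => [|n [IHD IHL]].
  rewrite big_ord0 (_ : (fun x => _) = fun=> 0)//.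
  by apply/funext => x; rewrite big_ord0.
have -> : (fun x => \sum_(i < n.+1) c i * E i x) =
          (fun x => c n * E n x + \sum_(i < n) c i * E i x).
  by apply/funext => x; rewrite big_ord_recr/= addrC.
by split; [exact: DD|rewrite LD// IHL big_ord_recr/= addrC].
Qed.

Lemma positive_linear_dist f g e : D f -> D g -> (forall x, `|f x - g x| <= e) ->
  `|L f - L g| <= e * L (fun=> 1).
Proof.
have [D1 DD LD Lp] := DL; have [D0 L0] := positive_linear0.
move=> Df Dg fge.
have De : D (fun=> e).
  rewrite (_ : (fun=> e) = fun x => e * 1 + 0); first exact: DD.
  by apply/funext => x; rewrite mulr1 addr0.
have Le : L (fun=> e) = e * L (fun=> 1).
  rewrite (_ : (fun=> e) = fun x => e * 1 + 0); first by rewrite (LD e (fun=> 1))// L0 addr0.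
  by apply/funext => x; rewrite mulr1 addr0.
have H u v : D u -> D v -> (forall x, v x <= u x + e) -> L v - L u <= e * L (fun=> 1).
  move=> Du Dv vu.
  have Due : D (fun x => 1 * u x + e) by exact: DD.
  have := Lp (fun x => -1 * v x + (1 * u x + e)) (DD _ _ _ Dv Due).
  rewrite LD// LD// Le.
  have h : forall x, 0 <= -1 * v x + (1 * u x + e) by move=> x; have := vu x; lra.
  by move=> /(_ h); lra.
rewrite ler_norml; apply/andP; split.
  rewrite lerNl opprB; apply: H => // x; have := fge x; rewrite ler_norml; lra.
by apply: H => // x; have := fge x; rewrite ler_norml; lra.
Qed.

End positive_functional.

(** Abel summation: [b] switches once from false to true, at [k], and the remaining differences
    telescope to [c k] thanks to the terminal value 0. *)
Lemma step_sum (R : realType) n (b : nat -> bool) : b n ->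
  (forall i, (i < n)%N -> b i -> b i.+1) ->
  exists2 k, (k <= n)%N & [/\ b k, (0 < k)%N -> ~~ b k.-1 & forall c : nat -> R, c n.+1 = 0 ->
    \sum_(i < n.+1) (c i - c i.+1) * (b i)%:R = c k].
Proof.
move=> bn bS.
have ex : exists k, b k by exists n.
case: (ex_minnP ex) => k bk kmin.
have kn : (k <= n)%N by exact: kmin.
have bge i : (k <= i <= n)%N -> b i.
  elim: i => [|i IH] /andP[ki iN]; first by move: ki; rewrite leqn0 => /eqP <-.
  move: ki; rewrite leq_eqVlt => /predU1P[<-//|ki].
  by apply: bS => //; apply: IH; rewrite -ltnS ki ltnW.
exists k => //; split => // [k0|c cn].
  by apply/negP => /kmin; rewrite leqNgt prednK// leqnn.
rewrite -(big_mkord xpredT (fun i => (c i - c i.+1) * (b i)%:R)).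
rewrite (big_cat_nat (n := k))//=; last exact: leqW.
rewrite big_nat big1 ?add0r; last first.
  move=> i /andP[_ ik]; have /negbTE -> : ~~ b i by apply/negP => /kmin; rewrite leqNgt ik.
  by rewrite mulr0.
rewrite big_nat (eq_bigr (fun i => (- c i.+1) - (- c i))); last first.
  by move=> i /andP[ki iN]; rewrite bge ?ki// mulr1 opprK addrC.
rewrite -big_nat telescope_sumr; last exact: leqW.
by rewrite cn oppr0 sub0r opprK.
Qed.

Section riesz.
Context (R : realType) (T : {posnum R}).

Fact clamp_subproof (x : R) : Num.max 0 (Num.min T%:num x) \in `[0, T%:num]%classic.
Proof. by rewrite inE /= in_itv /= le_max lexx/= ge_max ge_min lexx ge0. Qed.

(** Retraction of the line onto [0, T], through which functions of time become functions of a real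
    variable. *)
Definition clamp (x : R) : time T := SigSub (clamp_subproof x).

Lemma time_itv (t : time T) : 0 <= \val t <= T%:num.
Proof. by have := set_valP t; rewrite /= in_itv. Qed.

Lemma clamp_val (x : R) : 0 <= x <= T%:num -> \val (clamp x) = x.
Proof. by move=> /andP[x0 xT] /=; rewrite min_r// max_r. Qed.

Lemma val_clamp (t : time T) : clamp (\val t) = t.
Proof. by apply: val_inj; rewrite clamp_val// time_itv. Qed.

Lemma clamp_continuous : continuous clamp.
Proof.
apply: (@continuous_comp_initial (time T) R R \val clamp) => x.
apply: (@continuous_max _ _ (fun=> 0) (fun x => Num.min T%:num x)); first exact: cvg_cst.
by apply: (@continuous_min _ _ (fun=> T%:num) id); [exact: cvg_cst|exact: cvg_id].
Qed.

Lemma measurable_clamp : measurable_fun setT (clamp : R -> borel (time T)).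
Proof.
apply: (@measurability _ _ R (borel (time T)) setT clamp (@open (time T))) => //.
move=> _ [B oB <-]; rewrite setTI; apply: open_measurable.
by move/continuousP: clamp_continuous; exact.
Qed.

Lemma time_unif_continuous (f : time T -> R) : continuous f -> forall e, 0 < e ->
  exists2 n : nat, (0 < n)%N & forall s t : time T, `|\val s - \val t| < n%:R^-1 -> `|f s - f t| < e.
Proof.
move=> cf e e0.
have cF : continuous (f \o clamp).
  move=> x; apply: continuous_comp; [exact: clamp_continuous|exact: cf].
have /compact_near_coveringP cpt := @segment_compact R 0 T%:num.
have : \forall n \near \oo, `[0, T%:num]%classic `<=` (fun x => forall y,
    `|x - y| < n.+1%:R^-1 -> `|f (clamp x) - f (clamp y)| < e).
  apply: (cpt nat \oo (fun n x => forall y, `|x - y| < n.+1%:R^-1 ->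
    `|f (clamp x) - f (clamp y)| < e)) => x _.
  have e20 : 0 < e / 2 by rewrite divr_gt0.
  have /cvgrPdist_lt/(_ _ e20) := cF x.
  rewrite -filter_from_ballE => -[dl /= dl0 hdl].
  have dl20 : 0 < dl / 2 by rewrite divr_gt0.
  exists ([set x' | `|x - x'| < dl / 2], [set n | n.+1%:R^-1 < dl / 2]) => /=.
    split; first by apply: (nbhsx_ballx x _ dl20).
    exact: (near_infty_natSinv_lt (PosNum dl20)).
  move=> [x' n] /= [xx' nd] y x'y.
  have h1 : `|f (clamp x) - f (clamp x')| < e / 2.
    by apply: hdl; rewrite /ball/=; lra.
  have h2 : `|f (clamp x) - f (clamp y)| < e / 2.
    apply: hdl; rewrite /ball/=; apply: le_lt_trans (ler_distD x' _ _) _.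
    by rewrite (splitr dl) ltrD// (lt_trans x'y).
  have := ler_distD (f (clamp x)) (f (clamp x')) (f (clamp y)).
  by rewrite (distrC (f (clamp x')) (f (clamp x))); lra.
move=> [N _ /(_ N (leqnn N)) hN]; exists N.+1 => // s t st.
have := hN (\val s) _ (\val t) st; rewrite !val_clamp; apply.
by rewrite /= in_itv/= time_itv.
Qed.

Lemma continuous_bdd_fun (f : time T -> R) : continuous f -> bdd_fun f.
Proof.
move=> cf; have [t1 h1] := time_EVT_max cf.
have cNf : continuous (fun t => - f t) by move=> t; apply: continuousN; exact: cf.
have [t2 h2] := time_EVT_max cNf.
exists (`|f t1| + `|f t2|) => t; rewrite ler_norml; have := h1 t; have := h2 t.
by have := ler_norm (f t1); have := ler_norm (- f t2); rewrite normrN;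
  have := normr_ge0 (f t1); have := normr_ge0 (f t2); lra.
Qed.

Variable L : (time T -> R) -> R.
Hypothesis hL : positive_linear (@bdd_fun R (time T)) L.

Let cdf_ind (t : time T) : time T -> R := fun s => (\val s <= \val t)%R%:R.

Let ind01 t s : 0 <= cdf_ind t s <= 1.
Proof. by rewrite /cdf_ind; case: (\val s <= \val t)%R => /=; rewrite ?lexx ?ler01. Qed.

Let bcdf t : bdd_fun (cdf_ind t).
Proof. by exists 1 => s; have /andP[? ?] := ind01 t s; rewrite ger0_norm. Qed.

Let G (t : time T) : R := L (cdf_ind t).

Let M : R := L (fun=> 1).

Let le_L f g : bdd_fun f -> bdd_fun g -> (forall t, f t <= g t) -> L f <= L g.
Proof.
have [D1 DD LD Lp] := hL; move=> bf bg fg.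
have := Lp (fun x => -1 * f x + g x) (DD _ _ _ bf bg); rewrite LD//.
have h x : 0 <= -1 * f x + g x by have := fg x; lra.
by move=> /(_ h); lra.
Qed.

Let b1 : bdd_fun (fun _ : time T => 1 : R). Proof. by have [] := hL. Qed.

Let M0 : 0 <= M. Proof. by have [D1 _ _ Lp] := hL; exact: Lp. Qed.

Let G0 t : 0 <= G t.
Proof. by have [_ _ _ Lp] := hL; apply: (Lp _ (bcdf t)) => s; have /andP[] := ind01 t s. Qed.

Let GM t : G t <= M.
Proof. by apply: (le_L (bcdf t) b1) => s; have /andP[] := ind01 t s. Qed.

Let leG s t : \val s <= \val t -> G s <= G t.
Proof.
move=> st; apply: (le_L (bcdf s) (bcdf t)) => u.
have [us|us] := boolP (\val u <= \val s); first by rewrite /cdf_ind us (le_trans us st).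
by rewrite {1}/cdf_ind (negbTE us); have /andP[] := ind01 t u.
Qed.

Let GT : G (clamp T%:num) = M.
Proof.
congr L; apply/funext => s; rewrite /cdf_ind clamp_val ?lexx ?andbT//.
by have /andP[_ ->] := time_itv s.
Qed.

Let V (u : R) := [set t : R | 0 <= t <= T%:num /\ (u <= G (clamp t) \/ t = T%:num)].

Let VT u : V u T%:num. Proof. by split; [rewrite lexx andbT|right]. Qed.

Let lbV u : lbound (V u) 0. Proof. by move=> t [/andP[]]. Qed.

Let qr (u : R) := inf (V u).

Let qr_le u t : V u t -> qr u <= t.
Proof. by move=> Vt; apply: ge_inf => //; exists 0; exact: lbV. Qed.

Let qr_ge u t : (forall s, V u s -> t <= s) -> t <= qr u.
Proof. by move=> h; apply: lb_le_inf; [exists T%:num|]. Qed.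

Let qr_nd : nondecreasing_fun qr.
Proof.
move=> u v uv; apply: qr_ge => s [s0 h]; apply: qr_le; split => //.
by case: h => [h|]; [left; exact: le_trans h|right].
Qed.

Let qr_itv u : 0 <= qr u <= T%:num.
Proof. by rewrite qr_le// andbT; apply: qr_ge => s [/andP[]]. Qed.

Let q u : borel (time T) := clamp (qr u).

Let mq : measurable_fun setT (q : measurableTypeR R -> borel (time T)).
Proof.
apply: (measurableT_comp measurable_clamp).
exact: nondecreasing_measurable.
Qed.

Let mI : measurable (`]0, M]%classic : set (measurableTypeR R)). Proof. exact: measurable_itv. Qed.

Let ell : {measure set (measurableTypeR R) -> \bar R} := mrestr (@lebesgue_measure R) mI.

Let ell_le g : 0 <= g <= M -> ell [set u | u <= g] = g%:E.
Proof.
move=> /andP[g0 gM]; rewrite /ell /= /mrestr.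
rewrite (_ : _ `&` _ = `]0, g]%classic); last first.
  apply/seteqP; split => u /=; rewrite !in_itv/=.
    by move=> [ug /andP[u0 _]]; rewrite u0.
  by move=> /andP[u0 ug]; rewrite u0 (le_trans ug gM).
rewrite lebesgue_measure_itv/= lte_fin; case: ltP => [_|g0']; first by rewrite sube0.
by congr EFin; apply/eqP; rewrite eq_le g0 g0'.
Qed.

Let ellT : ell setT = M%:E.
Proof.
have MM : 0 <= M <= M by rewrite lexx M0.
rewrite -(ell_le MM) /ell /= /mrestr; congr lebesgue_measure.
by apply/seteqP; split => u /=; rewrite !in_itv/= => -[_ /andP[-> ->]].
Qed.

Let ell_fin : (ell setT < +oo)%E. Proof. by rewrite ellT ltry. Qed.

Let D (h : R -> R) := measurable_fun setT h /\ bdd_fun h.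

Let Dint h : D h -> ell.-integrable setT (EFin \o h).
Proof.
move=> [mh [B hB]]; apply: measurable_bounded_integrable => //.
by exists B; split; [exact: num_real|move=> x Bx y _; apply: le_trans (hB y) (ltW Bx)].
Qed.

Let DL : positive_linear D (fun h => \int[ell]_u h u).
Proof.
split.
- by split; [exact: measurable_cst|exists 1 => x; rewrite normr1].
- move=> a f g [mf bf] [mg bg]; split; last exact: bdd_funD (bdd_funZ a bf) bg.
  by apply: measurable_funD => //; exact: measurable_funM.
- move=> a f g Df Dg; have Dif := Dint Df; have Dig := Dint Dg.
  rewrite RintegralD//=; last exact: (integrableZl measurableT a Dif).
  by rewrite (RintegralZl a measurableT Dif).
- by move=> f _ f0; apply: Rintegral_ge0.
Qed.

(* [q] is the quantile function of [G t = L (1_[0, t])]; the representing measure is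
   the image under [q] of the Lebesgue measure on ]0, L 1]. *)
Lemma riesz_time : exists lambda : {finite_measure set (borel (time T)) -> \bar R},
  forall f : time T -> R, continuous f -> \int[lambda]_t f t = L f.
Proof.
pose lam0 : {measure set (borel (time T)) -> \bar R} :=
  measure_function_pushforward__canonical__measure_function_Measure ell mq.
have lfin : fin_num_fun lam0.
  move=> A mA; rewrite ge0_fin_numE//; apply: le_lt_trans ell_fin.
  have -> : lam0 A = ell (q @^-1` A) by [].
  apply: (@le_measure _ _ _ ell (q @^-1` A) setT); rewrite ?inE//.
  by rewrite -[X in measurable X]setTI; exact: mq.
exists (as_finite_measure lfin) => f cf.
have mf : measurable_fun setT (f : borel (time T) -> R) by exact: continuous_borel_measurableR.
have bf := continuous_bdd_fun cf.
have Dfq : D (f \o q).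
  split; first exact: measurableT_comp mf mq.
  by have [B hB] := bf; exists B => u; exact: hB.
have -> : \int[as_finite_measure lfin]_t f t = \int[ell]_u f (q u).
  rewrite /Rintegral; congr fine.
  transitivity (\int[lam0]_t (f t)%:E)%E; first by [].
  have := @integral_pushforward _ _ (measurableTypeR R) (borel (time T)) R q mq ell setT (EFin \o f); rewrite preimage_setT; apply => //.
    exact/measurable_EFinP.
  exact: Dint.
suff H : forall e0 : R, 0 < e0 -> `|\int[ell]_u f (q u) - L f| <= e0.
  apply/eqP; rewrite -subr_eq0 -normr_eq0 eq_le normr_ge0 andbT; apply/ler_addgt0Pr => x x0.
  by rewrite add0r; exact: H.
move=> e0 e00.
(* Each of the two approximations by step functions costs at most e M, and 2 e M <= e0; M + 1 avoids
   a division by zero. *)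
pose e := e0 / (2 * (M + 1)).
have Mp : 0 < M + 1 by rewrite ltr_wpDl.
have M1 : 0 < 2 * (M + 1) by rewrite mulr_gt0.
have e_gt0 : 0 < e by rewrite divr_gt0.
have [N N0 hN] := time_unif_continuous cf e_gt0.
have NR : 0 < N%:R :> R by rewrite ltr0n.
have [n n0 nT] : exists2 n : nat, (0 < n)%N & T%:num / n%:R < N%:R^-1.
  pose n := (Num.truncn (T%:num * N%:R)).+1.
  exists n => //; rewrite ltr_pdivrMr ?ltr0n// mulrC -ltr_pdivrMr ?invr_gt0// invrK.
  exact: truncnS_gt.
have nR : 0 < n%:R :> R by rewrite ltr0n.
pose tau i := clamp (T%:num * i%:R / n%:R).
have tauE i : (i <= n)%N -> \val (tau i) = T%:num * i%:R / n%:R.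
  move=> ni; rewrite clamp_val// divr_ge0 ?mulr_ge0//= ler_pdivrMr//.
  by rewrite ler_wpM2l// ler_nat.
have tau_le i j : (i <= j <= n)%N -> \val (tau i) <= \val (tau j).
  move=> /andP[ij jn]; rewrite !tauE ?(leq_trans ij)//.
  apply: ler_wpM2r; first by rewrite invr_ge0 ltW.
  by apply: ler_wpM2l => //; rewrite ler_nat.
have tau0 : \val (tau 0%N) = 0 by rewrite tauE// mulr0 mul0r.
have taun : tau n = clamp T%:num by rewrite /tau mulfK ?gt_eqF.
have tauS k : (0 < k <= n)%N -> \val (tau k) - \val (tau k.-1) < N%:R^-1.
  case: k => // k /andP[_ kn]; rewrite -[k.+1.-1]/k (tauE _ kn) (tauE _ (ltnW kn)).
  rewrite -mulrBl -mulrBr -natrB// subSnn mulr1//.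
pose c i := if (i <= n)%N then f (tau i) else 0.
have cn : c n.+1 = 0 by rewrite /c ltnn.
(* Both functionals are compared with their common value on step functions. *)
pose phi := fun t : time T => \sum_(i < n.+1) (c i - c i.+1) * cdf_ind (tau i) t.
(* The clause [i == n] makes the last indicator constant, so that the comparison with [f (q u)] also
   holds for u > M, where q u = T. *)
pose psi_ i u : R := ((u <= G (tau i)) || (i == n))%:R.
pose psi := fun u : R => \sum_(i < n.+1) (c i - c i.+1) * psi_ i u.
(* Weak inequalities on both sides of [t] are all that can be expected: [G] need not be
   right-continuous, so the infimum defining [qr] need not be attained. *)
have close k (t : time T) : (k <= n)%N -> \val t <= \val (tau k) ->
    ((0 < k)%N -> \val (tau k.-1) <= \val t) -> `|c k - f t| <= e.
  move=> kn tk kt; rewrite /c kn; apply/ltW/hN.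
  have [/eqP k0|k0] := posnP k.
    have := time_itv t; move: tk; rewrite (eqP k0) tau0.
    by move=> ? /andP[? _]; rewrite (_ : \val t = 0) ?subrr ?normr0 ?invr_gt0//; lra.
  have := kt k0; have := tauS k; rewrite k0 kn => /(_ isT).
  rewrite ger0_norm; [lra|by rewrite subr_ge0].
have phif t : `|phi t - f t| <= e.
  have [||k kn [bk k0 hk]] := @step_sum R n (fun i => \val t <= \val (tau i)).
  - by rewrite taun clamp_val ?lexx ?andbT//; have /andP[] := time_itv t.
  - by move=> i ni h; apply: le_trans h (tau_le _ _ _); rewrite leqnSn.
  rewrite /phi (hk c cn); apply: close => // /k0.
  by rewrite -ltNge => /ltW.
have psif u : `|psi u - f (q u)| <= e.
  have [||k kn [bk k0 hk]] := @step_sum R n (fun i => (u <= G (tau i)) || (i == n)).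
  - by rewrite eqxx orbT.
  - move=> i ni /orP[h|/eqP h]; last by rewrite h ltnn in ni.
    by rewrite (le_trans h) ?leG ?tau_le ?leqnSn.
  rewrite /psi (hk c cn); apply: close => //; rewrite /q clamp_val ?qr_itv//.
    apply: qr_le; split; first exact: time_itv.
    case/orP: bk => [h|/eqP ->]; first by left; rewrite val_clamp.
    by right; rewrite taun clamp_val// lexx andbT.
  move=> /[dup] kp /k0; rewrite negb_or -ltNge => /andP[h _]; apply: qr_ge => s [s0 [us|->]].
    rewrite leNgt; apply/negP => sk; move: h; rewrite ltNge => /negP; apply.
    by apply: le_trans us (leG _); rewrite clamp_val// ltW.
  by have /andP[] := time_itv (tau k.-1).
have Dpsi i : D (psi_ i).
  split; last by exists 1 => u; rewrite /psi_; case: (_ || _); rewrite ?normr1 ?normr0.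
  rewrite /psi_; case: (i == n); last first.
    under eq_fun do rewrite orbF.
    rewrite (_ : (fun u => _) = \1_[set u : R | u <= G (tau i)]).
      apply: measurable_indic; rewrite (_ : [set u | _] = `]-oo, G (tau i)]%classic).
        exact: measurable_itv.
      by apply/seteqP; split => u /=; rewrite in_itv.
    apply/funext => u; rewrite indicE; case: (leP u (G (tau i))) => h.
      by rewrite mem_set.
    by rewrite memNset//= leNgt h.
  by under eq_fun do rewrite orbT; exact: measurable_cst.
have Ipsi i : \int[ell]_u psi_ i u = G (tau i).
  have [->|ni] := eqVneq i n.
    rewrite /psi_; under eq_Rintegral do rewrite eqxx orbT.
    by rewrite /Rintegral integral_cst//= ellT mul1e taun GT.
  rewrite /psi_ /Rintegral (_ : (fun u => _) = (fun u => (\1_[set u : R | u <= G (tau i)] u)%:E)).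
    rewrite integral_indic//; last first.
      rewrite (_ : [set u | _] = `]-oo, G (tau i)]%classic).
        exact: measurable_itv.
      by apply/seteqP; split => u /=; rewrite in_itv.
    by rewrite setIT ell_le// G0 GM.
  apply/funext => u; rewrite (negbTE ni) orbF indicE; case: (leP u (G (tau i))) => h.
    by rewrite mem_set.
  by rewrite memNset//= leNgt h.
have [_ Lphi] := positive_linear_sum hL n.+1 (fun i => c i - c i.+1) (fun i => bcdf (tau i)).
have [bphi _] := positive_linear_sum hL n.+1 (fun i => c i - c i.+1) (fun i => bcdf (tau i)).
have [Dps Lpsi] := positive_linear_sum DL n.+1 (fun i => c i - c i.+1) Dpsi.
have d1 := positive_linear_dist hL bphi bf phif.
have d2 := positive_linear_dist DL Dps Dfq psif.
have e1 : L phi = \int[ell]_u psi u.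
  by rewrite Lphi Lpsi; apply: eq_bigr => i _; rewrite Ipsi.
have E1 : \int[ell]_(u in setT) (fun=> 1) u = M.
  by rewrite /Rintegral integral_cst//= ellT mul1e.
move: d1 d2; rewrite -/M E1 -/phi -/psi e1 => d1 d2.
have eM : 2 * (e * M) <= e0.
  rewrite /e; have -> : 2 * (e0 / (2 * (M + 1)) * M) = e0 * (M / (M + 1)).
    by field; rewrite gt_eqF.
  by apply: ler_piMr; [exact: ltW|rewrite ler_pdivrMr// mul1r lerDl].
have := ler_distD (\int[ell]_u psi u) (\int[ell]_u f (q u)) (L f).
by rewrite (distrC _ (\int[ell]_u psi u)); lra.
Qed.

End riesz.

(** * Integration in time *)

Section time_integral.
Context (R : realType) (T : {posnum R}) (d : nat) (p : R).
Hypothesis hp : 1 <= p.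
Variable g : time T -> 'rV[R]_d -> R.
Hypothesis cg : continuous (fun z : time T * 'rV[R]_d => g z.1 z.2).
Variable D : R.
Hypothesis D0 : 0 <= D.
Hypothesis gD : forall x : 'rV[R]_d,
  (ereal_sup (range (fun t : time T => `|g t x|%:E)) <= (D * (1 + enorm x `^ p))%:E)%E.

Local Notation path := (borel (path_space T d)).

Let F (z : path * borel (time T)) : R := g z.2 (coord_at z.2 z.1).

Let stp (n : nat) (t : time T) : nat := Num.truncn (n.+1%:R * \val t).

Let cvg_stp (t : time T) : clamp T ((stp n t)%:R / n.+1%:R) @[n --> \oo] --> t.
Proof.
rewrite -[X in _ --> X](val_clamp t).
apply: continuous_cvg; first exact: clamp_continuous.
have FF : Filter (nbhs (\val t)) by exact: nbhs_filter.
apply/cvgrPdist_lt => e e0.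
have := near_infty_natSinv_lt (PosNum e0); apply: filterS => n /= ne.
apply: le_lt_trans ne.
have /andP[t0 _] := time_itv t.
have nt0 : 0 <= n.+1%:R * \val t by rewrite mulr_ge0.
have /andP[h1 h2] := truncn_itv nt0.
have n0 : 0 < n.+1%:R :> R by rewrite ltr0n.
rewrite -/(stp n t) in h1 h2.
have E : n.+1%:R^-1 * n.+1%:R = 1 :> R by rewrite mulVf// gt_eqF.
rewrite ger0_norm; last by rewrite subr_ge0 ler_pdivrMr// mulrC.
rewrite lerBlDr -[X in X + _]mul1r -mulrDl ler_pdivlMr//.
by rewrite mulrC addrC natr1; exact: ltW.
Qed.

(** A Caratheodory argument: with time frozen on slabs of length 1/(n+1) the functional depends
    measurably on the path, and continuity in time gives the limit. The sigma-algebra is the product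
    one, as Fubini's theorem requires. *)
Lemma measurable_joint_functional : measurable_fun setT F.
Proof.
pose Fn n (z : path * borel (time T)) : R :=
  g (clamp T ((stp n z.2)%:R / n.+1%:R)) (coord_at (clamp T ((stp n z.2)%:R / n.+1%:R)) z.1).
apply: (@measurable_fun_cvg _ _ R setT Fn) => [n|[w t] _]; last first.
  exact: (continuous_cvg _ (@path_functional_continuous R T d g cg w t) (@cvg_stp t)).
have mval : measurable_fun setT (\val : borel (time T) -> R).
  by apply: continuous_borel_measurableR; exact: initial_continuous.
pose E k : set (path * borel (time T))%type := [set z | stp n z.2 = k].
have mE k : measurable (E k).
  rewrite (_ : E k = setT `&` (fun z => n.+1%:R * \val z.2) @^-1` `[k%:R, k.+1%:R[%classic).
    have mz : measurable_fun setT (fun z : path * borel (time T) => n.+1%:R * \val z.2 : R).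
      by apply: measurable_funM => //; exact: (measurableT_comp mval measurable_snd).
    exact: mz.
  apply/seteqP; split => -[w t]; rewrite /E /stp /= in_itv/=.
    move=> <-; split => //; apply: truncn_itv; rewrite mulr_ge0//.
    by have /andP[] := time_itv t.
  by move=> [_ /truncn_def].
rewrite (_ : setT = \bigcup_k E k); last first.
  by apply/seteqP; split => // z _; exists (stp n z.2).
apply/measurable_fun_bigcup => // k.
apply: (@eq_measurable_fun _ _ _ _ _ (fun z : path * borel (time T) =>
  g (clamp T (k%:R / n.+1%:R)) (coord_at (clamp T (k%:R / n.+1%:R)) z.1))).
  by move=> z; rewrite inE /E/= /Fn => ->.
apply: measurable_funTS.
exact: (measurableT_comp (measurable_path_functional cg _) measurable_fst).
Qed.

Variable lambda : {finite_measure set (borel (time T)) -> \bar R}.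

Let lT := fine (lambda setT).

Let lTE : lambda setT = lT%:E. Proof. by rewrite fineK// fin_num_measure. Qed.

Definition time_integral (w : path_space T d) : R := \int[lambda]_t g t (coord_at t w).

Lemma integrable_time_functional (w : path_space T d) :
  lambda.-integrable setT (fun t => (g t (coord_at t w))%:E).
Proof.
apply: measurable_bounded_integrable => //.
- by rewrite ltey_eq fin_num_measure.
- by apply: continuous_borel_measurableR; exact: path_functional_continuous.
- exists (path_bound p D w); split; first exact: num_real.
  move=> x /ltW Bx t _; apply: le_trans Bx.
  exact: (path_functional_bound hp D0 gD).
Qed.

Let joint_int (mu : P_path T d p) : (mu \x lambda)%E.-integrable setT (EFin \o F).
Proof.
have mF : measurable_fun setT (EFin \o F) by apply/measurable_EFinP; exact: measurable_joint_functional.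
apply: (proj2 (@integrable12ltyP _ _ path (borel (time T)) R mu lambda (EFin \o F) mF)).
apply: (@le_lt_trans _ _ (\int[mu]_w ((path_bound p D w)%:E * lT%:E))%E).
  apply: ge0_le_integral => //.
  - by move=> w _; apply: integral_ge0.
  - apply: (measurable_fun_fubini_tonelli_F (abse \o (EFin \o F))) => //.
      exact: (measurableT_comp (@abse_measurable R setT) mF).
    by move=> z; exact: abse_ge0.
  - under eq_fun do rewrite -EFinM.
    by apply/measurable_EFinP; apply: measurable_funM => //; exact: measurable_path_bound.
  - move=> w _; rewrite -lTE -integral_cst//.
    apply: ge0_le_integral => //.
    + apply: measurableT_comp => //; apply: (measurable_int lambda); exact: integrable_time_functional.
    + by move=> t _ /=; rewrite lee_fin; exact: (path_functional_bound hp D0 gD).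
under eq_integral do rewrite -EFinM mulrC EFinM.
have ib := integrable_path_bound D mu.
rewrite integralZl//.
by rewrite ltey_eq fin_numM//; apply: integrable_fin_num.
Qed.

Lemma measurable_time_integral (mu : P_path T d p) : measurable_fun setT (time_integral : path -> R).
Proof.
exact: (measurableT_comp (@fine_measurable R setT measurableT) (measurable_fubini_F (joint_int mu))).
Qed.

Lemma time_integral_bound (w : path_space T d) : `|time_integral w| <= path_bound p D w * lT.
Proof.
apply: le_trans (le_normr_Rintegral _ (integrable_time_functional w)) _ => //.
have <- : \int[lambda]_(t in setT) path_bound p D w = path_bound p D w * lT.
  by rewrite Rintegral_cst.
apply: le_Rintegral => //.
- exact: (integrable_abse (integrable_time_functional w)).
- apply/integrableP; split; first exact: measurable_cst.
  by rewrite integral_cst// ltey_eq fin_numM// fin_num_measure.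
- by move=> t _; exact: (path_functional_bound hp D0 gD).
Qed.

Lemma integrable_time_integral (mu : P_path T d p) :
  mu.-integrable setT (fun w : path => (time_integral w)%:E).
Proof.
apply: (@le_integrable _ _ _ _ _ measurableT _ (fun w : path => (path_bound p D w * lT)%:E)) => //.
- by apply/measurable_EFinP; exact: (measurable_time_integral mu).
- move=> w _ /=; rewrite lee_fin; apply: le_trans (time_integral_bound w) _.
  exact: ler_norm.
- under eq_fun do rewrite mulrC EFinM.
  exact: (integrableZl measurableT lT (integrable_path_bound D mu)).
Qed.

Lemma integral_path_mean (mu : P_path T d p) :
  \int[lambda]_t path_mean g mu t = \int[mu]_w time_integral w.
Proof.
have iF := joint_int mu.
rewrite /Rintegral; congr fine.
transitivity (\int[lambda]_t \int[mu]_w (F (w, t))%:E)%E.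
  apply: eq_integral => t _; rewrite /path_mean /Rintegral fineK//.
  by apply: integrable_fin_num => //; exact: (integrable_path_functional hp cg D0 gD mu t).
rewrite -(Fubini iF); apply: eq_integral => w _; rewrite /time_integral /Rintegral fineK//.
by apply: integrable_fin_num => //; exact: integrable_time_functional.
Qed.

End time_integral.

(** * Multipliers and the Gibbs form *)

Section constrained_variations.
Context (R : realType) (T : {posnum R}) (d : nat) (p : R).
Hypothesis hp : 1 <= p.
Variable nu : P_path T d p.
Variable Psi : P_Rd d p -> R.
Hypothesis hPsi : lower_semicontinuous (EFin \o Psi).
Variables mu_ini mu_fin : P_Rd d p.
Variables (mubar : P_path T d p) (g : time T -> 'rV[R]_d -> R).
Hypothesis hmin : minimiser hp nu Psi mu_ini mu_fin mubar.
Hypothesis cPsi : continuous Psi.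
Hypothesis hlin : forall t : time T, is_linear_derivative Psi (marginal hp mubar t) (g t).
Hypothesis hunif : forall mu : P_path T d p,
  ereal_sup (range (fun t : time T =>
    `| (Psi (mix e (marginal hp mubar t) (marginal hp mu t))
          - Psi (marginal hp mubar t)) / e
       - (\int[marginal hp mu t]_x g t x
          - \int[marginal hp mubar t]_x g t x) |%:E))
    @[e --> 0^'+] --> 0%E.
Hypothesis cg : continuous (fun z : time T * 'rV[R]_d => g z.1 z.2).
Variable D : R.
Hypothesis D0 : 0 <= D.
Hypothesis gD : forall x : 'rV[R]_d,
  (ereal_sup (range (fun t : time T => `|g t x|%:E)) <= (D * (1 + enorm x `^ p))%:E)%E.
Implicit Types (mu : P_path T d p) (t : time T).

Local Notation path := (borel (path_space T d)).

Definition constraint t : R := Psi (marginal hp mubar t).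

Definition feasible mu : Prop :=
  [/\ (entropy mu nu < +oo)%E, marginal hp mu (time_ini T) ≡μ mu_ini
    & marginal hp mu (time_fin T) ≡μ mu_fin].

(** The constraint linearised at [mubar], strictly satisfied at some scale [e]. The constraint
    itself would not do, as [Psi] may be nonconvex. *)
Definition strictly_feasible mu : Prop :=
  exists2 e : R, 0 < e & forall t, constraint t + e * path_mean g mu t < 0.

Lemma constraint_le0 t : constraint t <= 0.
Proof. by have [[_ _ h] _ _] := hmin; exact: h. Qed.

Lemma constraint_continuous : continuous constraint.
Proof. exact: law_continuous. Qed.

Lemma path_mean_minimiser t : path_mean g mubar t = 0.
Proof. by rewrite -(marginal_mean hp cg D0 gD); have [] := hlin t. Qed.

Lemma minimiser_feasible : feasible mubar.
Proof. by have [[h1 h2 _] E vfin] := hmin; split => //; rewrite E ltey_eq vfin. Qed.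

(** Compactness of [0, T] gives a margin [c] at scale [e1]. For e <= e1, h + e G is a convex
    combination of h <= 0 and h + e1 G <= -c, and the remainder, at most e c / (2 e1) uniformly in
    time, is absorbed. *)
Lemma strictly_feasible_admissible mu : feasible mu -> strictly_feasible mu ->
  exists2 e0 : R, 0 < e0 <= 1 & forall e, 0 < e <= e0 ->
    admissible hp Psi mu_ini mu_fin (path_mix e mubar mu).
Proof.
move=> [_ i f] [e1 e10 h1].
have [[ib fb _] _ _] := hmin.
have [|c c0 hc] := @time_negative_bound R T (fun t => constraint t + e1 * path_mean g mu t) _ h1.
  move=> t; apply: continuousD; first exact: constraint_continuous.
  by apply: continuousM; [exact: cst_continuous|exact: (path_mean_continuous hp cg D0 gD)].
have c1 : 0 < c / (2 * e1) by rewrite divr_gt0// mulr_gt0.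
have nb : nbhs (0 : \bar R)%E [set x | (x < (c / (2 * e1))%:E)%E].
  apply: open_nbhs_nbhs; split; first exact: open_ereal_lt_ereal.
  by rewrite /= lte_fin.
have : \forall e \near 0^'+, (ereal_sup (range (fun t : time T =>
    `| (Psi (mix e (marginal hp mubar t) (marginal hp mu t)) - Psi (marginal hp mubar t)) / e
       - (\int[marginal hp mu t]_x g t x - \int[marginal hp mubar t]_x g t x) |%:E))
    < (c / (2 * e1))%:E)%E.
  exact: (hunif mu nb).
rewrite near_withinE => /nbhs_ballP[dl /= dl0 hdl].
pose e0 := Num.min 1 (Num.min e1 (dl / 2)).
have e00 : 0 < e0 by rewrite !lt_min ltr01 e10 divr_gt0.
exists e0; first by rewrite e00 /e0 ge_min lexx.
move=> e /andP[e_gt0 ee0].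
have [e_le1 ee1 edl] : [/\ e <= 1, e <= e1 & e < dl].
  move: ee0; rewrite !le_min => /and3P[? ? ?]; split => //; lra.
have e01 : 0 <= e <= 1 by rewrite ltW.
have H : (ereal_sup (range (fun t : time T =>
    `| (Psi (mix e (marginal hp mubar t) (marginal hp mu t)) - Psi (marginal hp mubar t)) / e
       - (\int[marginal hp mu t]_x g t x - \int[marginal hp mubar t]_x g t x) |%:E))
    < (c / (2 * e1))%:E)%E.
  by apply: hdl => //; rewrite /ball/= sub0r normrN gtr0_norm.
split; [exact: path_mix_marginal|exact: path_mix_marginal|move=> t].
rewrite (lsc_measure_eq (nu := mix e (marginal hp mubar t) (marginal hp mu t)) hp hPsi); last first.
  exact: marginal_path_mix.
have : (`| (Psi (mix e (marginal hp mubar t) (marginal hp mu t)) - Psi (marginal hp mubar t)) / e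
       - (\int[marginal hp mu t]_x g t x - \int[marginal hp mubar t]_x g t x) |%:E < (c / (2 * e1))%:E)%E.
  by apply: le_lt_trans H; apply: ereal_sup_ubound; exists t.
rewrite !(marginal_mean hp cg D0 gD) path_mean_minimiser subr0 lte_fin ltr_norml => /andP[_].
rewrite -/(constraint t) ltrBlDr ltr_pdivrMr// => h2.
have h3 := hc t; have h4 := constraint_le0 t.
have E : e * (c / (2 * e1)) = e / e1 * c / 2 by field; rewrite gt_eqF.
have r0 : 0 <= e / e1 by rewrite divr_ge0// ltW.
have r1 : e / e1 <= 1 by rewrite ler_pdivrMr// mul1r.
have E2 : e * path_mean g mu t = e / e1 * (e1 * path_mean g mu t) by field; rewrite gt_eqF.
have h5 := ler_wpM2l r0 h3.
have h6 : 0 <= (1 - e / e1) * - constraint t by rewrite mulr_ge0 ?subr_ge0// oppr_ge0.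
have h7 : 0 <= e / e1 * c by rewrite mulr_ge0// ltW.
move: h2; rewrite mulrDl (mulrC _ e) (mulrC _ e) E E2.
move: h5; rewrite mulrDr mulrN; lra.
Qed.

Variable f : path -> R.
Hypothesis hf : has_density mubar nu f.

Let mf : measurable_fun setT f. Proof. by have [] := hf. Qed.

Let f0 x : 0 <= f x. Proof. by have [_] := hf. Qed.

Let fin_f : (\int[nu]_x (theta (f x))%:E < +oo)%E.
Proof. by rewrite -(entropyE hf); have [] := minimiser_feasible. Qed.

Let fi := has_density_integrable hf.

Lemma strict_variation mu q : feasible mu -> strictly_feasible mu -> has_density mu nu q ->
  [/\ {ae nu, forall x, f x = 0 -> q x = 0},
      nu.-integrable setT (fun x => (ln (f x) * (q x - f x))%:E)
    & 0 <= \int[nu]_x (ln (f x) * (q x - f x))].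
Proof.
move=> fm sm hq; have [e0 /andP[e00 e01] adm] := strictly_feasible_admissible fm sm.
have [mq q0 _] := hq.
have Hq : (\int[nu]_x (theta (q x))%:E < +oo)%E by rewrite -(entropyE hq); have [] := fm.
have qi := has_density_integrable hq.
have fmin : forall e, 0 < e <= e0 ->
    (\int[nu]_x (theta (f x))%:E <= \int[nu]_x (theta ((1 - e) * f x + e * q x))%:E)%E.
  move=> e /[dup] ee /andP[e_gt0 ee0].
  have e1 : 0 <= e <= 1 by rewrite ltW//= (le_trans ee0).
  rewrite -(entropyE hf) -(entropyE (has_density_mixm e1 hf hq)).
  have [_ -> _] := hmin.
  by apply: ereal_inf_lbound; exists (path_mix e mubar mu) => //; exact: adm.
split.
- exact: (first_variation_support mf mq f0 q0 fi qi fin_f Hq e00 fmin).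
- exact: (first_variation_integrable mf mq f0 q0 fi qi fin_f Hq e00 fmin).
- exact: (first_variation_ge0 mf mq f0 q0 fi qi fin_f Hq e00 fmin).
Qed.

Lemma integrable_ln_minimiser : mubar.-integrable setT (fun x => (ln (f x))%:E).
Proof.
apply/(integrable_density hf); first exact: measurableT_comp (@measurable_ln R) mf.
exact: (integrable_ln_mul mf f0 fi fin_f).
Qed.

(** The first variation in terms of measures: among strictly feasible ones, [mubar] minimises the
    linear functional mu |-> int ln f dmu. *)
Lemma strict_energy mu : feasible mu -> strictly_feasible mu ->
  mu.-integrable setT (fun x => (ln (f x))%:E) /\
  \int[mubar]_x ln (f x) <= \int[mu]_x ln (f x).
Proof.
move=> fm sm; have [q hq _] := @entropy_density _ _ _ mu nu (let: And3 h _ _ := fm in h).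
have [_ h1 h2] := strict_variation fm sm hq.
have mln : measurable_fun setT (fun x => ln (f x)) by exact: measurableT_comp (@measurable_ln R) mf.
have ib := integrable_ln_minimiser.
have ibn := (integrable_density hf mln).1 ib.
have iq : nu.-integrable setT (fun x => (ln (f x) * q x)%:E).
  have := integrableD measurableT h1 ibn; apply: eq_integrable => // x _.
  by rewrite /= -EFinD; congr EFin; rewrite mulrBr subrK.
split; first exact/(integrable_density hq mln).
rewrite (Rintegral_density hf mln) (Rintegral_density hq mln) -subr_ge0 -RintegralB//.
by move: h2; congr (0 <= _); apply: eq_Rintegral => x _; rewrite mulrBr.
Qed.

Definition energy mu : R := \int[mu]_x ln (f x) - \int[mubar]_x ln (f x).

(** Integrability is demanded because it has been derived for strictly feasible measures, while the
    cone of [multiplier_exists] contains others. *)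
Definition finite_energy mu : Prop :=
  feasible mu /\ mu.-integrable setT (fun x => (ln (f x))%:E).

Let mln : measurable_fun setT (fun x => ln (f x)).
Proof. exact: measurableT_comp (@measurable_ln R) mf. Qed.

Lemma feasible_mix e mu1 mu2 : 0 <= e <= 1 -> feasible mu1 -> feasible mu2 ->
  feasible (path_mix e mu1 mu2).
Proof.
move=> e01 [H1 i1 f1] [H2 i2 f2]; split; try exact: path_mix_marginal.
have [q1 hq1 E1] := entropy_density H1; have [q2 hq2 E2] := entropy_density H2.
rewrite (entropyE (has_density_mixm e01 hq1 hq2)).
have [mq1 q10 _] := hq1; have [mq2 q20 _] := hq2; have /andP[e0 e1] := e01.
apply: (@le_lt_trans _ _ ((1 - e)%:E * (\int[nu]_x (theta (q1 x))%:E) +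
   e%:E * (\int[nu]_x (theta (q2 x))%:E))%E).
  have t1 x : (0 <= (theta (q1 x))%:E)%E by rewrite lee_fin theta_ge0.
  have t2 x : (0 <= (theta (q2 x))%:E)%E by rewrite lee_fin theta_ge0.
  have m1 := measurable_theta_comp mq1; have m2 := measurable_theta_comp mq2.
  have e1' : 0 <= 1 - e by rewrite subr_ge0.
  rewrite -!ge0_integralZl// -ge0_integralD//; last 4 first.
  - by move=> x _; rewrite mule_ge0.
  - exact: measurable_funeM.
  - by move=> x _; rewrite mule_ge0.
  - exact: measurable_funeM.
  apply: ge0_le_integral => //.
  - by move=> x _; rewrite lee_fin theta_ge0// addr_ge0// mulr_ge0.
  - by apply: measurable_theta_comp; apply: measurable_funD; exact: measurable_funM.
  - by apply: emeasurable_funD; exact: measurable_funeM.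
  - by move=> x _; rewrite -!EFinM -EFinD lee_fin; exact: theta_convex.
rewrite -E1 -E2 lte_add_pinfty// ltey_eq fin_numM// ge0_fin_numE//; exact: entropy_ge0.
Qed.

Lemma energy_mix e mu1 mu2 : 0 <= e <= 1 -> finite_energy mu1 -> finite_energy mu2 ->
  finite_energy (path_mix e mu1 mu2) /\
  energy (path_mix e mu1 mu2) = (1 - e) * energy mu1 + e * energy mu2.
Proof.
move=> e01 [fe1 i1] [fe2 i2].
have [q1 hq1 E1] := @entropy_density _ _ _ mu1 nu (let: And3 h _ _ := fe1 in h).
have [q2 hq2 E2] := @entropy_density _ _ _ mu2 nu (let: And3 h _ _ := fe2 in h).
have hm := has_density_mixm e01 hq1 hq2.
have n1 := (integrable_density hq1 mln).1 i1; have n2 := (integrable_density hq2 mln).1 i2.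
have z1 := integrableZl measurableT (1 - e) n1; have z2 := integrableZl measurableT e n2.
have nm : nu.-integrable setT (fun x => (ln (f x) * ((1 - e) * q1 x + e * q2 x))%:E).
  have := integrableD measurableT z1 z2; apply: eq_integrable => // x _.
  by rewrite /= -!EFinM -EFinD; congr EFin; ring.
split; first by split; [exact: feasible_mix|exact/(integrable_density hm mln)].
rewrite /energy (Rintegral_density hm mln) (Rintegral_density hq1 mln) (Rintegral_density hq2 mln).
have -> : \int[nu]_x (ln (f x) * ((1 - e) * q1 x + e * q2 x)) =
    (1 - e) * (\int[nu]_x (ln (f x) * q1 x)) + e * \int[nu]_x (ln (f x) * q2 x).
  rewrite -(RintegralZl (1 - e) measurableT n1) -(RintegralZl e measurableT n2) -RintegralD//.
  by apply: eq_Rintegral => x _; ring.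
by ring.
Qed.

Lemma finite_energy_minimiser : finite_energy mubar.
Proof. by split; [exact: minimiser_feasible|exact: integrable_ln_minimiser]. Qed.

Variables (mutilde : P_path T d p) (etilde : R).
Hypotheses (ft : feasible mutilde) (et0 : 0 < etilde).
Hypothesis slater : forall t, constraint t + etilde * path_mean g mutilde t < 0.

Lemma slater_energy : finite_energy mutilde /\ 0 <= energy mutilde.
Proof.
have sm : strictly_feasible mutilde by exists etilde.
by have [h1 h2] := strict_energy ft sm; split => //; rewrite subr_ge0.
Qed.

Let cG mu : continuous (path_mean g mu).
Proof. exact: (path_mean_continuous hp cg D0 gD). Qed.

Let comb (a e : R) mu t := a * constraint t + e * path_mean g mu t.

Let continuous_comb a e mu : continuous (comb a e mu).
Proof.
move=> t; apply: (@continuousD _ _ _ (fun t => a * constraint t) (fun t => e * path_mean g mu t)).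
  by apply: (@continuousM _ _ (fun=> a) constraint); [exact: cst_continuous|exact: constraint_continuous].
by apply: (@continuousM _ _ (fun=> e) (path_mean g mu)); [exact: cst_continuous|exact: cG].
Qed.

Lemma slater_margin : exists2 c : R, 0 < c &
  forall t, constraint t + etilde * path_mean g mutilde t <= - c.
Proof.
apply: (@time_negative_bound R T (fun t => constraint t + etilde * path_mean g mutilde t)) => // t.
have := @continuous_comb 1 etilde mutilde t; rewrite /comb.
by under eq_fun do rewrite mul1r.
Qed.

(** If a h + e G_mu <= s, adding s'/c times the Slater inequality with s' > s makes the combination
    negative; so a mixture of [mu] and [mutilde] is strictly feasible and has nonnegative energy.
    The share of [mutilde] in that energy is C s', which gives the value of [C]. *)
Lemma slater_penalty : exists2 C : R, 0 <= C & forall a e mu s, 0 <= a -> 0 <= e -> 0 <= s ->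
  finite_energy mu -> (forall t, comb a e mu t <= s) -> 0 <= e * energy mu + C * s.
Proof.
have [Kt Et] := slater_energy.
have [c c0 hc] := slater_margin.
pose C := etilde * energy mutilde / c.
have C0 : 0 <= C by rewrite divr_ge0 ?mulr_ge0// ltW.
exists C => // a e mu s a0 e0 s0 Km hs.
suff H : forall k : R, 0 < k -> 0 <= e * energy mu + C * (s + k).
  apply/ler_addgt0Pl => k k0.
  have k1 : 0 < k / (C + 1) by rewrite divr_gt0// ltr_wpDl.
  have h1 : C * (k / (C + 1)) <= k.
    rewrite mulrCA ler_piMr ?(ltW k0)// ler_pdivrMr ?mul1r ?lerDl//.
    by rewrite ltr_wpDl.
  by have := H _ k1; lra.
move=> k k0.
(* [k] > 0 leaves room for strict inequalities. [A] and [B] are the total weights of the constraint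
   and of the measures, and [w] is the proportion of [mutilde] in the mixture. *)
pose s' := s + k; have s'0 : 0 < s' by rewrite ltr_wpDl.
pose A := a + s' / c; pose B := e + s' * etilde / c.
have sc : 0 < s' / c by rewrite divr_gt0.
have sec : 0 < s' * etilde / c by rewrite divr_gt0// mulr_gt0.
have A0 : 0 < A by rewrite ltr_wpDl.
have B0 : 0 < B by rewrite ltr_wpDl.
pose w := s' * etilde / c / B.
have w01 : 0 <= w <= 1.
  by apply/andP; split; [rewrite divr_ge0// ltW|rewrite ler_pdivrMr// mul1r lerDr].
have Bw : B * w = s' * etilde / c by rewrite /w mulrC divfK// gt_eqF.
have B1w : B * (1 - w) = e by rewrite mulrBr Bw mulr1 /B addrK.
have [[fm im] Em] := energy_mix w01 Km Kt.
have sm : strictly_feasible (path_mix w mu mutilde).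
  exists (B / A) => [|t]; first by rewrite divr_gt0.
  rewrite -(pmulr_rlt0 _ A0) mulrDr mulrA (mulrC A (B / A)) divfK ?gt_eqF//.
  rewrite (path_mean_mix hp cg D0 gD)//.
  have -> : B * ((1 - w) * path_mean g mu t + w * path_mean g mutilde t) =
      B * (1 - w) * path_mean g mu t + B * w * path_mean g mutilde t by ring.
  rewrite B1w Bw.
  have h1 := hs t; rewrite /comb in h1.
  have h2 := ler_wpM2l (ltW sc) (hc t).
  have E1 : s' / c * - c = - s' by rewrite mulrN divfK// gt_eqF.
  rewrite E1 in h2; rewrite /A.
  have E2 : s' * etilde / c * path_mean g mutilde t = s' / c * (etilde * path_mean g mutilde t).
    by field; rewrite gt_eqF.
  rewrite E2; move: h2; rewrite mulrDr mulrDl /s'; lra.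
have [_ h] := strict_energy fm sm.
have : 0 <= B * energy (path_mix w mu mutilde) by rewrite mulr_ge0 ?(ltW B0)// subr_ge0.
rewrite Em; have -> : B * ((1 - w) * energy mu + w * energy mutilde) =
    B * (1 - w) * energy mu + B * w * energy mutilde by ring.
rewrite B1w Bw; congr (0 <= _ + _).
by rewrite /C -/s'; field; rewrite gt_eqF.
Qed.

(** The pairs (a h + e G_mu, e energy mu) form a convex cone, mixtures providing the sums, and
    [slater_penalty] is the hypothesis of [cone_separation]. The element (h, 0) gives int h dlambda
    >= 0 whereas h <= 0: complementary slackness. *)
Lemma multiplier_exists : exists lambda : {finite_measure set (borel (time T)) -> \bar R},
  {ae lambda, forall t, constraint t = 0} /\
  forall mu, finite_energy mu -> 0 <= energy mu + \int[lambda]_t path_mean g mu t.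
Proof.
have [C C0 hC] := slater_penalty.
have Kb := finite_energy_minimiser.
pose K := [set z : (time T -> R) * R | exists a e mu,
  [/\ 0 <= a, 0 <= e, finite_energy mu & z = (comb a e mu, e * energy mu)]].
have [| | | | |L [LD LZ LC LK]] := @cone_separation R (time T) K C C0.
- move=> _ [a [e [mu [_ _ _ ->]]]]; apply: continuous_bdd_fun; exact: continuous_comb.
- exists 0, 0, mubar; split => //; rewrite mul0r; congr pair.
  by apply/funext => t; rewrite /comb !mul0r addr0.
- move=> _ _ [a1 [e1 [mu1 [a10 e10 K1 ->]]]] [a2 [e2 [mu2 [a20 e20 K2 ->]]]] /=.
  (* If e1 = e2 = 0 the mixing proportion is undefined; [mubar] then represents an element whose
     measure has weight 0. *)
  have := addr_ge0 e10 e20; rewrite le_eqVlt => /predU1P[E0|E0].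
    have e1E : e1 = 0 by lra.
    have e2E : e2 = 0 by lra.
    exists (a1 + a2), 0, mubar; split; rewrite ?addr_ge0//; subst e1 e2; rewrite !mul0r addr0.
    by congr pair; apply/funext => t; rewrite /comb /= !mul0r !addr0 mulrDl.
  pose w := e2 / (e1 + e2).
  have w01 : 0 <= w <= 1.
    by apply/andP; split; [rewrite divr_ge0// ltW|rewrite ler_pdivrMr// mul1r lerDr].
  have Ew : (e1 + e2) * w = e2 by rewrite mulrC divfK// gt_eqF.
  have E1w : (e1 + e2) * (1 - w) = e1 by rewrite mulrBr Ew mulr1 addrK.
  have [Km Em] := energy_mix w01 K1 K2.
  exists (a1 + a2), (e1 + e2), (path_mix w mu1 mu2); split; rewrite ?addr_ge0//; congr pair.
    apply/funext => t; rewrite /comb /= (path_mean_mix hp cg D0 gD)//.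
    have -> : (e1 + e2) * ((1 - w) * path_mean g mu1 t + w * path_mean g mu2 t) =
        (e1 + e2) * (1 - w) * path_mean g mu1 t + (e1 + e2) * w * path_mean g mu2 t by ring.
    by rewrite E1w Ew mulrDl addrACA.
  rewrite Em; have -> : (e1 + e2) * ((1 - w) * energy mu1 + w * energy mu2) =
      (e1 + e2) * (1 - w) * energy mu1 + (e1 + e2) * w * energy mu2 by ring.
  by rewrite E1w Ew.
- move=> b _ b0 [a [e [mu [a0 e0 Km ->]]]] /=; exists (b * a), (b * e), mu; split => //.
  + by rewrite mulr_ge0.
  + by rewrite mulr_ge0.
  + congr pair; last by rewrite mulrA.
    by apply/funext => t; rewrite /comb mulrDr !mulrA.
- by move=> c s [a [e [mu [a0 e0 Km ->]]]] /= s0 hs; exact: (hC a e mu s a0 e0 s0 Km hs).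
have pL : positive_linear (@bdd_fun R (time T)) L.
  split.
  - by exists 1 => t; rewrite normr1.
  - by move=> a h k bh bk; exact: bdd_funD (bdd_funZ a bh) bk.
  - by move=> a h k bh bk; rewrite -(LZ a h bh) -LD//; exact: bdd_funZ.
  - move=> h bh h0.
    have := LC _ 0 (bdd_funZ (-1) bh) (lexx _); rewrite mulr0 LZ// mulN1r oppr_le0; apply.
    by move=> t; rewrite mulN1r oppr_le0.
have [lambda hl] := riesz_time pL.
exists lambda; split; last first.
  move=> mu Km; rewrite hl; last exact: cG.
  have := LK (comb 0 1 mu, 1 * energy mu); rewrite mul1r.
  rewrite (_ : comb 0 1 mu = path_mean g mu); last first.
    by apply/funext => t; rewrite /comb mul0r add0r mul1r.
  apply; exists 0, 1, mu; split => //; rewrite mul1r; congr pair.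
  by apply/funext => t; rewrite /comb mul0r add0r mul1r.
have ch := constraint_continuous.
have h0 : 0 <= \int[lambda]_t constraint t.
  rewrite hl//; have := LK (comb 1 0 mubar, 0 * energy mubar); rewrite mul0r add0r.
  rewrite (_ : comb 1 0 mubar = constraint); last first.
    by apply/funext => t; rewrite /comb mul1r mul0r addr0.
  apply; exists 1, 0, mubar; split => //; rewrite mul0r; congr pair.
  by apply/funext => t; rewrite /comb mul1r mul0r addr0.
have mh : measurable_fun setT (constraint : borel (time T) -> R).
  exact: continuous_borel_measurableR.
have ih : lambda.-integrable setT (EFin \o (constraint : borel (time T) -> R)).
  apply: measurable_bounded_integrable => //; first by rewrite ltey_eq fin_num_measure.
  have [M hM] := continuous_bdd_fun ch.
  by exists M; split; [exact: num_real|move=> x /ltW Mx t _; exact: le_trans Mx].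
have I0 : (\int[lambda]_t `|(constraint t)%:E| = 0)%E.
  have -> : (\int[lambda]_t `|(constraint t)%:E| = (\int[lambda]_t - constraint t)%:E)%E.
    rewrite /Rintegral fineK; last first.
      apply: integrable_fin_num => //; rewrite (_ : (fun t => _) = (fun t => - (constraint t)%:E)%E)//.
      exact: integrableN.
    by apply: eq_integral => t _; rewrite /= ler0_norm// constraint_le0.
  have N0 : 0 <= \int[lambda]_t - constraint t.
    by apply: Rintegral_ge0 => t _; rewrite oppr_ge0 constraint_le0.
  have NE : \int[lambda]_t - constraint t = -1 * \int[lambda]_t constraint t.
    by rewrite -(RintegralZl (-1) measurableT ih); apply: eq_Rintegral => t _; rewrite mulN1r.
  by congr EFin; lra.
have /ae_eq_integral_abs : measurable_fun setT (EFin \o (constraint : borel (time T) -> R)).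
  exact/measurable_EFinP.
move=> /(_ lambda measurableT)[/(_ I0) + _].
by apply: filterS => t /(_ I)[].
Qed.

(** * Perturbations with fixed endpoint laws, and the Gibbs form *)

Hypothesis hnu : forall alpha : R, 0 < alpha ->
  (\int[nu]_x (expR (alpha * supnorm x `^ p))%:E < +oo)%E.

Local Notation ini := (coord_at (time_ini T) : path -> borel 'rV[R]_d).
Local Notation fin := (coord_at (time_fin T) : path -> borel 'rV[R]_d).

Let mini : measurable_fun setT ini. Proof. exact: measurable_coord_at. Qed.
Let mfin : measurable_fun setT fin. Proof. exact: measurable_coord_at. Qed.

Let mpre (u : path -> borel 'rV[R]_d) A : measurable_fun setT u -> measurable A ->
  measurable (u @^-1` A).
Proof. by move=> mu mA; rewrite -[X in measurable X]setTI; exact: mu. Qed.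

(** For eta M <= 1 the new density lies between 0 and 2 q0 + 1, so its entropy is finite by
    [theta_le_add] and [theta_double]. Finite entropy supplies the p-th moment, and the null
    integrals keep the endpoint laws. *)
Lemma perturbation mu0 (q0 s : path -> R) (M eta : R) : feasible mu0 -> has_density mu0 nu q0 ->
  measurable_fun setT s -> 0 <= M -> (forall x, - (M * q0 x) <= s x <= M * (1 + q0 x)) ->
  (forall A, measurable A -> (\int[nu]_(x in ini @^-1` A) (s x)%:E = 0)%E) ->
  (forall A, measurable A -> (\int[nu]_(x in fin @^-1` A) (s x)%:E = 0)%E) ->
  0 < eta -> eta * M <= 1 ->
  nu.-integrable setT (EFin \o s) /\
  exists mu, feasible mu /\ has_density mu nu (fun x => q0 x + eta * s x).
Proof.
move=> [H0 i0 f00] hq0 ms M0 sM si sf eta0 etaM.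
have [mq0 q00 q0E] := hq0; have iq0 := has_density_integrable hq0.
pose q x := q0 x + eta * s x.
have mq : measurable_fun setT q by apply: measurable_funD => //; exact: measurable_funM.
have q_ge0 x : 0 <= q x.
  have /andP[h _] := sM x; have := ler_wpM2l (ltW eta0) h.
  have := ler_wpM2r (q00 x) etaM; rewrite mul1r mulrN mulrA /q; lra.
have q_le x : q x <= 2 * q0 x + 1.
  have /andP[_ h] := sM x; have := ler_wpM2l (ltW eta0) h; have := q00 x => q0x.
  have h1 : 0 <= 1 + q0 x by lra.
  have := ler_wpM2r h1 etaM; rewrite mul1r mulrA /q; lra.
have is_ : nu.-integrable setT (EFin \o s).
  apply: (@le_integrable _ _ _ _ _ measurableT _ (fun x => M%:E * (1%:E + (EFin \o q0) x))%E).
  - exact/measurable_EFinP.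
  - move=> x _; rewrite /= -?EFinD -?EFinM lee_fin.
    have /andP[h1 h2] := sM x; have q0x := q00 x.
    have h0 : 0 <= M * (1 + q0 x) by rewrite mulr_ge0// addr_ge0.
    rewrite [X in _ <= X]ger0_norm// ler_norml h2 andbT; apply: le_trans h1.
    by rewrite lerN2 mulrDr mulr1 lerDr.
  - apply: integrableZl => //; apply: integrableD => //.
    apply/integrableP; split; first exact: measurable_cst.
    by rewrite integral_cst//= ?normr1 mul1e; rewrite ltey_eq fin_num_measure.
split => //.
have qE B : measurable B -> (\int[nu]_(x in B) (s x)%:E = 0)%E ->
    (\int[nu]_(x in B) (q x)%:E = mu0 B)%E.
  move=> mB sB.
  have iB : nu.-integrable B (EFin \o s) by apply: integrableS is_.
  have iqB : nu.-integrable B (EFin \o q0) by apply: integrableS iq0.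
  under eq_integral do rewrite EFinD EFinM.
  rewrite integralD//=; last exact: integrableZl.
  by rewrite integralZl// sB mule0 adde0 q0E.
have qT : (\int[nu]_x (q x)%:E = 1)%E.
  rewrite qE//; first exact: probability_setT.
  by rewrite -(preimage_setT ini); exact: si.
have [P hP] := probability_density mq q_ge0 qT.
have HP : (entropy P nu < +oo)%E.
  rewrite (entropyE hP).
  apply: (@le_lt_trans _ _ (\int[nu]_x ((1 + theta (2 * 1))%:E + (8%:E + 4%:E * (theta (q0 x))%:E + 12%:E * (q0 x)%:E)))%E).
    apply: ge0_le_integral => //.
    - by move=> x _; rewrite lee_fin theta_ge0.
    - exact: measurable_theta_comp.
    - apply/measurable_EFinP; apply: measurable_funD => //.
      apply: measurable_funD; last exact: measurable_funM.
      apply: measurable_funD => //; apply: measurable_funM => //.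
      exact: measurableT_comp measurable_theta mq0.
    - move=> x _; rewrite /= lee_fin.
      have q0x := q00 x.
      have h2 : 0 <= 2 * q0 x by rewrite mulr_ge0.
      have := theta_le_add (q_ge0 x) h2 ler01 (q_le x).
      have := theta_double h2; have := theta_double q0x.
      by have := theta_ge0 q0x; lra.
  have t0 x : 0 <= theta (q0 x) by exact: theta_ge0.
  have t21 : 0 <= theta (2 * 1 : R) by apply: theta_ge0; rewrite mulr1.
  have h3 : 0 <= 1 + theta (2 * 1 : R) by lra.
  have mt := measurable_theta_comp mq0.
  have mq0E : measurable_fun setT (EFin \o q0) by exact/measurable_EFinP.
  rewrite ge0_integralD//; last 2 first.
  - by move=> x _; rewrite -!EFinM -!EFinD lee_fin !addr_ge0// mulr_ge0.
  - apply: emeasurable_funD; last exact: measurable_funeM.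
    by apply: emeasurable_funD => //; exact: measurable_funeM.
  rewrite ge0_integralD//; last 4 first.
  - by move=> x _; rewrite -!EFinM -!EFinD lee_fin addr_ge0// mulr_ge0.
  - by apply: emeasurable_funD => //; exact: measurable_funeM.
  - by move=> x _; rewrite -EFinM lee_fin mulr_ge0.
  - exact: measurable_funeM.
  rewrite ge0_integralD//; last 2 first.
  - by move=> x _; rewrite -EFinM lee_fin mulr_ge0.
  - exact: measurable_funeM.
  have E12 : (\int[nu]_x (12%:E * (q0 x)%:E) = 12%:E)%E.
    by rewrite -[RHS]mule1 -(has_density_int hq0) ge0_integralZl// => x _; rewrite lee_fin.
  have E4 : (\int[nu]_x (4%:E * (theta (q0 x))%:E) = 4%:E * entropy mu0 nu)%E.
    by rewrite (entropyE hq0) ge0_integralZl// => x _; rewrite lee_fin.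
  rewrite !integral_probability_cst E12 E4.
  rewrite lte_add_pinfty ?ltry// lte_add_pinfty ?ltry// lte_add_pinfty ?ltry//.
  by rewrite ltey_eq fin_numM// ge0_fin_numE//; exact: entropy_ge0.
have [mu muE] := finite_entropy_P_path hnu HP.
exists mu; rewrite -muE in hP HP; split; last exact: hP.
have [_ _ muq] := hP.
split => // A mA.
  transitivity (mu0 (ini @^-1` A)); last exact: i0.
  transitivity (mu (ini @^-1` A)); first by [].
  by rewrite (muq _ (mpre mini mA)); apply: qE; [exact: mpre|exact: si].
transitivity (mu0 (fin @^-1` A)); last exact: f00.
transitivity (mu (fin @^-1` A)); first by [].
by rewrite (muq _ (mpre mfin mA)); apply: qE; [exact: mpre|exact: sf].
Qed.

Lemma perturbation_integral mu0 mu (q0 s F : path -> R) (eta : R) : has_density mu0 nu q0 ->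
  has_density mu nu (fun x => q0 x + eta * s x) -> measurable_fun setT F ->
  mu0.-integrable setT (EFin \o F) -> nu.-integrable setT (fun x => (F x * s x)%:E) ->
  mu.-integrable setT (EFin \o F) /\
  \int[mu]_x F x = \int[mu0]_x F x + eta * \int[nu]_x (F x * s x).
Proof.
move=> hq0 hq mF i0 is_.
have n0 := (integrable_density hq0 mF).1 i0.
have zs := integrableZl measurableT eta is_.
have ni : nu.-integrable setT (fun x => (F x * (q0 x + eta * s x))%:E).
  have := integrableD measurableT n0 zs; apply: eq_integrable => // x _.
  by rewrite /= -EFinM -EFinD; congr EFin; ring.
split; first exact/(integrable_density hq mF).
rewrite (Rintegral_density hq mF) (Rintegral_density hq0 mF).
rewrite -(RintegralZl eta measurableT is_) -RintegralD//.
by apply: eq_Rintegral => x _; ring.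
Qed.

Local Notation Ep := (borel 'rV[R]_d * borel 'rV[R]_d)%type.
Local Notation law2 := (joint_law mini mfin).

Let m : probability Ep R := (mu_ini \x mu_fin)%E.

Hypothesis hac1 : endpoints_law nu `<< (mu_ini \x mu_fin)%E.
Hypothesis hac2 : (mu_ini \x mu_fin)%E `<< endpoints_law nu.

Let law2_marginal mu : feasible mu ->
  (forall A, measurable A -> law2 mu (fst @^-1` A) = mu_ini A) /\
  (forall A, measurable A -> law2 mu (snd @^-1` A) = mu_fin A).
Proof. by move=> [_ h1 h2]; split => A mA; [rewrite -h1|rewrite -h2]. Qed.

Let law2_density mu q : has_density mu nu q -> exists r, has_density (law2 mu) m r.
Proof.
move=> /has_density_dominates/null_content_dominatesP h.
have [|r hr] := @has_density_exists _ _ R (law2 mu) m; last by exists r.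
apply/null_content_dominatesP => A mA A0; apply: h.
  by rewrite -[X in measurable X]setTI; exact: (measurable_funP (joint_mfun mini mfin)).
by move/null_content_dominatesP: hac1; exact.
Qed.

(** If {f = 0} were charged, rectangles with first corner in it would perturb [mutilde] into a
    strictly feasible measure charging it, against [strict_variation]. The removed corners come from
    [mutilde], the opposite corner from [nu]. *)
Lemma minimiser_positive : {ae nu, forall x, 0 < f x}.
Proof.
have hnu1 : has_density nu nu (fun=> 1).
  by split => // A mA; rewrite integral_cst// mul1e.
have [r hr] := law2_density hnu1; have [mr r0 _] := hr.
have [qt hqt _] := @entropy_density _ _ _ mutilde nu (let: And3 h _ _ := ft in h).
have [mqt qt0 _] := hqt.
have [rt hrt] := law2_density hqt; have [mrt rt0 _] := hrt.
pose e (w : path) : Ep := (ini w, fin w).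
have me : measurable_fun setT e by apply/measurable_fun_pairP.
pose Z := [set w : path | f w = 0].
have mZ : measurable Z.
  rewrite (_ : Z = f @^-1` [set 0]); last by [].
  by rewrite -[X in measurable X]setTI; exact: mf.
(* The factor e^(-r) makes the endpoint law of [alpha] at most [m], because r e^(-r) <= 1; being
   positive, it leaves the null sets within [Z] unchanged. *)
pose kap w : R := \1_Z w * expR (- r (e w)).
have mexp : measurable_fun setT (fun z => expR (- r z)).
  exact: (measurableT_comp (@measurable_expR R) (measurableT_comp (@oppr_measurable R setT) mr)).
have mkap : measurable_fun setT kap.
  by apply: measurable_funM; [exact: measurable_indic|exact: (measurableT_comp mexp me)].
have kap0 w : 0 <= kap w by rewrite mulr_ge0 ?expR_ge0.
have exp1 z : expR (- r z) <= 1 by rewrite -expR0 ler_expR oppr_le0.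
have ind1 w : \1_Z w <= 1 :> R by rewrite indicE; case: (_ \in _); rewrite ?lexx ?ler01.
have kap1 w : kap w <= 1 by rewrite /kap -[leRHS]mul1r ler_pM ?expR_ge0.
have kapfin : (\int[nu]_w (kap w)%:E < +oo)%E.
  apply: (@le_lt_trans _ _ (\int[nu]_w 1%:E)%E); last by rewrite integral_probability_cst ltry.
  apply: ge0_le_integral => //; first by move=> w _; rewrite lee_fin.
    exact/measurable_EFinP.
  by move=> w _; rewrite lee_fin.
have [alpha ha] := finite_measure_density mkap kap0 kapfin.
have alphaE (A : set Ep) : measurable A -> (alpha (e @^-1` A) <= m A)%E.
  move=> mA; have [_ _ ->] := ha; last by rewrite -[X in measurable X]setTI; exact: me.
  apply: (@le_trans _ _ (\int[nu]_(w in e @^-1` A) (expR (- r (e w)))%:E)%E).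
    apply: ge0_le_integral => //.
    - by rewrite -[X in measurable X]setTI; exact: me.
    - by move=> w _; rewrite lee_fin.
    - by apply/measurable_EFinP; exact: measurable_funTS.
    - by apply/measurable_EFinP; apply: measurable_funTS; exact: (measurableT_comp mexp me).
    - by move=> w _; rewrite lee_fin /kap -[leRHS]mul1r ler_wpM2r ?expR_ge0.
  have mE : measurable_fun setT (fun z => (expR (- r z))%:E) by exact/measurable_EFinP.
  rewrite (_ : \int[nu]_(w in e @^-1` A) _ = \int[law2 nu]_(z in A) (expR (- r z))%:E)%E; last first.
    symmetry; apply: (@ge0_integral_pushforward _ _ _ _ _ (joint_mfun mini mfin) _ nu A) => //.
    exact: measurable_funTS.
  rewrite (ge0_integral_density hr)//.
  rewrite -[leRHS]mul1e -integral_cst//; apply: ge0_le_integral => //.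
  - by move=> z _; rewrite -EFinM lee_fin mulr_ge0 ?expR_ge0.
  - by apply/measurable_EFinP; apply: measurable_funTS; exact: measurable_funM.
  - move=> z _; rewrite /= -EFinM lee_fin expRN mulrC ler_pdivrMr ?expR_gt0// mul1r.
    by apply: le_trans (expR_ge1Dx _); rewrite lerDr.
have alpha1 A : measurable A -> (alpha (ini @^-1` A) <= mu_ini A)%E.
  move=> mA; have mA' : measurable (A `*` setT : set Ep) by exact: measurableX.
  have := alphaE _ mA'; rewrite (_ : m _ = mu_ini A); last first.
    transitivity (mu_ini A * mu_fin setT)%E; first by exact: product_measure1E.
    by rewrite [X in (_ * X)%E](@probability_setT _ _ _ mu_fin) mule1.
  by congr (alpha _ <= _)%E; apply/seteqP; split => w //= [].
have alpha2 A : measurable A -> (alpha (fin @^-1` A) <= mu_fin A)%E.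
  move=> mA; have mA' : measurable (setT `*` A : set Ep) by exact: measurableX.
  have := alphaE _ mA'; rewrite (_ : m _ = mu_fin A); last first.
    transitivity (mu_ini setT * mu_fin A)%E; first by exact: product_measure1E.
    by rewrite [X in (X * _)%E](@probability_setT _ _ _ mu_ini) mul1e.
  by congr (alpha _ <= _)%E; apply/seteqP; split => w //= [].
pose M : {measure set (path * Ep)%type -> \bar R} := (alpha \x m)%E.
have msl := @measurable_swap_left _ _ _ path (borel 'rV[R]_d) (borel 'rV[R]_d) ini mini.
have msr := @measurable_swap_right _ _ _ path (borel 'rV[R]_d) (borel 'rV[R]_d) fin mfin.
have mrtl : measurable_fun setT (fun y : path * Ep => rt (ini y.1, y.2.2)).
  exact: (measurableT_comp mrt msl).
have mrtr : measurable_fun setT (fun y : path * Ep => rt (y.2.1, fin y.1)).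
  exact: (measurableT_comp mrt msr).
(* Rectangles whose three other corners have density at least 1/(n+1): [density_superlevel] then
   bounds the weights by n + 1. *)
pose S (n : nat) : set (path * Ep)%type :=
  [set y | n.+1%:R^-1 <= rt (ini y.1, y.2.2)] `&` [set y | n.+1%:R^-1 <= rt (y.2.1, fin y.1)]
  `&` [set y | n.+1%:R^-1 <= r y.2].
have mS n : measurable (S n).
  apply: measurableI; first apply: measurableI.
  - exact: (measurable_superlevel _ mrtl).
  - exact: (measurable_superlevel _ mrtr).
  - exact: (measurable_superlevel _ (measurableT_comp mr measurable_snd)).
have MS n : M (S n) = 0%E.
  have n0 : 0 < n.+1%:R^-1 :> R by rewrite invr_gt0.
  have c0 : 0 <= n.+1%:R :> R by [].
  have mB := measurable_superlevel n.+1%:R^-1 mrt.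
  have mB' := measurable_superlevel n.+1%:R^-1 mr.
  pose B := [set z | n.+1%:R^-1 <= rt z]; pose B' := [set z | n.+1%:R^-1 <= r z].
  have hB A : measurable A -> (m (A `&` B) <= (n.+1%:R : R)%:E * law2 mutilde A)%E.
    by move=> mA; have := density_superlevel hrt n0 mA; rewrite invrK.
  have hB' A : measurable A -> (m (A `&` B') <= (n.+1%:R : R)%:E * law2 nu A)%E.
    by move=> mA; have := density_superlevel hr n0 mA; rewrite invrK.
  have SB y : S n y -> [/\ n.+1%:R^-1 <= rt (ini y.1, y.2.2), n.+1%:R^-1 <= rt (y.2.1, fin y.1)
    & n.+1%:R^-1 <= r y.2] by move=> [[h1 h2] h3].
  have [s [k2 [k3 [k4 [[ms mk2 mk3 mk4] [s01 k20 k30 k40] sE _ [msig sig1 sig2]]]]]] :=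
    quadruple_perturbation alpha1 alpha2 ha hqt hnu1 c0 mB mB' (mS n) hB hB' SB.
  pose N : R := n.+1%:R; pose K : R := 1 + 2 * N.
  have K0 : 0 < K by rewrite ltr_wpDr// mulr_ge0.
  pose sigma w := s w * kap w + k4 (ini w, fin w) * 1 - (k2 (ini w, fin w) + k3 (ini w, fin w)) * qt w.
  have sM x : - (K * qt x) <= sigma x <= K * (1 + qt x).
    apply: perturbation_bounds => //; have /andP[s_0 s_1] := s01 x.
    by rewrite mulr_ge0//= -[leRHS]mul1r ler_pM.
  have [cS cS0 hcS] := slater_margin.
  pose pb := path_bound p D : path -> R.
  have mpb : measurable_fun setT pb by exact: measurable_path_bound.
  have pb0 w : 0 <= pb w by exact: path_bound_ge0.
  have ipq : nu.-integrable setT (fun w => (pb w * (K * (1 + qt w)))%:E).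
    have n1 := integrableZl measurableT K (integrable_path_bound D nu).
    have n2 := integrableZl measurableT K ((integrable_density hqt mpb).1 (integrable_path_bound D mutilde)).
    have := integrableD measurableT n1 n2; apply: eq_integrable => // w _.
    by rewrite /= -!EFinM -EFinD; congr EFin; rewrite /pb; ring.
  pose Cs : R := \int[nu]_w (pb w * (K * (1 + qt w))).
  have Cs0 : 0 <= Cs.
    by apply: Rintegral_ge0 => w _; rewrite mulr_ge0// mulr_ge0 ?(ltW K0)// addr_ge0.
  have sabs w : `|sigma w| <= K * (1 + qt w).
    have /andP[h1 h2] := sM w; rewrite ler_norml h2 andbT; apply: le_trans h1.
    by rewrite lerN2 mulrDr mulr1 lerDr ltW.
  have gs t w : `|g t (coord_at t w) * sigma w| <= pb w * (K * (1 + qt w)).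
    by rewrite normrM ler_pM//; exact: (path_functional_bound hp D0 gD).
  have mg t : measurable_fun setT (fun w : path => g t (coord_at t w)).
    exact: measurable_path_functional.
  have igs t : nu.-integrable setT (fun w => (g t (coord_at t w) * sigma w)%:E).
    apply: (@le_integrable _ _ _ _ _ measurableT _ _ _ _ ipq).
      by apply/measurable_EFinP; apply: measurable_funM => //; exact: msig.
    by move=> w _; rewrite lee_fin; apply: le_trans (gs t w) (ler_norm _).
  have Xt t : \int[nu]_w (g t (coord_at t w) * sigma w) <= Cs.
    apply: (le_Rintegral measurableT (igs t) ipq) => w _; apply: le_trans (ler_norm _) (gs t w).
  have C1 : 0 < Cs + 1 by rewrite ltr_wpDl.
  (* The first bound keeps the density nonnegative; the second preserves the Slater inequality, [Cs]
     being a bound, uniform in time, on the increase rate of the linearised constraint. *)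
  pose eta := Num.min K^-1 (cS / (etilde * (Cs + 1))).
  have eta0 : 0 < eta by rewrite lt_min invr_gt0 K0 divr_gt0// mulr_gt0.
  have etaK : eta * K <= 1.
    by rewrite -(mulVf (lt0r_neq0 K0)); apply: ler_wpM2r; [exact: ltW|rewrite ge_min lexx].
  have etaC : etilde * eta * Cs < cS.
    have h1 : etilde * eta * (Cs + 1) <= cS.
      have : eta <= cS / (etilde * (Cs + 1)) by rewrite ge_min lexx orbT.
      by rewrite ler_pdivlMr ?mulr_gt0// => h; rewrite -mulrA mulrCA.
    apply: lt_le_trans h1; rewrite mulrDr mulr1 ltrDl mulr_gt0//.
  have [_ [mu [fmu hmu]]] := perturbation ft hqt msig (ltW K0) sM sig1 sig2 eta0 etaK.
  have smu : strictly_feasible mu.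
    exists etilde => // t.
    have [_ E] := perturbation_integral hqt hmu (mg t) (integrable_path_functional hp cg D0 gD mutilde t) (igs t).
    rewrite /path_mean E mulrDr addrA -/(path_mean g mutilde t).
    apply: (@le_lt_trans _ _ (- cS + etilde * eta * Cs)); last by rewrite addrC subr_lt0.
    apply: lerD; first exact: hcS.
    by rewrite mulrA; apply: ler_wpM2l; [rewrite mulr_ge0// ltW|exact: Xt].
  have [supp _ _] := strict_variation fmu smu hmu.
  have sk0 : {ae nu, forall w, s w * kap w = 0}.
    apply: filterS supp => w hw.
    have [fw|fw] := eqVneq (f w) 0; last first.
      by rewrite /kap indicE memNset ?mul0r ?mulr0//; exact/eqP.
    apply: (perturbation_vanish (k20 _) (k30 _) (k40 _) (qt0 w) eta0 etaK _ (hw fw)).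
    by rewrite mulr_ge0//; have /andP[] := s01 w.
  rewrite -(integral_mul1_indic M (mS n)).
  rewrite (sE (cst 1%:E))//.
  rewrite (ge0_integral_density ha)//; last 2 first.
  - by apply: emeasurable_funM => //; exact/measurable_EFinP.
  - by move=> w; rewrite mule_ge0// lee_fin; have /andP[] := s01 w.
  rewrite (@ae_eq_integral _ _ _ nu setT (cst 0%E) _) ?integral0//.
  - apply: emeasurable_funM; last exact/measurable_EFinP.
    by apply: emeasurable_funM => //; exact/measurable_EFinP.
  - by apply: filterS sk0 => w h _; rewrite mul1e -EFinM h.
have [b1 b2] := law2_marginal ft.
have mr0 : measurable [set z | r z = 0].
  rewrite (_ : [set z | _] = r @^-1` [set 0]); last by [].
  by rewrite -[X in measurable X]setTI; exact: mr.
have lr0 : law2 nu [set z | r z = 0] = 0%E := density_zero_level hr.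
(* The product is dominated by the endpoint law of [nu], so almost every opposite corner has
   positive density; up to a null set, the [S n] exhaust the rectangles whose swapped corners are
   charged by [mutilde]. *)
have m0 : m [set z | r z = 0] = 0%E.
  by move/null_content_dominatesP: hac2; apply.
have MQ : M [set y | 0 < rt (ini y.1, y.2.2) /\ 0 < rt (y.2.1, fin y.1)] = 0%E.
  have mr2 : measurable (snd @^-1` [set z | r z = 0] : set (path * Ep)%type).
    by rewrite -[X in measurable X]setTI; exact: measurable_snd.
  apply: (measure0_cover _ mr2 mS _ MS); last first.
    apply/eqP; rewrite eq_le measure_ge0 andbT.
    by apply: le_trans (second_le _ alpha1 mr0) _; rewrite -m0.
  - move=> y [/= h1 h2]; have [ry|ry] := eqVneq (r y.2) 0; first by right.
    left; have h3 : 0 < r y.2 by rewrite lt_neqAle eq_sym ry r0.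
    pose x := Num.min (rt (ini y.1, y.2.2)) (Num.min (rt (y.2.1, fin y.1)) (r y.2)).
    have x0 : 0 < x by rewrite !lt_min h1 h2 h3.
    have [n _ hn] := near_infty_natSinv_lt (PosNum x0).
    exists n => //; have := hn n (leqnn n) => /= /ltW; rewrite !le_min => /and3P[? ? ?].
    by split.
  - by apply: measurableI; [exact: (measurable_pos_level mrtl)|exact: (measurable_pos_level mrtr)].
have alpha0 := rectangle_null mini mfin alpha1 alpha2 hrt b1 b2 MQ.
have kap_ae : {ae nu, forall w, kap w = 0}.
  have [_ _ aE] := ha; move: alpha0; rewrite aE// => k0.
  have : ae_eq nu setT (EFin \o kap) (cst 0%E).
    apply/ae_eq_integral_abs => //; first exact/measurable_EFinP.
    by rewrite -[RHS]k0; apply: eq_integral => w _; rewrite gee0_abs ?lee_fin.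
  by apply: filterS => w /(_ I)[].
apply: filterS kap_ae => w; rewrite /kap => /eqP; rewrite mulf_eq0 (gt_eqF (expR_gt0 _)) orbF.
rewrite indicE pnatr_eq0 eqb0 => /negP h; rewrite lt_neqAle f0 andbT eq_sym.
by apply/eqP => fw; apply: h; rewrite inE.
Qed.

Variable lambda : {finite_measure set (borel (time T)) -> \bar R}.
Hypothesis hmul : forall mu, finite_energy mu -> 0 <= energy mu + \int[lambda]_t path_mean g mu t.

Let I := time_integral g lambda : path -> R.

Definition potential (w : path) : R := ln (f w) + I w.

Let mI : measurable_fun setT I. Proof. exact: (measurable_time_integral hp cg D0 gD lambda mubar). Qed.

Lemma measurable_potential : measurable_fun setT potential.
Proof. exact: measurable_funD. Qed.

Let iI mu : mu.-integrable setT (EFin \o I).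
Proof. exact: (integrable_time_integral hp cg D0 gD lambda mu). Qed.

Lemma integrable_potential mu : mu.-integrable setT (fun w => (ln (f w))%:E) ->
  mu.-integrable setT (EFin \o potential).
Proof.
move=> h; have := integrableD measurableT h (iI mu); apply: eq_integrable => // w _.
Qed.

(** The mean of the derivative under [mubar] is 0 by normalisation, and Fubini's theorem exchanges
    time and path: the multiplier inequality becomes minimality of [mubar] for the mean of the
    potential. *)
Lemma potential_energy mu : mu.-integrable setT (fun w => (ln (f w))%:E) ->
  \int[mu]_w potential w - \int[mubar]_w potential w =
  energy mu + \int[lambda]_t path_mean g mu t.
Proof.
move=> h; have ib := integrable_ln_minimiser.
rewrite (RintegralD _ h (iI mu))// (RintegralD _ ib (iI mubar))//.
rewrite -!(integral_path_mean hp cg D0 gD) /energy.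
have -> : \int[lambda]_t path_mean g mubar t = 0.
  under eq_Rintegral do rewrite path_mean_minimiser.
  by rewrite Rintegral_cst// mul0r.
by rewrite addr0 addrAC.
Qed.

(* Both [s] and [-s] are admissible directions, so the first variation vanishes. *)
Lemma potential_orthogonal (s : path -> R) (K : R) : measurable_fun setT s -> 0 < K ->
  (forall w, `|s w| <= K * f w) ->
  (forall A, measurable A -> (\int[nu]_(w in ini @^-1` A) (s w)%:E = 0)%E) ->
  (forall A, measurable A -> (\int[nu]_(w in fin @^-1` A) (s w)%:E = 0)%E) ->
  \int[nu]_w (potential w * s w) = 0.
Proof.
move=> ms K0 sK si sf.
have fb := minimiser_feasible.
have ib := integrable_ln_minimiser.
have iPb := integrable_potential ib.
have mP := measurable_potential.
have is_ (F : path -> R) (s' : path -> R) : measurable_fun setT F -> measurable_fun setT s' ->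
    (forall w, `|s' w| <= K * f w) -> mubar.-integrable setT (EFin \o F) ->
    nu.-integrable setT (fun w => (F w * s' w)%:E).
  move=> mF ms' s'K iF.
  have n1 := integrableZl measurableT K ((integrable_density hf mF).1 iF).
  apply: (@le_integrable _ _ _ _ _ measurableT _ _ _ _ n1).
    by apply/measurable_EFinP; exact: measurable_funM.
  move=> w _; rewrite /= lee_fin normrM [leRHS]normrM normrM (gtr0_norm K0) (ger0_norm (f0 w)).
  by rewrite mulrCA; apply: ler_wpM2l.
have sM (s' : path -> R) : (forall w, `|s' w| <= K * f w) ->
    forall x, - (K * f x) <= s' x <= K * (1 + f x).
  move=> s'K x; have := s'K x; rewrite ler_norml => /andP[-> h]; apply: le_trans h _.
  by rewrite ler_wpM2l ?(ltW K0)// lerDr.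
have eta0 : 0 < K^-1 by rewrite invr_gt0.
have etaK : K^-1 * K <= 1 by rewrite mulVf ?gt_eqF.
have key (s' : path -> R) : measurable_fun setT s' -> (forall w, `|s' w| <= K * f w) ->
    (forall A, measurable A -> (\int[nu]_(w in ini @^-1` A) (s' w)%:E = 0)%E) ->
    (forall A, measurable A -> (\int[nu]_(w in fin @^-1` A) (s' w)%:E = 0)%E) ->
    0 <= \int[nu]_w (potential w * s' w).
  move=> ms' s'K s'i s'f.
  have [_ [mu [fmu hmu]]] := perturbation fb hf ms' (ltW K0) (sM _ s'K) s'i s'f eta0 etaK.
  have [il _] := perturbation_integral hf hmu mln ib (is_ _ _ mln ms' s'K ib).
  have [_ E] := perturbation_integral hf hmu mP iPb (is_ _ _ mP ms' s'K iPb).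
  have := hmul (conj fmu il : finite_energy mu); rewrite -potential_energy// E.
  by rewrite addrAC subrr add0r pmulr_rge0.
apply/eqP; rewrite eq_le (key s)// andbT.
have msN : measurable_fun setT (fun w => - s w) by exact: measurable_funN.
have [iS _] := perturbation fb hf ms (ltW K0) (sM _ sK) si sf eta0 etaK.
have isN D' : measurable D' -> (\int[nu]_(w in D') (s w)%:E = 0 -> \int[nu]_(w in D') (- s w)%:E = 0)%E.
  move=> mD' h; have i1 : nu.-integrable D' (EFin \o s) by apply: integrableS iS.
  have := integralZl mD' i1 (-1); rewrite /= h mule0 => <-.
  by apply: eq_integral => w _; rewrite -EFinM mulN1r.
have : 0 <= \int[nu]_w (potential w * - s w).
  apply: key => //.
  - by move=> w; rewrite normrN.
  - by move=> A mA; apply: isN; [exact: mpre|exact: si].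
  - by move=> A mA; apply: isN; [exact: mpre|exact: sf].
have -> : \int[nu]_w (potential w * - s w) = -1 * \int[nu]_w (potential w * s w).
  rewrite -(RintegralZl (-1) measurableT (is_ _ _ mP ms sK iPb)).
  by apply: eq_Rintegral => w _; rewrite mulN1r mulrN.
by rewrite mulN1r oppr_ge0.
Qed.

(** Orthogonality to the perturbation built on each S inside [A n], rewritten under the measure of
    rectangles, says that [G] has null integral over S; hence G = 0 almost everywhere. *)
Lemma potential_decomposition : exists (phi : Ep -> R) (z : Ep),
  measurable_fun setT phi /\
  {ae nu, forall w, potential w = phi (ini w, z.2) + phi (z.1, fin w) - phi z}.
Proof.
have fb := minimiser_feasible.
have ib := integrable_ln_minimiser.
have iP := integrable_potential ib.
have mP := measurable_potential.
have [phi [iphi phiE]] := joint_conditional_mean mini mfin iP.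
have mphi : measurable_fun setT phi by apply/measurable_EFinP; exact: (measurable_int (law2 mubar)).
have [b1 b2] := law2_marginal fb.
have alpha1 A : measurable A -> (mubar (ini @^-1` A) <= mu_ini A)%E by move=> mA; rewrite -b1.
have alpha2 A : measurable A -> (mubar (fin @^-1` A) <= mu_fin A)%E by move=> mA; rewrite -b2.
have [r hr] := law2_density hf; have [mr r0 _] := hr.
pose M : {measure set (path * Ep)%type -> \bar R} := (mubar \x m)%E.
have msl := @measurable_swap_left _ _ _ path (borel 'rV[R]_d) (borel 'rV[R]_d) ini mini.
have msr := @measurable_swap_right _ _ _ path (borel 'rV[R]_d) (borel 'rV[R]_d) fin mfin.
have mrl : measurable_fun setT (fun y : path * Ep => r (ini y.1, y.2.2)).
  exact: (measurableT_comp mr msl).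
have mrr : measurable_fun setT (fun y : path * Ep => r (y.2.1, fin y.1)).
  exact: (measurableT_comp mr msr).
pose A (n : nat) : set (path * Ep)%type :=
  [set y | n.+1%:R^-1 <= r (ini y.1, y.2.2)] `&` [set y | n.+1%:R^-1 <= r (y.2.1, fin y.1)]
  `&` [set y | n.+1%:R^-1 <= r y.2].
have mA n : measurable (A n).
  apply: measurableI; first apply: measurableI.
  - exact: (measurable_superlevel _ mrl).
  - exact: (measurable_superlevel _ mrr).
  - exact: (measurable_superlevel _ (measurableT_comp mr measurable_snd)).
(* Alternating sum over the four corners: the potential itself at the path [y.1], its conditional
   mean at the other three, which enter through their endpoints alone. *)
pose G (y : path * Ep) : R :=
  potential y.1 + phi y.2 - (phi (ini y.1, y.2.2) + phi (y.2.1, fin y.1)).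
have mG : measurable_fun setT G.
  apply: measurable_funB; apply: measurable_funD.
  - exact: (measurableT_comp mP measurable_fst).
  - exact: (measurableT_comp mphi measurable_snd).
  - exact: (measurableT_comp mphi msl).
  - exact: (measurableT_comp mphi msr).
have MG n : M (A n `&` [set y | G y != 0]) = 0%E.
  apply: integral_indic_null => // S mS SA.
  have n0 : 0 < n.+1%:R^-1 :> R by rewrite invr_gt0.
  have c0 : 0 <= n.+1%:R :> R by [].
  pose B := [set z | n.+1%:R^-1 <= r z].
  have mB : measurable B by exact: measurable_superlevel.
  have hB D' : measurable D' -> (m (D' `&` B) <= (n.+1%:R : R)%:E * law2 mubar D')%E.
    by move=> mD'; have := density_superlevel hr n0 mD'; rewrite invrK.
  have SB y : S y -> [/\ n.+1%:R^-1 <= r (ini y.1, y.2.2), n.+1%:R^-1 <= r (y.2.1, fin y.1)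
    & n.+1%:R^-1 <= r y.2] by move=> /SA[[h1 h2] h3].
  have [s [k2 [k3 [k4 [[ms mk2 mk3 mk4] [s01 k20 k30 k40] sE kE [msig sig1 sig2]]]]]] :=
    quadruple_perturbation alpha1 alpha2 hf hf hf c0 mB mB mS hB hB SB.
  pose N : R := n.+1%:R; pose K : R := 1 + 2 * N.
  have K0 : 0 < K by rewrite ltr_wpDr// mulr_ge0.
  pose kap w : R := s w + k4 (ini w, fin w) - (k2 (ini w, fin w) + k3 (ini w, fin w)).
  have e_meas (k : Ep -> R) : measurable_fun setT k -> measurable_fun setT (fun w => k (ini w, fin w)).
    by move=> mk; apply: (measurableT_comp mk); apply/measurable_fun_pairP.
  have mkap : measurable_fun setT kap.
    by apply: measurable_funB; apply: measurable_funD => //; exact: e_meas.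
  have bk (k : path -> R) (c : R) : measurable_fun setT k -> (forall w, 0 <= k w <= c) ->
      mubar.-integrable setT (fun w => (potential w * k w)%:E).
    move=> mk kc.
    apply: (@le_integrable _ _ _ _ _ measurableT _ (fun w => c%:E * (EFin \o potential) w)%E).
    - by apply/measurable_EFinP; exact: measurable_funM.
    - move=> w _; have /andP[h1 h2] := kc w.
      rewrite /= lee_fin normrM [leRHS]normrM (ger0_norm h1) (ger0_norm (le_trans h1 h2)) mulrC.
      by rewrite ler_wpM2r.
    - exact: integrableZl.
  have js := bk _ _ ms s01.
  have j2 := bk _ _ (e_meas _ mk2) (fun w => k20 (ini w, fin w)).
  have j3 := bk _ _ (e_meas _ mk3) (fun w => k30 (ini w, fin w)).
  have j4 := bk _ _ (e_meas _ mk4) (fun w => k40 (ini w, fin w)).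
  have Z : \int[mubar]_w (potential w * kap w) = 0.
    have H := potential_orthogonal msig K0 _ sig1 sig2.
    rewrite (Rintegral_density hf); last exact: measurable_funM.
    transitivity (\int[nu]_w (potential w * (s w * f w + k4 (ini w, fin w) * f w
        - (k2 (ini w, fin w) + k3 (ini w, fin w)) * f w))).
      by apply: eq_Rintegral => w _; rewrite /kap; ring.
    by apply: H => w; exact: perturbation_norm_bound.
  have Z2 : \int[mubar]_w (potential w * s w) + \int[mubar]_w (potential w * k4 (ini w, fin w))
      - (\int[mubar]_w (potential w * k2 (ini w, fin w)) + \int[mubar]_w (potential w * k3 (ini w, fin w))) = 0.
    have jA := integrableD measurableT js j4; have jB := integrableD measurableT j2 j3.
    rewrite -(RintegralD _ js j4)// -(RintegralD _ j2 j3)// -RintegralB//.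
    by rewrite -[RHS]Z; apply: eq_Rintegral => w _; rewrite /kap; ring.
  have [i1 E1] := @transport_integrable _ _ (path * Ep)%type path R M S fst mubar s 1 potential
    mS measurable_fst ms s01 sE iP.
  have [i4 E4] := @transport_integrable _ _ (path * Ep)%type Ep R M S snd (law2 mubar) k4 _ phi
    mS measurable_snd mk4 k40 (fun psi h h0 => let: And3 _ _ H := kE psi h h0 in H) iphi.
  have [i2 E2] := @transport_integrable _ _ (path * Ep)%type Ep R M S _ (law2 mubar) k2 _ phi
    mS msl mk2 k20 (fun psi h h0 => let: And3 H _ _ := kE psi h h0 in H) iphi.
  have [i3 E3] := @transport_integrable _ _ (path * Ep)%type Ep R M S _ (law2 mubar) k3 _ phi
    mS msr mk3 k30 (fun psi h h0 => let: And3 _ H _ := kE psi h h0 in H) iphi.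
  rewrite (phiE _ _ mk2 k20) (phiE _ _ mk3 k30) (phiE _ _ mk4 k40) -E1 -E2 -E3 -E4 in Z2.
  have iA := integrableD measurableT i1 i4; have iB := integrableD measurableT i2 i3.
  split.
    have := integrableB measurableT iA iB; apply: eq_integrable => // y _.
    by rewrite /= -!EFinD; congr EFin; rewrite /G; ring.
  rewrite -[RHS]Z2 -(RintegralD _ i1 i4)// -(RintegralD _ i2 i3)// -RintegralB//.
  by apply: eq_Rintegral => y _; rewrite /G; ring.
have fpos := minimiser_positive.
have mr0 : measurable [set z | r z = 0].
  rewrite (_ : [set z | _] = r @^-1` [set 0]); last by [].
  by rewrite -[X in measurable X]setTI; exact: mr.
have me : measurable_fun setT (fun w => (ini w, fin w)) by apply/measurable_fun_pairP.
(* Positivity of [f] makes [nu] absolutely continuous with respect to [mubar]; what holds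
   [mubar]-almost everywhere is thus transferred to [nu]. *)
have mubar_nu (D' : set path) : measurable D' -> mubar D' = 0%E -> nu D' = 0%E.
  move=> mD' D0'; have [_ _ fE] := hf; rewrite fE// in D0'.
  have mfD : measurable_fun D' (EFin \o f) by apply/measurable_EFinP; exact: measurable_funTS.
  have I0 : (\int[nu]_(w in D') `|(EFin \o f) w| = 0)%E.
    by rewrite -[RHS]D0'; apply: eq_integral => w _; rewrite gee0_abs ?lee_fin.
  have /(ae_eq_integral_abs nu mD')/iffLR/(_ I0) := mfD => ae0.
  apply: measure_negligible => //.
  have [N [mN N0 hN]] : {ae nu, forall w, ~ D' w}.
    by apply: filterS2 ae0 fpos => w h fw /h[] fw0; rewrite fw0 ltxx in fw.
  by exists N; split => // w D'w; apply: hN => /(_ D'w).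
have m0 : m [set z | r z = 0] = 0%E.
  move/null_content_dominatesP: hac2; apply => //.
  apply: mubar_nu; last exact: (density_zero_level hr).
  by rewrite -[X in measurable X]setTI; exact: me.
have mGZ : measurable [set y | G y != 0].
  rewrite (_ : [set y | _] = ~` (G @^-1` [set 0])).
    by apply: measurableC; rewrite -[X in measurable X]setTI; exact: mG.
  by apply/seteqP; split => y /= /eqP.
have MZ : M [set y | G y != 0] = 0%E.
  pose C1 := (fun y : path * Ep => (ini y.1, y.2.2)) @^-1` [set z | r z = 0].
  pose C2 := (fun y : path * Ep => (y.2.1, fin y.1)) @^-1` [set z | r z = 0].
  pose C3 := @snd path Ep @^-1` [set z | r z = 0].
  have mC1 : measurable C1 by rewrite -[X in measurable X]setTI; exact: msl.
  have mC2 : measurable C2 by rewrite -[X in measurable X]setTI; exact: msr.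
  have mC3 : measurable C3 by rewrite -[X in measurable X]setTI; exact: measurable_snd.
  have M1 : M C1 = 0%E.
    apply/eqP; rewrite eq_le measure_ge0 andbT.
    by apply: le_trans (swap_left_le mini _ alpha1 mr0) _; rewrite -m0.
  have M2 : M C2 = 0%E.
    apply/eqP; rewrite eq_le measure_ge0 andbT.
    by apply: le_trans (swap_right_le mfin _ alpha2 mr0) _; rewrite -m0.
  have M3 : M C3 = 0%E.
    apply/eqP; rewrite eq_le measure_ge0 andbT.
    by apply: le_trans (second_le _ alpha1 mr0) _; rewrite -m0.
  have cov : [set y | G y != 0] `<=`
      \bigcup_n (A n `&` [set y | G y != 0]) `|` (C1 `|` C2 `|` C3).
    move=> y Gy.
    have [h1|h1] := eqVneq (r (ini y.1, y.2.2)) 0; first by right; left; left.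
    have [h2|h2] := eqVneq (r (y.2.1, fin y.1)) 0; first by right; left; right.
    have [h3|h3] := eqVneq (r y.2) 0; first by right; right.
    left; pose x := Num.min (r (ini y.1, y.2.2)) (Num.min (r (y.2.1, fin y.1)) (r y.2)).
    have x0 : 0 < x by rewrite !lt_min !lt_neqAle ![0 == _]eq_sym h1 h2 h3 !r0.
    have [n _ hn] := near_infty_natSinv_lt (PosNum x0).
    exists n => //; have := hn n (leqnn n) => /= /ltW; rewrite !le_min => /and3P[? ? ?].
    by split.
  have mAG n : measurable (A n `&` [set y | G y != 0]) by exact: measurableI (mA n) mGZ.
  have [mC MC] := measure0_setU3 mC1 mC2 mC3 M1 M2 M3.
  exact: (measure0_cover mGZ mC mAG cov MG MC).
(* Fubini's theorem gives a corner [z] valid for almost all paths. Freezing it makes sense because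
   [phi] is a fixed measurable function, not a class modulo null sets. *)
have [z Hz] : exists z : Ep, mubar (ysection [set y | G y != 0] z) = 0%E.
  apply: (probability_ae_ex (P := m)).
  set GZ := [set y | G y != 0].
  have ME : (\int[m]_z mubar (ysection GZ z) = 0)%E.
    by rewrite -[RHS]MZ; symmetry; exact: product_measure_ysection.
  have : ae_eq m setT (fun z => mubar (ysection GZ z)) (cst 0%E).
    apply/ae_eq_integral_abs => //; first exact: measurable_fun_ysection.
    by rewrite -[RHS]ME; apply: eq_integral => z _; rewrite gee0_abs.
  by apply: filterS => z h; exact: h.
exists phi, z; split => //.
have mY : measurable (ysection [set y | G y != 0] z) by exact: measurable_ysection.
exists (ysection [set y | G y != 0] z); split => //; first exact: mubar_nu.
move=> w /= h; rewrite /ysection/= inE/=; apply/eqP => Gw; apply: h.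
by move: Gw; rewrite /G /=; lra.
Qed.

Lemma gibbs_representation : exists zeta0 zetaT : borel 'rV[R]_d -> R,
  [/\ measurable_fun setT zeta0, measurable_fun setT zetaT
    & {ae nu, forall w, f w = gibbs_weight g lambda zeta0 zetaT w}].
Proof.
have [phi [z [mphi hphi]]] := potential_decomposition.
exists (fun x => phi z - phi (x, z.2)), (fun x => - phi (z.1, x)); split.
- apply: measurable_funB => //; apply: (measurableT_comp mphi).
  by apply/measurable_fun_pairP; split; [exact: measurable_id|exact: measurable_cst].
- apply: measurable_funN; apply: (measurableT_comp mphi).
  by apply/measurable_fun_pairP; split; [exact: measurable_cst|exact: measurable_id].
- apply: filterS2 hphi minimiser_positive => w h fw.
  rewrite /gibbs_weight -/(time_integral g lambda w) -[LHS](lnK fw); congr expR.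
  by move: h; rewrite /potential -/(time_integral g lambda w) /I; lra.
Qed.

End constrained_variations.

Section gibbs_density.
Context (R : realType) (T : {posnum R}) (d : nat) (p : R).
Variable nu : P_path T d p.

(** [f] is already a probability density: the normalising factor is contained in the zetas, and the
    constant is 1. *)
Lemma gibbs_density (mubar : P_path T d p) f (g : time T -> 'rV[R]_d -> R)
    (lambda : {finite_measure set (borel (time T)) -> \bar R}) (zeta0 zetaT : borel 'rV[R]_d -> R) :
  measurable_fun setT (gibbs_weight g lambda zeta0 zetaT : borel (path_space T d) -> R) ->
  has_density mubar nu f -> {ae nu, forall w, f w = gibbs_weight g lambda zeta0 zetaT w} ->
  (1%:E = \int[nu]_x (gibbs_weight g lambda zeta0 zetaT x)%:E)%E /\
  {ae nu, forall x, density mubar nu x = (1^-1 * gibbs_weight g lambda zeta0 zetaT x)%:E}.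
Proof.
move=> mw hf h; have [mf f0 _] := hf; split.
  rewrite -(has_density_int hf); apply: ae_eq_integral => //.
  - exact/measurable_EFinP.
  - exact/measurable_EFinP.
  - by apply: filterS h => w fw _ /=; rewrite fw.
apply: filterS2 (density_ae_eq hf) h => w /(_ Logic.I) -> <-.
by rewrite invr1 mul1r.
Qed.

End gibbs_density.
Theorem theorem3p3 (R : realType) (T : {posnum R}) (d : nat) (p : R)
    (hd : (1 <= d)%N) (hp : 1 <= p)
    (nu : P_path T d p)
    (hnu : forall alpha : R, 0 < alpha ->
      (\int[nu]_x (expR (alpha * supnorm x `^ p))%:E < +oo)%E)
    (Psi : P_Rd d p -> R)
    (hPsi : lower_semicontinuous (EFin \o Psi))
    (mu_ini mu_fin : P_Rd d p)
    (hac1 : endpoints_law nu `<< (mu_ini \x mu_fin)%E)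
    (hac2 : (mu_ini \x mu_fin)%E `<< endpoints_law nu) :
  (* 1 *)
  (problem_value hp nu Psi mu_ini mu_fin \is a fin_num ->
    (exists mubar : P_path T d p, minimiser hp nu Psi mu_ini mu_fin mubar) /\
    (convex_on_P Psi -> forall mu1 mu2 : P_path T d p,
      minimiser hp nu Psi mu_ini mu_fin mu1 ->
      minimiser hp nu Psi mu_ini mu_fin mu2 -> mu1 ≡μ mu2)) /\
  (* 2 *)
  (forall (mubar : P_path T d p) (dPsi : time T -> 'rV[R]_d -> R),
    minimiser hp nu Psi mu_ini mu_fin mubar ->
    (* (i) *)
    continuous Psi ->
    (* (ii) *)
    (forall t : time T,
      is_linear_derivative Psi (marginal hp mubar t) (dPsi t)) ->
    (forall mu : P_path T d p,
      ereal_sup (range (fun t : time T =>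
        `| (Psi (mix e (marginal hp mubar t) (marginal hp mu t))
              - Psi (marginal hp mubar t)) / e
           - (\int[marginal hp mu t]_x dPsi t x
              - \int[marginal hp mubar t]_x dPsi t x) |%:E))
        @[e --> 0^'+] --> 0%E) ->
    (* (iii) *)
    continuous (fun z : time T * 'rV[R]_d => dPsi z.1 z.2) ->
    (* (iv) *)
    (exists2 D : R, 0 <= D & forall (x : 'rV[R]_d),
      (ereal_sup (range (fun t : time T => `|dPsi t x|%:E))
         <= (D * (1 + enorm x `^ p))%:E)%E) ->
    (* (v) *)
    (exists (mutilde : P_path T d p) (etilde : R),
      [/\ (entropy mutilde nu < +oo)%E,
          marginal hp mutilde (time_ini T) ≡μ mu_ini,
          marginal hp mutilde (time_fin T) ≡μ mu_fin,
          0 < etilde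
        & forall t : time T,
            Psi (marginal hp mubar t) + etilde *
              (\int[marginal hp mutilde t]_x dPsi t x
               - \int[marginal hp mubar t]_x dPsi t x) < 0]) ->
    exists (lambda : {finite_measure set (borel (time T)) -> \bar R})
           (zeta0 zetaT : borel 'rV[R]_d -> R) (Z : R),
      [/\ measurable_fun setT zeta0, measurable_fun setT zetaT, 0 < Z
        & [/\ Z%:E = (\int[nu]_x (gibbs_weight dPsi lambda zeta0 zetaT x)%:E)%E,
              mubar `<< nu,
              {ae nu, forall x, density mubar nu x =
                (Z^-1 * gibbs_weight dPsi lambda zeta0 zetaT x)%:E}
            & {ae lambda, forall t, Psi (marginal hp mubar t) = 0}]]).
Proof.
split.
  move=> vfin; split; first exact: minimiser_exists.
  exact: minimiser_unique.
move=> mubar g hmin cPsi hlin hunif cg [D D0 gD] [mutilde [et [Ht it ft et0 slater]]].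
have [f hf _] : exists2 f, has_density mubar nu f & entropy mubar nu = (\int[nu]_x (theta (f x))%:E)%E.
  by apply: entropy_density; have [_ -> vfin] := hmin; rewrite ltey_eq vfin.
have fmt : feasible hp nu mu_ini mu_fin mutilde by split.
have slater' t : constraint hp Psi mubar t + et * path_mean g mutilde t < 0.
  have := slater t; rewrite !(marginal_mean hp cg D0 gD) (path_mean_minimiser hlin cg D0 gD).
  by rewrite subr0.
have [lambda [h0 hmul]] := multiplier_exists hPsi hmin cPsi hlin hunif cg D0 gD hf fmt et0 slater'.
have [z0 [zT [mz0 mzT hz]]] :=
  gibbs_representation hPsi hmin cPsi hlin hunif cg D0 gD hf fmt et0 slater' hnu hac1 hac2 hmul.
exists lambda, z0, zT, 1.
have mw : measurable_fun setT (gibbs_weight g lambda z0 zT : borel (path_space T d) -> R).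
  apply: (measurableT_comp (@measurable_expR R)); apply: measurable_funB; last first.
    exact: (measurable_time_integral hp cg D0 gD lambda mubar).
  apply: measurable_funB.
    apply: measurable_funN; exact: (measurableT_comp mz0 (@measurable_coord_at R T d _)).
  exact: (measurableT_comp mzT (@measurable_coord_at R T d _)).
have [Z1 Zd] := gibbs_density mw hf hz.
split => //; split => //; exact: has_density_dominates hf.
Qed.
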